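(* For every word $w\in\mathcal B_n^*$ there is a unique orthogonal tableau $P^B(w)$ of type $B$ with $\mathrm w(P^B(w))\sim w$, and for any two words $w_1,w_2\in\mathcal B_n^*$: $$w_1\sim w_2\iff w_1\equiv^B w_2\iff P^B(w_1)=P^B(w_2).$$
   Context: Fix $n\ge2$. $\mathcal B_n=\{1\prec\cdots\prec n\prec0\prec\bar n\prec\cdots\prec\bar1\}$ (total order), $\bar{\bar k}=k$, $\bar0=0$, $x$ unbarred iff $x\preceq n$. Vector crystal: arrows $i\xrightarrow{i}i+1$, $\overline{i+1}\xrightarrow{i}\bar i$ ($1\le i<n$), $n\xrightarrow{n}0\xrightarrow{n}\bar n$ ($a\xrightarrow{i}b$ means $\tilde f_ia=b$). Tensor rule: $\tilde f_i(u\otimes v)=\tilde f_iu\otimes v$ if $\varphi_i(u)>\varepsilon_i(v)$, else $u\otimes\tilde f_iv$; $\tilde e_i(u\otimes v)=u\otimes\tilde e_iv$ if $\varphi_i(u)<\varepsilon_i(v)$, else $\tilde e_iu\otimes v$ ($\varepsilon_i,\varphi_i$ = lengths of $i$-strings). $G_n^B$ is the crystal on $\mathcal B_n^*$ obtained by identifying $u_1\cdots u_l$ with $u_1\otimes\cdots\otimes u_l$. $w_1\sim w_2$ means: the connected components of $w_1,w_2$ are isomorphic as colored graphs and, with $w_j^0$ their highest weight vertices (killed by all $\tilde e_i$), there are $i_1,\dots,i_r$ with $w_j=\tilde f_{i_1}\cdots\tilde f_{i_r}w_j^0$ for $j=1,2$. Columns of type $B$: sequences $x_1,\dots,x_l$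 of letters, strictly increasing except $0$ may repeat; reading $\mathrm w(C)=x_1\cdots x_l$. $N(z)$ (for $z\preceq n$) is the number of letters $x$ of $C$ with $x\preceq z$ or $x\succeq\bar z$. $C$ is admissible if $h(C)\le n$ and for every $z=x_p$, $\bar z=x_q$ with $z\preceq n$, $|q-p|\ge h(C)-z+1$ (equivalently $N(z)\le z$). Orthogonal tableaux: a tabloid $T=C_1\cdots C_r$ is a sequence of columns with $h(C_1)\ge\cdots\ge h(C_r)$ (shape $Y$), reading $\mathrm w(T)=\mathrm w(C_r)\cdots\mathrm w(C_1)$; it is an orthogonal tableau if $\mathrm w(T)$ lies in the connected component of $G_n^B$ containing $\mathrm w(T_Y)$, where $T_Y$ fills each column of height $k$ with $1,\dots,k$. $\equiv^B$ is the smallest congruence on the free monoid $\mathcal B_n^*$ containing: (R1) $yzx\equiv yxz$ and $xzy\equiv zxy$ for $x\prec y\prec z$, $x\ne\bar z$; (R2) for $x\prec y$, $x\ne\bar y$: $xyx\equiv xxy$ if $x\ne0$, and $xyy\equiv yxy$ if $y\ne0$; (R3) for $1\prec x\preceq n$ and $x\preceq y\preceq\bar x$: $y\,\overline{x-1}\,(x-1)\equiv y\,x\,\bar x$ and $x\,\bar x\,y\equiv\overline{x-1}\,(x-1)\,y$; and $0\bar nn\equiv\bar nn0$; (R4) for $x\preceq n$: $00x\equiv0x0$ and $0\bar x0\equiv\bar x00$; (R5) if $w=\mathrm w(C)$ is the reading of a non-admissible column $C$ of type $B$ all of whose proper factors are readings of admissible columns: if $C$ contains some unbarred $z$ with $\bar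 z\in C$ and $N(z)>z$, take the lowest such $z$ and let $\tilde w$ be $w$ with $z$ and $\bar z$ erased; otherwise let $\tilde w$ be $w$ with a letter $0$ erased; then $w\equiv\tilde w$. *)

(* Defs.v *)
From mathcomp Require Import all_boot.
From Stdlib Require Import Relation_Operators.


(* Letters of B_n encoded by their rank (0-based) in the total order
     1 < ... < n < 0 < bar n < ... < bar 1 :
   unbarred k (1<=k<=n) has rank k-1, the letter 0 has rank n,
   bar k has rank 2n+1-k.  Hence bar of rank p is rank 2n-p, and the
   order of B_n is the order on ranks. *)
Definition letter (n : nat) := 'I_(n.*2.+1).
Definition word (n : nat) := seq (letter n).

(* vector crystal: f_i on letters (1 <= i <= n):
   rank i-1 -> rank i  and  rank 2n-i -> rank 2n-i+1
   (for i < n: i -> i+1, bar(i+1) -> bar i; for i = n: n -> 0 -> bar n) *)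
Definition fL (n i : nat) (a : letter n) : option (letter n) :=
  if (1 <= i <= n) && ((a == i.-1 :> nat) || (a == n.*2 - i :> nat))
  then Some (inord a.+1) else None.

Definition eL (n i : nat) (a : letter n) : option (letter n) :=
  if (1 <= i <= n) && ((a == i :> nat) || (a == (n.*2 - i).+1 :> nat))
  then Some (inord a.-1) else None.

Fixpoint strlen {T : Type} (g : T -> option T) (fuel : nat) (x : T) : nat :=
  match fuel with
  | 0 => 0
  | k.+1 => match g x with None => 0 | Some y => (strlen g k y).+1 end
  end.

(* Crystal operators on words u1 ... ul = u1 (x) (u2 (x) ... ), defined by
   recursion on the length l.  eps_i / phi_i are the lengths of i-strings;
   i-strings of a word of length l have length at most 2l, which is the
   fuel used. *)
Fixpoint eW (n i l : nat) (w : word n) {struct l} : option (word n) :=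
  match l, w with
  | l'.+1, a :: v =>
      let eps_v := strlen (eW n i l') (size v).*2 v in
      let phi_a := strlen (fL n i) 2 a in
      if phi_a < eps_v then omap (cons a) (eW n i l' v)
      else omap (fun b => b :: v) (eL n i a)
  | _, _ => None
  end.


Fixpoint fW (n i l : nat) (w : word n) {struct l} : option (word n) :=
  match l, w with
  | l'.+1, a :: v =>
      let eps_v := strlen (eW n i l') (size v).*2 v in
      let phi_a := strlen (fL n i) 2 a in
      if eps_v < phi_a then omap (fun b => b :: v) (fL n i a)
      else omap (cons a) (fW n i l' v)
  | _, _ => None
  end.

Definition fB (n i : nat) (w : word n) : option (word n) := fW n i (size w) w.
Definition eB (n i : nat) (w : word n) : option (word n) := eW n i (size w) w.

Definition edgeB (n : nat) (w w' : word n) : Prop :=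
  exists i, 1 <= i <= n /\ fB n i w = Some w'.

Definition connB (n : nat) : word n -> word n -> Prop :=
  clos_refl_sym_trans (word n) (edgeB n).

Definition highestB (n : nat) (w : word n) : Prop :=
  forall i, 1 <= i <= n -> eB n i w = None.

Definition fseqB (n : nat) (s : seq nat) (w : word n) : option (word n) :=
  foldr (fun i o => obind (fB n i) o) (Some w) s.

Definition compIso (n : nat) (w1 w2 : word n) (phi : word n -> word n) : Prop :=
  [/\ (forall x, connB n w1 x -> connB n w2 (phi x)),
      (forall x y, connB n w1 x -> connB n w1 y -> phi x = phi y -> x = y),
      (forall y, connB n w2 y -> exists2 x, connB n w1 x & phi x = y) &
      (forall x y i, connB n w1 x -> connB n w1 y -> 1 <= i <= n ->
         (fB n i x = Some y <-> fB n i (phi x) = Some (phi y)))].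

Definition simB (n : nat) (w1 w2 : word n) : Prop :=
  (exists phi, compIso n w1 w2 phi) /\
  (exists h1 h2 (s : seq nat),
     [/\ connB n w1 h1, highestB n h1, connB n w2 h2, highestB n h2 &
         fseqB n s h1 = Some w1 /\ fseqB n s h2 = Some w2]).

(* columns of type B (nonempty), reading = the word itself *)
Definition isColumn (n : nat) (c : word n) : bool :=
  (c != [::]) &&
  sorted (fun a b : letter n => (a < b) || ((a == n :> nat) && (b == n :> nat))) c.

(* N(z) for an unbarred letter z of rank z (i.e. the letter z+1) *)
Definition Ncol (n : nat) (c : word n) (z : nat) : nat :=
  count (fun x : letter n => (x <= z) || (n.*2 - z <= x)) c.

(* admissible: h(C) <= n and for z = x_p unbarred, bar z = x_q,
   |q - p| >= h(C) - z + 1   (z as a number = rank + 1) *)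
Definition admissible (n : nat) (c : word n) : Prop :=
  [/\ isColumn n c, size c <= n &
   forall p q, p < size c -> q < size c ->
     let z := nth ord0 c p in let zb := nth ord0 c q in
     z < n -> (zb : nat) = n.*2 - z ->
     (size c).+1 <= (q - p) + (p - q) + z.+1].

Definition readT (n : nat) (T : seq (word n)) : word n := flatten (rev T).

Definition isTabloid (n : nat) (T : seq (word n)) : Prop :=
  all (isColumn n) T /\ sorted geq (map size T).

Definition colTY (n k : nat) : word n := [seq inord i | i <- iota 0 k].

Definition TY (n : nat) (T : seq (word n)) : seq (word n) :=
  [seq colTY n (size C) | C <- T].

(* orthogonal tableau (T_Y only exists when all heights are <= n) *)
Definition orthTab (n : nat) (T : seq (word n)) : Prop :=
  [/\ isTabloid n T, all (fun C => size C <= n) T &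
      connB n (readT n T) (readT n (TY n T))].

Definition badZ (n : nat) (c : word n) (z : letter n) : Prop :=
  [/\ z < n, z \in c, (exists2 zb : letter n, zb \in c & (zb : nat) = n.*2 - z) &
      z.+1 < Ncol n c z].

Inductive elemB (n : nat) : word n -> word n -> Prop :=
| R1a (x y z : letter n) : x < y -> y < z -> (x : nat) <> n.*2 - z ->
    elemB n [:: y; z; x] [:: y; x; z]
| R1b (x y z : letter n) : x < y -> y < z -> (x : nat) <> n.*2 - z ->
    elemB n [:: x; z; y] [:: z; x; y]
| R2a (x y : letter n) : x < y -> (x : nat) <> n.*2 - y -> (x : nat) <> n ->
    elemB n [:: x; y; x] [:: x; x; y]
| R2b (x y : letter n) : x < y -> (x : nat) <> n.*2 - y -> (y : nat) <> n ->
    elemB n [:: x; y; y] [:: y; x; y]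
| R3a (x y a b xb : letter n) : 1 <= x < n -> x <= y -> y <= n.*2 - x ->
    (a : nat) = x.-1 -> (b : nat) = (n.*2 - x).+1 -> (xb : nat) = n.*2 - x ->
    elemB n [:: y; b; a] [:: y; x; xb]
| R3b (x y a b xb : letter n) : 1 <= x < n -> x <= y -> y <= n.*2 - x ->
    (a : nat) = x.-1 -> (b : nat) = (n.*2 - x).+1 -> (xb : nat) = n.*2 - x ->
    elemB n [:: x; xb; y] [:: b; a; y]
| R3c (z0 nb nn : letter n) : (z0 : nat) = n -> (nb : nat) = n.+1 ->
    (nn : nat) = n.-1 -> elemB n [:: z0; nb; nn] [:: nb; nn; z0]
| R4a (z0 x : letter n) : (z0 : nat) = n -> x < n ->
    elemB n [:: z0; z0; x] [:: z0; x; z0]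
| R4b (z0 x xb : letter n) : (z0 : nat) = n -> x < n -> (xb : nat) = n.*2 - x ->
    elemB n [:: z0; xb; z0] [:: xb; z0; z0]
| R5a (w : word n) (z zb : letter n) :
    isColumn n w -> ~ admissible n w ->
    (forall u v x, w = u ++ x ++ v -> x != [::] -> size x < size w -> admissible n x) ->
    badZ n w z -> (forall z', badZ n w z' -> z <= z') -> (zb : nat) = n.*2 - z ->
    elemB n w (rem zb (rem z w))
| R5b (w : word n) (z0 : letter n) :
    isColumn n w -> ~ admissible n w ->
    (forall u v x, w = u ++ x ++ v -> x != [::] -> size x < size w -> admissible n x) ->
    (forall z, ~ badZ n w z) -> (z0 : nat) = n ->
    elemB n w (rem z0 w).

Definition stepB (n : nat) (a b : word n) : Prop :=
  exists u v x y, [/\ elemB n x y, a = u ++ x ++ v & b = u ++ y ++ v].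

Definition congB (n : nat) : word n -> word n -> Prop :=
  clos_refl_sym_trans (word n) (@stepB n).

(* Main.v *)
(** The congruence is generated by relations that commute with the crystal operators, so congruent
    words occupy the same place in isomorphic components. For (R5) a column is read as a lattice path
    whose height at [z] is [N(z) - z], each letter 0 being a final up step: [w] is as in (R5) exactly
    when the path has maximum 1, and the relation erases the step at which height 1 is first reached.
    Conversely a highest weight word is congruent to the highest weight tableau of its weight: append
    its letters one by one and push each of them through the columns [1 2 ... m].
    It remains to see that a component has only one highest weight word. Replacing each letter by two
    columns of a 0/1 matrix with [2n] rows turns [f_i] into [f_i f_{2n-i}] (or [f_n] if [i = n]) in
    type A. There the row operators commute with the operators acting on pairs of adjacent columns;
    a matrix that is highest for both is a Young diagram, hence determined by its column sums, which
    the row operators preserve. *)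

(* Uniqueness of the highest weight word concerns whole components, and the axioms of strings alone
   do not imply it. Type A supplies it because a matrix carries a second family of operators, which
   moves a whole component to another one while pushing entries to the left; the process stops only
   at matrices that are highest for both families. Given uniqueness, the theorem becomes formal.
   Congruent words are reached from congruent highest weight words by the same sequence of
   operators, so congruent words of one component are equal. Hence sending a word to the congruent
   word of another component is well defined, and this is the required isomorphism. Conversely an
   isomorphism preserves the lengths of strings, hence all [wphi] of highest weight words; these
   determine the highest weight tableau, so both highest weight words are congruent to the same one.
   An orthogonal tableau is recovered likewise: its shape from the top of its component, its columns
   by cutting the reading at the column heights. *)
Require Import Defs.
From mathcomp Require Import all_boot zify.
From Stdlib Require Import Relation_Operators.

Set Implicit Arguments.
Unset Strict Implicit.
Unset Printing Implicit Defensive.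

(** * Tensor products of strings and the vector crystal *)

(* [up] and [dn] are total; their values matter only where [eps], resp. [phi], is positive. *)
Record sl2 (T : Type) := Sl2
  { eps : T -> nat; phi : T -> nat; up : T -> T; dn : T -> T }.

Definition sl2_ax (T : Type) (C : sl2 T) := forall x,
  (0 < phi C x -> [/\ eps C (dn C x) = (eps C x).+1,
                      (phi C (dn C x)).+1 = phi C x & up C (dn C x) = x]) /\
  (0 < eps C x -> [/\ phi C (up C x) = (phi C x).+1,
                      (eps C (up C x)).+1 = eps C x & dn C (up C x) = x]).

Section Tensor.
Variables (T : Type) (C : sl2 T).

(** Truncated subtraction carries out the cancellation of the signature rule: the [phi] of a factor
    cancels against the [eps] of the factors to its right. *)
Fixpoint weps (w : seq T) :=
  if w is a :: v then eps C a + (weps v - phi C a) else 0.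
Fixpoint wphi (w : seq T) :=
  if w is a :: v then wphi v + (phi C a - weps v) else 0.
Fixpoint wup (w : seq T) :=
  if w is a :: v then
    if phi C a < weps v then a :: wup v else up C a :: v
  else [::].
Fixpoint wdn (w : seq T) :=
  if w is a :: v then
    if weps v < phi C a then dn C a :: v else a :: wdn v
  else [::].

Definition tens := Sl2 weps wphi wup wdn.

Lemma weps_cat u v : weps (u ++ v) = weps u + (weps v - wphi u).
Proof. elim: u => [|a u IH] /=; first by lia. rewrite IH; lia. Qed.

Lemma wphi_cat u v : wphi (u ++ v) = wphi v + (wphi u - weps v).
Proof. elim: u => [|a u IH] /=; first by lia. rewrite IH weps_cat; lia. Qed.

Lemma wdn_cat u v :
  wdn (u ++ v) = if weps v < wphi u then wdn u ++ v else u ++ wdn v.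
Proof.
elim: u => [|a u IH] /=; first by [].
rewrite IH weps_cat.
have [h1|h1] := ltnP (weps u) (phi C a).
  case: ifP => h2; case: ifP => h3 //; try lia.
  by case: ifP => h4 //; lia.
case: ifP => h2; first lia.
by case: ifP => h3; case: ifP => h4 //; lia.
Qed.

(** When [weps] vanishes, [wup] still applies [up] to the first letter and would split differently;
    [wdn] leaves a word unchanged when [wphi] vanishes. *)
Lemma wup_cat u v : 0 < weps (u ++ v) ->
  wup (u ++ v) = if wphi u < weps v then u ++ wup v else wup u ++ v.
Proof.
elim: u => [|a u IH] /=; first by case: ltnP => //; lia.
rewrite weps_cat => h0.
have [h1|h1] := ltnP (phi C a) (weps u).
  rewrite IH; last by rewrite weps_cat; lia.
  case: ifP => h2; last lia.
  by case: ifP => h3; case: ifP => h4 //; lia.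
case: ifP => h2; last by case: ifP => h3 //; lia.
rewrite IH; last by rewrite weps_cat; lia.
by case: ifP => h3; case: ifP => h4 //; lia.
Qed.

Lemma tens_ax : sl2_ax C -> sl2_ax tens.
Proof.
move=> ax; elim=> [|a v [IH1 IH2]] /=; first by [].
have [a1 a2] := ax a.
split=> h.
  case: ifP => h1 /=.
    have [] := a1 ltac:(lia) => e1 e2 e3.
    by split; [lia|lia|rewrite e3; case: ifP => //; lia].
  have [] := IH1 ltac:(simpl; lia) => /= e1 e2 e3.
  by split; [lia|lia|rewrite e3; case: ifP => //; lia].
case: ifP => h1 /=.
  have [] := IH2 ltac:(simpl; lia) => /= e1 e2 e3.
  by split; [lia|lia|rewrite e3; case: ifP => //; lia].
have [] := a2 ltac:(lia) => e1 e2 e3.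
by split; [lia|lia|rewrite e3; case: ifP => //; lia].
Qed.

End Tensor.

(* Letters are ranks, as in [letter n]; the conjuncts [i == n] account for the string of length 2. *)
Definition Lc (n i : nat) : sl2 nat :=
  Sl2 (fun a => (a == i) + (a == (n.*2 - i).+1) + ((a == (n.*2 - i).+1) && (i == n)))
      (fun a => (a == i.-1) + ((a == i.-1) && (i == n)) + (a == n.*2 - i))
      predn S.

Lemma epsE n i a : eps (Lc n i) a =
  (a == i) + (a == (n.*2 - i).+1) + ((a == (n.*2 - i).+1) && (i == n)).
Proof. by []. Qed.

Lemma phiE n i a : phi (Lc n i) a =
  (a == i.-1) + ((a == i.-1) && (i == n)) + (a == n.*2 - i).
Proof. by []. Qed.

Lemma upE n i a : up (Lc n i) a = a.-1. Proof. by []. Qed.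
Lemma dnE n i a : dn (Lc n i) a = a.+1. Proof. by []. Qed.

Opaque Lc.

(** The cases follow the arrows i -> i+1 and bar(i+1) -> bar i for [i < n], then the string n -> 0
    -> bar n for [i = n], then the inert letters. *)
Variant Lc_spec n i a : nat -> nat -> Prop :=
| LcL of i < n & a = i.-1 : Lc_spec n i a 0 1
| LcL' of i < n & a = i : Lc_spec n i a 1 0
| LcR' of i < n & a = n.*2 - i : Lc_spec n i a 0 1
| LcR of i < n & a = (n.*2 - i).+1 : Lc_spec n i a 1 0
| LcN of i = n & a = n.-1 : Lc_spec n i a 0 2
| Lc0 of i = n & a = n : Lc_spec n i a 1 1
| LcNb of i = n & a = n.+1 : Lc_spec n i a 2 0
| LcO of a <> i.-1 & a <> i & a <> n.*2 - i & a <> (n.*2 - i).+1 : Lc_spec n i a 0 0.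

Lemma eqn_false (a b : nat) : a <> b -> (a == b) = false.
Proof. by move/eqP/negbTE. Qed.

Lemma LcP n i a : 1 <= i <= n -> Lc_spec n i a (eps (Lc n i) a) (phi (Lc n i) a).
Proof.
move=> /andP[hi hin]; rewrite epsE phiE.
have [hn|hn] := eqVneq i n.
  have e : n.*2 - i = n by lia.
  rewrite e hn; subst i.
  have [->|h1] := eqVneq a n.-1.
    rewrite (@eqn_false n.-1 n) ?(@eqn_false n.-1 n.+1); [|lia|lia].
    by apply: LcN.
  have [->|h2] := eqVneq a n.
    rewrite (@eqn_false n n.+1); [|lia].
    by apply: Lc0.
  have [->|h3] := eqVneq a n.+1; first exact: LcNb.
  by apply: LcO; rewrite ?e; apply/eqP.
rewrite !andbF !addn0.
have {}hn : i < n by lia.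
have [->|h1] := eqVneq a i.-1.
  rewrite (@eqn_false i.-1 i) ?(@eqn_false i.-1 (n.*2 - i)) ?(@eqn_false i.-1 (n.*2 - i).+1); [|lia..].
  by apply: LcL; lia.
have [->|h2] := eqVneq a i.
  rewrite (@eqn_false i (n.*2 - i)) ?(@eqn_false i (n.*2 - i).+1); [|lia..].
  by apply: LcL'; lia.
have [->|h3] := eqVneq a (n.*2 - i).
  rewrite (@eqn_false (n.*2 - i) (n.*2 - i).+1); [|lia..].
  by apply: LcR'; lia.
have [->|h4] := eqVneq a (n.*2 - i).+1; first by apply: LcR; lia.
by apply: LcO; apply/eqP.
Qed.

Lemma Lc_val n i a e f : 1 <= i <= n -> Lc_spec n i a e f ->
  (eps (Lc n i) a = e) * (phi (Lc n i) a = f).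
Proof.
move=> hi h; have := LcP a hi.
by case: h => *; subst; match goal with H : Lc_spec _ _ _ _ _ |- _ => 
  case: H => * end; split; lia.
Qed.

Lemma Lc_dn n i a : 1 <= i <= n -> 0 < phi (Lc n i) a ->
  (eps (Lc n i) a.+1 = (eps (Lc n i) a).+1) * ((phi (Lc n i) a.+1).+1 = phi (Lc n i) a).
Proof.
move=> hi; case: (LcP a hi) => // h1 h2 _.
- by rewrite !(Lc_val hi (@LcL' n i _ h1 _)) //; lia.
- by rewrite !(Lc_val hi (@LcR n i _ h1 _)) //; lia.
- by rewrite !(Lc_val hi (@Lc0 n i _ h1 _)) //; lia.
- by rewrite !(Lc_val hi (@LcNb n i _ h1 _)) //; lia.
Qed.

Lemma Lc_up n i a : 1 <= i <= n -> 0 < eps (Lc n i) a ->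
  0 < a /\ 0 < phi (Lc n i) a.-1.
Proof.
move=> hi; case: (LcP a hi) => // h1 h2 _; split; try lia.
- by rewrite !(Lc_val hi (@LcL n i _ h1 _)) //; lia.
- by rewrite !(Lc_val hi (@LcR' n i _ h1 _)) //; lia.
- by rewrite !(Lc_val hi (@LcN n i _ h1 _)) //; lia.
- by rewrite !(Lc_val hi (@Lc0 n i _ h1 _)) //; lia.
Qed.

Lemma Lc_ax n i : 1 <= i <= n -> sl2_ax (Lc n i).
Proof.
move=> hi x; split=> h.
  by have [e f] := Lc_dn hi h; rewrite dnE; split.
have [h0 h1] := Lc_up hi h; have [] := Lc_dn hi h1.
rewrite upE dnE prednK // => e f; split=> //; exact: prednK.
Qed.

Lemma Wc_ax n i : 1 <= i <= n -> sl2_ax (tens (Lc n i)).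
Proof. by move=> h; apply/tens_ax/Lc_ax. Qed.

Lemma wdn_spec n i w : 1 <= i <= n -> 0 < wphi (Lc n i) w ->
  [/\ weps (Lc n i) (wdn (Lc n i) w) = (weps (Lc n i) w).+1,
     (wphi (Lc n i) (wdn (Lc n i) w)).+1 = wphi (Lc n i) w &
     wup (Lc n i) (wdn (Lc n i) w) = w].
Proof. by move=> hi; have [] := Wc_ax hi w. Qed.

Lemma wup_spec n i w : 1 <= i <= n -> 0 < weps (Lc n i) w ->
  [/\ wphi (Lc n i) (wup (Lc n i) w) = (wphi (Lc n i) w).+1,
     (weps (Lc n i) (wup (Lc n i) w)).+1 = weps (Lc n i) w &
     wdn (Lc n i) (wup (Lc n i) w) = w].
Proof. by move=> hi; have [] := Wc_ax hi w. Qed.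

Definition bnd n (w : seq nat) := all (fun a => a <= n.*2) w.

Lemma bnd_dn n i w : 1 <= i <= n -> bnd n w -> bnd n (wdn (Lc n i) w).
Proof.
move=> hi; elim: w => [//|a v IH] /= /andP[ha hv].
case: ifP => h /=; last by rewrite ha IH.
rewrite hv andbT; have : 0 < phi (Lc n i) a by exact: leq_ltn_trans h.
by rewrite dnE; case: (LcP a hi) => // *; lia.
Qed.

Lemma bnd_up n i w : bnd n w -> bnd n (wup (Lc n i) w).
Proof.
elim: w => [//|a v IH] /= /andP[ha hv].
by case: ifP => h /=; [rewrite ha IH|rewrite hv andbT upE; lia].
Qed.

Lemma weps_size n i w : 1 <= i <= n -> weps (Lc n i) w <= (size w).*2.
Proof.
move=> hi; elim: w => [//|a v IH].
by rewrite /= doubleS; case: (LcP a hi); lia.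
Qed.

(** * Agreement of the total operators with [eB] and [fB] *)

Section Bridge.
Variables (n i : nat).
Hypothesis hi : 1 <= i <= n.
Implicit Types w : word n.

Definition ranks w : seq nat := [seq nat_of_ord a | a <- w].
Arguments ranks : simpl never.
Lemma ranks_cons (a : letter n) w : ranks (a :: w) = nat_of_ord a :: ranks w.
Proof. by []. Qed.
Definition letters (s : seq nat) : word n := [seq inord a | a <- s].

Lemma ranks_bnd w : bnd n (ranks w).
Proof. by apply/allP => _ /mapP[a _ ->]; rewrite -ltnS ltn_ord. Qed.

Lemma ranks_inj : injective ranks.
Proof. exact/inj_map/ord_inj. Qed.

Lemma lettersK s : bnd n s -> ranks (letters s) = s.
Proof.
move=> h; rewrite /ranks /letters -map_comp -[RHS]map_id; apply/eq_in_map => a /(allP h) ha.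
by rewrite /= inordK.
Qed.

Lemma ranksK w : letters (ranks w) = w.
Proof. by apply: ranks_inj; rewrite lettersK ?ranks_bnd. Qed.

Lemma fLE (a : letter n) :
  fL n i a = if 0 < phi (Lc n i) a then Some (inord a.+1) else None.
Proof.
by rewrite /fL hi phiE; congr (if _ then _ else _); lia.
Qed.

Lemma eLE (a : letter n) :
  eL n i a = if 0 < eps (Lc n i) a then Some (inord a.-1) else None.
Proof.
by rewrite /eL hi epsE; congr (if _ then _ else _); lia.
Qed.

(** A potential that drops by one along [g] and vanishes where [g] stops measures the string, as
    soon as the fuel reaches it. *)
Lemma strlen_eps (T : Type) (g : T -> option T) (e : T -> nat) (P : T -> Prop) :
  (forall x, P x -> match g x with
    Some y => P y /\ (e y).+1 = e x | None => e x = 0 end) ->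
  forall k x, P x -> e x <= k -> strlen g k x = e x.
Proof.
move=> h; elim=> [|k IH] x Px hk /=; first lia.
have := h x Px; case: (g x) => [y [Py hy]|->//].
by rewrite IH //; lia.
Qed.

Lemma strlen_fL (a : letter n) : strlen (fL n i) 2 a = phi (Lc n i) a.
Proof.
apply: (@strlen_eps _ _ (fun x : letter n => phi (Lc n i) x) (fun _ => True)) => //=;
  last by case: (LcP a hi).
move=> x _; rewrite fLE; case: ifP => [h|]; last by lia.
split=> //; rewrite -(Lc_dn hi h).2 inordK //.
by have := ltn_ord x; move: h; case: (LcP x hi) => //; lia.
Qed.

Lemma eW_cons l (a : letter n) v : eW n i l.+1 (a :: v) =
  if strlen (fL n i) 2 a < strlen (eW n i l) (size v).*2 v
  then omap (cons a) (eW n i l v) else omap (fun b => b :: v) (eL n i a).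
Proof. by []. Qed.

Lemma fW_cons l (a : letter n) v : fW n i l.+1 (a :: v) =
  if strlen (eW n i l) (size v).*2 v < strlen (fL n i) 2 a
  then omap (fun b => b :: v) (fL n i a) else omap (cons a) (fW n i l v).
Proof. by []. Qed.

(** The two claims need each other: the operator at length [l.+1] branches on the string length at
    length [l], and that string length is read off the operator. *)
Lemma eW_step l w : size w = l ->
  eW n i l w = (if 0 < weps (Lc n i) (ranks w) then Some (letters (wup (Lc n i) (ranks w))) else None)
  /\ (strlen (eW n i l) (size w).*2 w = weps (Lc n i) (ranks w)).
Proof.
elim: l w => [|l IH] w hw.
  by rewrite (size0nil hw).
have A w' : size w' = l.+1 ->
  eW n i l.+1 w' = if 0 < weps (Lc n i) (ranks w') then Some (letters (wup (Lc n i) (ranks w'))) else None.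
  case: w' => // a v [hv].
  have [I1 I2] := IH v hv.
  rewrite eW_cons I2 strlen_fL I1 eLE ranks_cons.
  rewrite [wup _ _]/= [weps (Lc n i) (_ :: _)]/=.
  have [h|h] := ltnP (phi (Lc n i) a) (weps (Lc n i) (ranks v)).
    case: (ltnP 0 (weps (Lc n i) (ranks v))) => h1 /=; last by lia.
    case: ifP => h2; last by lia.
    by rewrite h /letters /= inord_val.
  have -> : (weps (Lc n i) (ranks v) - phi (Lc n i) a) = 0 by lia.
  rewrite addn0; case: ifP => h1 //=.
  by rewrite ltnNge h /letters /= -/(letters _) ranksK upE.
split; first exact: A.
(* The string stays among words of length [l.+1], the length for which the recursion counter is
   right. *)
apply: (@strlen_eps _ _ (fun w' => weps (Lc n i) (ranks w')) (fun w' => size w' = l.+1)) => //;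
  last first.
  by have := weps_size (ranks w) hi; rewrite size_map.
move=> x hx; rewrite A //; case: ifP => h; last by lia.
have [_ /(_ h)[_ h2 _]] := Wc_ax hi (ranks x).
rewrite lettersK ?bnd_up ?ranks_bnd //; split=> //.
rewrite size_map; rewrite -hx -(size_map (@nat_of_ord _) x) -/(ranks x).
elim: (ranks x) => //= a v IHv; by case: ifP => //= _; rewrite IHv.
Qed.

Lemma eB_wup w : eB n i w =
  if 0 < weps (Lc n i) (ranks w) then Some (letters (wup (Lc n i) (ranks w))) else None.
Proof. exact: (proj1 (@eW_step (size w) w erefl)). Qed.

Lemma fB_wdn w : fB n i w =
  if 0 < wphi (Lc n i) (ranks w) then Some (letters (wdn (Lc n i) (ranks w))) else None.
Proof.
rewrite /fB; elim: w => [//|a v IH].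
rewrite [size _]/= fW_cons (proj2 (@eW_step (size v) v erefl)) strlen_fL fLE IH ranks_cons.
rewrite [wdn _ _]/= [wphi (Lc n i) (_ :: _)]/=.
have [h|h] := ltnP (weps (Lc n i) (ranks v)) (phi (Lc n i) a).
  rewrite ifT; last by lia.
  rewrite ifT; last by lia.
  by rewrite /= dnE; congr Some; rewrite -[in LHS](ranksK v) h.
have -> : (phi (Lc n i) a - weps (Lc n i) (ranks v)) = 0 by lia.
rewrite addn0; case: ifP => h1 //=.
by rewrite ltnNge h /= inord_val.
Qed.

Lemma fBP w w' : fB n i w = Some w' <->
  0 < wphi (Lc n i) (ranks w) /\ ranks w' = wdn (Lc n i) (ranks w).
Proof.
rewrite fB_wdn; case: ltnP => h; split=> //; try by case.
- by move=> [<-]; rewrite lettersK // bnd_dn ?ranks_bnd.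
- by case=> _ h2; congr Some; apply: ranks_inj; rewrite lettersK ?h2 ?bnd_dn ?ranks_bnd.
Qed.

Lemma eBP w w' : eB n i w = Some w' <->
  0 < weps (Lc n i) (ranks w) /\ ranks w' = wup (Lc n i) (ranks w).
Proof.
rewrite eB_wup; case: ltnP => h; split=> //; try by case.
- by move=> [<-]; rewrite lettersK // bnd_up ?ranks_bnd.
- by case=> _ h2; congr Some; apply: ranks_inj; rewrite lettersK ?h2 ?bnd_up ?ranks_bnd.
Qed.

Lemma eB_None w : eB n i w = None <-> weps (Lc n i) (ranks w) = 0.
Proof. by rewrite eB_wup; case: ltnP => h; split=> //; lia. Qed.

Lemma fBK w w' : fB n i w = Some w' <-> eB n i w' = Some w.
Proof.
rewrite fBP eBP; split=> -[h e].
- by have [] := wdn_spec hi h; rewrite -e => -> _ <-.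
- by have [] := wup_spec hi h; rewrite -e => -> _ <-.
Qed.
End Bridge.
Arguments ranks {n} w : simpl never.

(** * Binary matrices and their commuting row and column operators *)

Definition set2 (P : nat) (c : seq bool) (x y : bool) :=
  take P c ++ [:: x; y] ++ drop P.+2 c.

(* A column of a binary matrix is listed from the bottom row to the top row, so that
   the row operator at position [P] raises an entry from position [P] to [P.+1]. *)
Definition Col (P : nat) : sl2 (seq bool) :=
  Sl2 (fun c => nth false c P && ~~ nth false c P.+1 : nat)
      (fun c => ~~ nth false c P && nth false c P.+1 : nat)
      (fun c => set2 P c false true)
      (fun c => set2 P c true false).

(** A letter is one row of two adjacent columns, so the two columns become a word over their rows,
    bottom row first; [dn] moves an entry from the first column to the second. *)
Definition Row : sl2 (bool * bool) :=
  Sl2 (fun p => ~~ p.1 && p.2 : nat) (fun p => p.1 && ~~ p.2 : nat)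
      (fun=> (true, false)) (fun=> (false, true)).

Lemma Row_ax : sl2_ax Row.
Proof. by case=> [[] []]; split. Qed.

Definition cols (z : seq (bool * bool)) := [:: unzip1 z; unzip2 z].

Lemma nth_at (T : Type) (d : T) A x s : nth d (A ++ x :: s) (size A) = x.
Proof. by rewrite nth_cat ltnn subnn. Qed.

Lemma nth_atS (T : Type) (d : T) A x y s : nth d (A ++ x :: y :: s) (size A).+1 = y.
Proof. by rewrite nth_cat ltnNge leqnSn subSnn. Qed.

Lemma set2_at A x y s x' y' : set2 (size A) (A ++ x :: y :: s) x' y' = A ++ x' :: y' :: s.
Proof.
rewrite /set2 take_size_cat //.
by rewrite (_ : A ++ x :: y :: s = (A ++ [:: x; y]) ++ s) ?drop_size_cat ?size_cat -?catA //= addn2.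
Qed.

Section Block.
Variables (z1 z3 : seq (bool * bool)).
Local Notation P := (size z1).
Implicit Types p q : bool * bool.

Local Notation W b := (cols (z1 ++ b ++ z3)).

Lemma nth_unzip1 x y : nth false (unzip1 (z1 ++ [:: x; y] ++ z3)) P = x.1.
Proof. by rewrite /unzip1 map_cat -(size_map fst z1) nth_at. Qed.
Lemma nth_unzip2 x y : nth false (unzip2 (z1 ++ [:: x; y] ++ z3)) P = x.2.
Proof. by rewrite /unzip2 map_cat -(size_map snd z1) nth_at. Qed.
Lemma nth_unzip1S x y : nth false (unzip1 (z1 ++ [:: x; y] ++ z3)) P.+1 = y.1.
Proof. by rewrite /unzip1 map_cat -(size_map fst z1) nth_atS. Qed.
Lemma nth_unzip2S x y : nth false (unzip2 (z1 ++ [:: x; y] ++ z3)) P.+1 = y.2.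
Proof. by rewrite /unzip2 map_cat -(size_map snd z1) nth_atS. Qed.
Lemma set2_unzip1 x y a b : set2 P (unzip1 (z1 ++ [:: x; y] ++ z3)) a b =
  unzip1 (z1 ++ [:: (a, x.2); (b, y.2)] ++ z3).
Proof. by rewrite /unzip1 !map_cat -(size_map fst z1) set2_at. Qed.
Lemma set2_unzip2 x y a b : set2 P (unzip2 (z1 ++ [:: x; y] ++ z3)) a b =
  unzip2 (z1 ++ [:: (x.1, a); (y.1, b)] ++ z3).
Proof. by rewrite /unzip2 !map_cat -(size_map snd z1) set2_at. Qed.

Definition beps p q : nat := (p.1 && ~~ q.1 : nat) + ((p.2 && ~~ q.2 : nat) - (~~ p.1 && q.1 : nat)).
Definition bphi p q : nat := (~~ p.2 && q.2 : nat) + ((~~ p.1 && q.1 : nat) - (p.2 && ~~ q.2 : nat)).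
Definition bdn p q := if (p.2 && ~~ q.2 : nat) < (~~ p.1 && q.1 : nat)
  then [:: (true, p.2); (false, q.2)] else
  if ~~ p.2 && q.2 then [:: (p.1, true); (q.1, false)] else [:: p; q].

Lemma weps_block p q : weps (Col P) (W [:: p; q]) = beps p q.
Proof. by rewrite [LHS]/= nth_unzip1 nth_unzip1S nth_unzip2 nth_unzip2S sub0n addn0. Qed.

Lemma wphi_block p q : wphi (Col P) (W [:: p; q]) = bphi p q.
Proof. by rewrite [LHS]/= nth_unzip1 nth_unzip1S nth_unzip2 nth_unzip2S subn0 sub0n addn0. Qed.

Lemma wdn_block p q : 0 < bphi p q -> wdn (Col P) (W [:: p; q]) = W (bdn p q).
Proof.
rewrite [X in _ -> X = _]/= nth_unzip1 nth_unzip1S nth_unzip2 nth_unzip2S sub0n addn0 set2_unzip1 set2_unzip2 /bphi /bdn.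
by case: p q => [[] []] [[] []] //=; rewrite /cols /unzip1 /unzip2 !map_cat.
Qed.

(** With [bdn_up], this is commutation on a single 2x2 block, settled by inspecting the sixteen 0/1
    matrices; longer columns reduce to it through the signature rule. *)
Lemma bdn_inv p q : 0 < bphi p q ->
  (weps Row (bdn p q) = weps Row [:: p; q]) * (wphi Row (bdn p q) = wphi Row [:: p; q]).
Proof. by case: p q => [[] []] [[] []]. Qed.

Lemma bdn_up p q : 0 < weps Row [:: p; q] ->
  exists p' q', [/\ wup Row [:: p; q] = [:: p'; q'], beps p' q' = beps p q,
    bphi p' q' = bphi p q & 0 < bphi p q -> wup Row (bdn p q) = bdn p' q'].
Proof. by case: p q => [[] []] [[] []] // _; do 2 eexists; split. Qed.
End Block.

Lemma bdn_size p q : size (bdn p q) = 2.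
Proof. by rewrite /bdn; case: ifP => // _; case: ifP. Qed.

Lemma size_wup (T : Type) (C : sl2 T) w : size (wup C w) = size w.
Proof. by elim: w => //= a v IH; case: ifP => //= _; rewrite IH. Qed.
Lemma size_wdn (T : Type) (C : sl2 T) w : size (wdn C w) = size w.
Proof. by elim: w => //= a v IH; case: ifP => //= _; rewrite IH. Qed.

Lemma split_block P (z : seq (bool * bool)) : P.+1 < size z ->
  exists z1 p q z3, z = z1 ++ [:: p; q] ++ z3 /\ P = size z1.
Proof.
move=> hP; exists (take P z), (nth (true, true) z P), (nth (true, true) z P.+1), (drop P.+2 z).
rewrite size_take (_ : P < size z); last by lia.
by split=> //=; rewrite -!drop_nth // ?cat_take_drop //; lia.
Qed.

(* The column operator on two adjacent columns commutes with every row operator: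
   a row operator only alters a 2x2 block, without changing the signature of that block. *)
Lemma pair_commute P z : P.+1 < size z -> 0 < weps Row z ->
  [/\ weps (Col P) (cols (wup Row z)) = weps (Col P) (cols z),
      wphi (Col P) (cols (wup Row z)) = wphi (Col P) (cols z) &
      0 < wphi (Col P) (cols z) -> exists z',
        [/\ wdn (Col P) (cols z) = cols z', size z' = size z, weps Row z' = weps Row z &
            wdn (Col P) (cols (wup Row z)) = cols (wup Row z')]].
Proof.
move=> hP.
have [z1 [p [q [z3 [-> eP]]]]] := split_block hP.
rewrite eP => {eP hP P z} h0.
have cat3 b : 0 < weps Row (z1 ++ b ++ z3) -> wup Row (z1 ++ b ++ z3) =
   if wphi Row z1 < weps Row (b ++ z3) then
     z1 ++ (if wphi Row b < weps Row z3 then b ++ wup Row z3 else wup Row b ++ z3)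
   else wup Row z1 ++ b ++ z3.
  move=> h; rewrite wup_cat //; case: ifP => // h1.
  by rewrite [wup Row (b ++ z3)]wup_cat //; apply: leq_ltn_trans h1.
have inv b b' : weps Row b = weps Row b' -> wphi Row b = wphi Row b' ->
   weps Row (z1 ++ b ++ z3) = weps Row (z1 ++ b' ++ z3).
  by move=> e f; rewrite !weps_cat e f.
rewrite cat3 // weps_block wphi_block.
set b := [:: p; q].
have hb : 0 < bphi p q -> weps Row (z1 ++ bdn p q ++ z3) = weps Row (z1 ++ b ++ z3).
  by move=> h; apply: inv; rewrite (bdn_inv h).
have sz : size (z1 ++ bdn p q ++ z3) = size (z1 ++ b ++ z3).
  by rewrite !size_cat bdn_size.
have ew : 0 < bphi p q ->
   weps Row (bdn p q ++ z3) = weps Row (b ++ z3).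
  by move=> h; rewrite !weps_cat !(bdn_inv h).
(* The column operator acts in [z3], in the block or in [z1]; the row operator alters only the
   block, so only the middle case needs [bdn_up]. *)
case: ifP => h1.
  case: ifP => h2.
    rewrite weps_block wphi_block; split=> // h; exists (z1 ++ bdn p q ++ z3).
    split; [exact: wdn_block|exact: sz|exact: hb|].
    by rewrite wdn_block // cat3 ?hb // ew // h1 (bdn_inv h).2 h2.
  have h3 : 0 < weps Row b.
    by move: h1 h2; rewrite weps_cat; case: (weps Row b) => //; lia.
  have [p' [q' [e1 e2 e3 e4]]] := bdn_up h3.
  rewrite e1 weps_block wphi_block e2 e3; split=> // h; exists (z1 ++ bdn p q ++ z3).
  split; [exact: wdn_block|exact: sz|exact: hb|].
  by rewrite wdn_block ?e3 // cat3 ?hb // ew // h1 (bdn_inv h).2 h2 e4.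
have es : size z1 = size (wup Row z1) by rewrite size_wup.
rewrite es weps_block wphi_block; split=> // h; exists (z1 ++ bdn p q ++ z3).
rewrite -{1}es; split; [exact: wdn_block|exact: sz|exact: hb|].
by rewrite wdn_block // cat3 ?hb // ew // h1.
Qed.

Lemma pair_dn P z : P.+1 < size z -> 0 < wphi (Col P) (cols z) -> exists z',
  wdn (Col P) (cols z) = cols z' /\ weps Row z' = weps Row z.
Proof.
move=> hP.
have [z1 [p [q [z3 [-> ->]]]]] := split_block hP.
rewrite wphi_block => h; exists (z1 ++ bdn p q ++ z3); rewrite wdn_block //; split=> //.
by rewrite !weps_cat !(bdn_inv h).
Qed.

(** * Matrices under both families of operators, and uniqueness of the highest matrix *)

Section Matrix.
Variable N : nat.
Definition matrix := seq (seq bool).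
Implicit Types M : matrix.

Definition wf M := all (fun c => size c == N) M.

Definition redge P M M' := [/\ P.+1 < N, 0 < wphi (Col P) M & M' = wdn (Col P) M].

Definition pairof j M := zip (nth [::] M j) (nth [::] M j.+1).
Definition cup j M := take j M ++ cols (wup Row (pairof j M)) ++ drop j.+2 M.
Definition cdn j M := take j M ++ cols (wdn Row (pairof j M)) ++ drop j.+2 M.
Definition ceps j M := weps Row (pairof j M).

Lemma size_set2 P c x y : P.+1 < size c -> size (set2 P c x y) = size c.
Proof. by move=> h; rewrite /set2 !size_cat size_take size_drop ifT /=; lia. Qed.

Lemma wf_wdn P M : P.+1 < N -> wf M -> wf (wdn (Col P) M).
Proof.
move=> hP; elim: M => //= c M IH /andP[/eqP hc hM].
by case: ifP => /= h; rewrite ?IH // ?hM ?size_set2 ?hc ?eqxx.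
Qed.

Lemma pairof_cat u c c' v : pairof (size u) (u ++ [:: c; c'] ++ v) = zip c c'.
Proof. by rewrite /pairof /= nth_at nth_atS. Qed.

Lemma cup_cat u z v : cup (size u) (u ++ cols z ++ v) = u ++ cols (wup Row z) ++ v.
Proof.
rewrite /cup pairof_cat zip_unzip take_size_cat //; congr (_ ++ (_ ++ _)).
by rewrite catA drop_size_cat // size_cat addn2.
Qed.

Lemma cdn_cat u z v : cdn (size u) (u ++ cols z ++ v) = u ++ cols (wdn Row z) ++ v.
Proof.
rewrite /cdn pairof_cat zip_unzip take_size_cat //; congr (_ ++ (_ ++ _)).
by rewrite catA drop_size_cat // size_cat addn2.
Qed.

Lemma ceps_cat u z v : ceps (size u) (u ++ cols z ++ v) = weps Row z.
Proof. by rewrite /ceps pairof_cat zip_unzip. Qed.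

Lemma split_pair j M : wf M -> j.+1 < size M ->
  exists u z v, [/\ M = u ++ cols z ++ v, j = size u, size z = N & wf (u ++ v)].
Proof.
move=> wM hj; exists (take j M), (pairof j M), (drop j.+2 M).
have hc k : k < size M -> size (nth [::] M k) = N.
  by move=> hk; apply/eqP; move/all_nthP: wM; apply.
rewrite /cols unzip1_zip ?unzip2_zip ?hc //; try lia.
split.
- by rewrite /= -!drop_nth ?cat_take_drop //; lia.
- by rewrite size_takel //; lia.
- by rewrite size_zip !hc; lia.
- apply/allP => c; rewrite mem_cat => /orP[/mem_take|/mem_drop]; exact: (allP wM).
Qed.

Lemma cdnK j M : wf M -> j.+1 < size M -> 0 < ceps j M -> cdn j (cup j M) = M.
Proof.
move=> wM hj; have [u [z [v [-> -> _ _]]]] := split_pair wM hj.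
rewrite ceps_cat cup_cat cdn_cat => h.
by have [_ /(_ h)[_ _ /= ->]] := tens_ax Row_ax z.
Qed.

Lemma wf_cup j M : wf M -> j.+1 < size M -> wf (cup j M).
Proof.
move=> wM hj; have [u [z [v [-> -> sz]]]] := split_pair wM hj.
by rewrite cup_cat /wf !all_cat /= !size_map size_wup sz eqxx => /andP[-> ->].
Qed.

Lemma weps_cup P j M : wf M -> j.+1 < size M -> 0 < ceps j M -> P.+1 < N ->
  (weps (Col P) (cup j M) = weps (Col P) M) * (wphi (Col P) (cup j M) = wphi (Col P) M).
Proof.
move=> wM hj; have [u [z [v [-> -> sz _]]]] := split_pair wM hj.
rewrite ceps_cat cup_cat => h hP.
rewrite -sz in hP; have [e1 e2 _] := pair_commute hP h.
by split; rewrite ?weps_cat ?wphi_cat ?weps_cat e1 e2.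
Qed.

Lemma redge_cup P j M M' : wf M -> j.+1 < size M -> 0 < ceps j M -> redge P M M' ->
  ceps j M' = ceps j M /\ redge P (cup j M) (cup j M').
Proof.
move=> wM hj h0 [hP hM ->].
have := weps_cup wM hj h0 hP.
move: hM h0; have [u [z [v [-> -> sz _]]]] := split_pair wM hj.
rewrite ceps_cat cup_cat => hM h0 [_ ew].
suff [u' [z' [v' [e1 e2 e3 e4]]]] : exists u' z' v',
   [/\ wdn (Col P) (u ++ cols z ++ v) = u' ++ cols z' ++ v', size u = size u',
      weps Row z' = weps Row z &
      wdn (Col P) (u ++ cols (wup Row z) ++ v) = u' ++ cols (wup Row z') ++ v'].
  rewrite e1 e2 ceps_cat cup_cat e3; split=> //; split=> //.
  by rewrite ew.
have hP' : P.+1 < size z by rewrite sz.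
have [f1 f2 f3] := pair_commute hP' h0.
rewrite !wdn_cat !weps_cat f1 f2.
case: ifP => h1; first by exists (wdn (Col P) u), z, v; rewrite size_wdn.
case: ifP => h2; last by exists u, z, (wdn (Col P) v).
have [z' [g1 g2 g3 g4]] := f3 (leq_ltn_trans (leq0n _) h2).
by exists u, z', v; rewrite g1 g4.
Qed.

Lemma ceps_redge P j M M' : wf M -> j.+1 < size M -> redge P M M' -> ceps j M' = ceps j M.
Proof.
move=> wM hj [hP hM ->]; move: hM.
have [u [z [v [-> -> sz _]]]] := split_pair wM hj; rewrite -sz in hP.
rewrite wdn_cat ceps_cat => hM; case: ifP => h1.
  by rewrite -(size_wdn (Col P) u) ceps_cat.
rewrite wdn_cat; case: ifP => h2; last by rewrite ceps_cat.
have [z' [-> <-]] := pair_dn hP (leq_ltn_trans (leq0n _) h2).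
exact: ceps_cat.
Qed.

Definition colsums M := map (count id) M.

Lemma colsums_wdn P M : wf M -> P.+1 < N -> colsums (wdn (Col P) M) = colsums M.
Proof.
move=> + hP; elim: M => //= c M IH /andP[/eqP hc hM].
case: ifP => /= h; last by rewrite IH.
congr cons; have {}h : ~~ nth false c P && nth false c P.+1.
  by move: h; case: (_ && _) => //; lia.
have ec : c = take P c ++ [:: nth false c P; nth false c P.+1] ++ drop P.+2 c.
  by rewrite /= -!drop_nth ?cat_take_drop //; lia.
rewrite /set2 [in RHS]ec !count_cat /=.
by case/andP: h => /negbTE -> ->.
Qed.

Lemma just_sorted (c : seq bool) :
  (forall P, P.+1 < size c -> eps (Col P) c = 0) -> sorted leq (map nat_of_bool c).
Proof.
elim: c => // x [//|y c] IH h /=; apply/andP; split; last first.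
  by apply: IH => P hP; apply: (h P.+1).
by have /= := h 0 isT; case: x {h IH}; case: y.
Qed.

Lemma sorted_bool (c c' : seq bool) : size c = size c' -> count id c = count id c' ->
  sorted leq (map nat_of_bool c) -> sorted leq (map nat_of_bool c') -> c = c'.
Proof.
move=> hs hc h h'; apply: (inj_map (f := nat_of_bool)); first by case=> -[].
apply: (sorted_eq leq_trans anti_leq) => //; apply: perm_map.
apply/allP => b _ /=; apply/eqP; have := count_predC id c; have := count_predC id c'.
have e d : count_mem false d = count (predC id) d by apply: eq_count => -[].
have e' d : count_mem true d = count id d by apply: eq_count => -[].
by case: b; rewrite ?e ?e'; lia.
Qed.

Definition rhigh M := forall P, P.+1 < N -> weps (Col P) M = 0.
Definition chigh M := forall j, j.+1 < size M -> ceps j M = 0.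

Lemma sorted_just (c : seq bool) : sorted leq (map nat_of_bool c) ->
  exists k, c = nseq k false ++ nseq (size c - k) true.
Proof.
elim: c => [_|[] c IH] /=; first by exists 0.
  move=> h; exists 0 => /=; congr cons.
  have /all_pred1P : all (pred1 true) c.
    move: h; rewrite path_sortedE; last exact: leq_trans.
    by case/andP; rewrite all_map => + _; apply: sub_all => -[].
  by [].
move=> /path_sorted/IH[k e]; exists k.+1 => /=; congr cons.
by rewrite subSS.
Qed.

(** The first [k] rows of [c] are empty, so they offer no [phi] that could cancel an entry of [c']
    in one of these rows. *)
Lemma chigh_pair k (c c' : seq bool) : c = nseq k false ++ nseq (size c - k) true ->
  size c = size c' -> weps Row (zip c c') = 0 ->
  forall P, P < k -> nth false c' P = false.
Proof.
elim: k c c' => // k IH [|a c] [|b c'] //= [-> e] [hs] h [|P] hP /=; first by case: b h => //= h; lia.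
rewrite subSS in e; apply: (IH c) hP => //.
by move: h => /=; case: b => /=; lia.
Qed.

(* Highest for both structures forces the matrix to be a Young diagram. *)
Lemma double_high_sorted M : wf M -> rhigh M -> chigh M ->
  forall c, c \in M -> sorted leq (map nat_of_bool c).
Proof.
move=> wM rM cM.
(* Here [k] counts the empty rows at the bottom of the last column of the prefix [u]; at positions
   from [k] on, [u] has no [wphi] left to cancel anything in the next column. *)
suff H u v : M = u ++ v -> exists k,
   (forall c, c \in u -> sorted leq (map nat_of_bool c)) /\
   (forall P, k <= P -> P.+1 < N -> wphi (Col P) u = 0) /\
   (u != [::] -> last [::] u = nseq k false ++ nseq (N - k) true).
  by have [k []] := H M [::] (esym (cats0 _)).
elim/last_ind: u v => [|u c IH] v eM; first by exists 0; split.
have {}eM : M = u ++ c :: v by rewrite -cat_rcons.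
have [k [h1 [h2 h3]]] := IH _ eM.
have sc : size c = N.
  by apply/eqP/(allP wM); rewrite eM mem_cat mem_head orbT.
have rc P : P.+1 < N -> eps (Col P) c <= wphi (Col P) u.
  move=> hP; have := rM P hP; rewrite eM weps_cat => h.
  have {}h : weps (Col P) (c :: v) <= wphi (Col P) u by lia.
  exact: leq_trans (leq_addr _ _) h.
have c0 P : u != [::] -> P < k -> nth false c P = false.
  case/lastP: u eM h1 h2 h3 rc {IH} => // u c1 eM h1 h2 h3 rc _ hP.
  have := cM (size u); rewrite eM size_cat size_rcons /= => /(_ ltac:(lia)).
  rewrite /ceps (_ : rcons u c1 ++ c :: v = u ++ [:: c1; c] ++ v); last by rewrite cat_rcons.
  rewrite pairof_cat => h.
  have sc1 : size c1 = N.
    by apply/eqP/(allP wM); rewrite eM mem_cat mem_rcons mem_head.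
  apply: (@chigh_pair k c1) hP => //; last by rewrite sc.
  by rewrite sc1; have := h3 _; rewrite last_rcons; apply; case: (u).
(* From [k] on, [rhigh] forbids an entry followed by an empty row, as [u] cannot cancel it; below
   [k] the column has no entry at all, by [chigh]. *)
have jc : sorted leq (map nat_of_bool c).
  apply: just_sorted => P; rewrite sc => hP.
  have [hk|hk] := leqP k P; first by have := rc P hP; rewrite h2 //; lia.
  case: (u =P [::]) => hu; first by have := rc P hP; rewrite hu /=; lia.
  by rewrite /= (c0 P) //; apply/eqP.
have [k' ek] := sorted_just jc.
have kk : u != [::] -> (k <= k') || (N <= k').
  move=> hu; case: leqP => //= hk; apply: contraT; rewrite -ltnNge => hN.
  have := c0 k' hu hk; rewrite ek nth_cat size_nseq ltnn subnn.
  by rewrite nth_nseq sc; case: ifP => //; lia.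
exists k'; split.
  by move=> d; rewrite mem_rcons in_cons => /orP[/eqP->|/h1].
split; last by move=> _; rewrite last_rcons {1}ek sc.
move=> P hk hP; rewrite -cats1 wphi_cat.
have -> : wphi (Col P) [:: c] = 0.
  suff e : nth false c P by rewrite /= e.
  by rewrite ek nth_cat size_nseq ltnNge hk /= nth_nseq sc ifT //; lia.
case: (u =P [::]) => [->//|/eqP hu].
rewrite h2 //; have := kk hu; lia.
Qed.

Lemma double_high_eq M M' : wf M -> wf M' -> rhigh M -> rhigh M' -> chigh M -> chigh M' ->
  colsums M = colsums M' -> M = M'.
Proof.
move=> w w' r r' c c' e.
have es : size M = size M' by have := congr1 size e; rewrite !size_map.
apply: (@eq_from_nth _ [::]) => // j hj.
have hj' : j < size M' by rewrite -es.
apply: sorted_bool.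
- by rewrite (eqP (all_nthP _ w j hj)) (eqP (all_nthP _ w' j hj')).
- by have := congr1 (nth 0 ^~ j) e; rewrite !(nth_map [::]).
- by apply: (double_high_sorted w r c); apply: mem_nth.
- by apply: (double_high_sorted w' r' c'); apply: mem_nth.
Qed.

(** Each entry is weighted by the index of its column, so [cup], which moves an entry one column to
    the left, lowers the sum. This is the termination measure of [rconn_highest]. *)
Fixpoint moment k M :=
  if M is c :: v then k * count id c + moment k.+1 v else 0.

Lemma moment_cat k u v : moment k (u ++ v) = moment k u + moment (k + size u) v.
Proof.
elim: u k => [|c u IH] k /=; first by rewrite addn0.
by rewrite IH addSnnS addnA.
Qed.

Lemma count_wup z : 0 < weps Row z ->
  count id (unzip1 (wup Row z)) = (count id (unzip1 z)).+1 /\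
  (count id (unzip2 (wup Row z))).+1 = count id (unzip2 z).
Proof.
elim: z => //= p z IH; case: ifP => h h0.
  by have [] := IH ltac:(lia); case: p h h0 => [[] []] /=; lia.
by case: p h h0 => [[] []] /=; lia.
Qed.

Lemma moment_cup j M : wf M -> j.+1 < size M -> 0 < ceps j M ->
  moment 0 (cup j M) < moment 0 M.
Proof.
move=> wM hj; have [u [z [v [-> -> _ _]]]] := split_pair wM hj.
rewrite ceps_cat cup_cat => /count_wup[e1 e2].
rewrite !moment_cat /= e1 -e2; lia.
Qed.

Definition rstep M M' := wf M /\ exists P, redge P M M'.
Definition rconn := clos_refl_sym_trans matrix rstep.

(** Well-formedness is an equality, and the rest is conditional on it, so that the relation passes
    through the symmetric closure. *)
Definition same_cols M M' :=
  wf M = wf M' /\ (wf M -> [/\ colsums M = colsums M', size M = size M' &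
    forall j, j.+1 < size M -> ceps j M = ceps j M']).

Lemma rconn_same_cols M M' : rconn M M' -> same_cols M M'.
Proof.
elim=> {M M'} [M M' [wM [P e]]|//|M M' _ [h1 h2]|M1 M2 M3 _ [h1 h2] _ [g1 g2]].
- have [hP h ->] := e; split; first by rewrite wM wf_wdn.
  move=> _; split; first by rewrite colsums_wdn.
    by rewrite size_wdn.
  by move=> j hj; rewrite -(ceps_redge wM hj e); case: e => _ _ ->.
- split=> // w'; rewrite h1 in h2; have [-> -> h3] := h2 w'.
  by split=> // j hj; rewrite h3.
- split; first by rewrite h1.
  move=> w; have [-> e h3] := h2 w; rewrite h1 in w; have [-> e' h3'] := g2 w.
  split=> //; first by rewrite e.
  by move=> j hj; rewrite h3 // h3' // -e.
Qed.

Lemma rconn_cup j M M' : rconn M M' -> wf M -> j.+1 < size M -> 0 < ceps j M ->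
  rconn (cup j M) (cup j M').
Proof.
elim=> {M M'} [M M' [wM [P e]] _ hj h|M *|M M' c IH w hj h|M1 M2 M3 c1 IH1 c2 IH2 w hj h].
- by apply: rst_step; split; [exact: wf_cup|exists P; exact: (redge_cup wM hj h e).2].
- exact: rst_refl.
- have [h1 h2] := rconn_same_cols c; rewrite -h1 in w; have [_ e2 e3] := h2 w.
  by apply/rst_sym/IH; rewrite ?e3 // e2.
- apply: rst_trans (IH1 w hj h) _.
  have [h1 h2] := rconn_same_cols c1; have [_ e2 e3] := h2 w.
  by apply: IH2; rewrite -?h1 -?e2 -?e3.
Qed.

(** Connected matrices have the same [ceps], so a column operator that applies to [M1] applies to
    [M2] and carries the connecting path along; being invertible, it reflects equality. When none
    applies, both matrices are highest for both families and have equal column sums. *)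
Theorem rconn_highest M1 M2 : wf M1 -> rconn M1 M2 -> rhigh M1 -> rhigh M2 -> M1 = M2.
Proof.
have [k] := ubnP (moment 0 M1); elim: k M1 M2 => // k IH M1 M2 hk w1 c r1 r2.
have [e1 e2] := rconn_same_cols c; have [e3 e4 e5] := e2 w1.
have w2 : wf M2 by rewrite -e1.
case: (boolP (has (fun j => (j.+1 < size M1) && (0 < ceps j M1)) (iota 0 (size M1)))).
  move=> /hasP[j _ /andP[hj h]].
  have hj2 : j.+1 < size M2 by rewrite -e4.
  have h2 : 0 < ceps j M2 by rewrite -e5.
  rewrite -(cdnK w1 hj h) -(cdnK w2 hj2 h2); congr (cdn j _); apply: IH.
  - by have := moment_cup w1 hj h; lia.
  - exact: wf_cup.
  - exact: rconn_cup.
  - by move=> P hP; rewrite (weps_cup w1 hj h hP) r1.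
  - by move=> P hP; rewrite (weps_cup w2 hj2 h2 hP) r2.
move=> /hasPn hn.
have c1 : chigh M1.
  move=> j hj; apply/eqP; have := hn j; rewrite mem_iota hj /= -eqn0Ngt; apply.
  by lia.
apply: double_high_eq => // j hj; rewrite -e5 ?c1 // e4 //.
Qed.
End Matrix.

(** * Virtualization in type A and uniqueness of highest weight words *)

Lemma nth_set2 P c x y q : P.+1 < size c -> nth false (set2 P c x y) q =
  if q == P then x else if q == P.+1 then y else nth false c q.
Proof.
move=> h; rewrite /set2.
have es : size (take P c) = P by rewrite size_takel //; lia.
have [->|h1] := eqVneq q P; first by rewrite nth_cat es ltnn subnn.
have [->|h2] := eqVneq q P.+1; first by rewrite nth_cat es ltnNge leqnSn subSnn.
rewrite nth_cat es; case: ltnP => h3; first by rewrite nth_take.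
rewrite nth_cat /= ifF; last by lia.
by rewrite nth_drop; congr nth; lia.
Qed.

(** Used for the mirror positions i-1 and 2n-1-i, whose distance 2n-2i is at least 2 when
    [i < n]. *)
Lemma far_wdn N P P' M : wf N M -> P'.+1 < N -> (P.+1 < P') || (P'.+1 < P) ->
  (weps (Col P) (wdn (Col P') M) = weps (Col P) M) *
  (wphi (Col P) (wdn (Col P') M) = wphi (Col P) M).
Proof.
move=> w hP h; elim: M w => [//|c M IH] /= /andP[/eqP hc /IH[e f]].
case: ifP => _ /=; last by rewrite e f.
rewrite !nth_set2 ?hc //.
by rewrite !ifF //; lia.
Qed.

Definition box N x := mkseq (fun q => q == x) N.
Definition hole N x := mkseq (fun q => q != x) N.

Lemma nth_box N x q : q < N -> nth false (box N x) q = (q == x).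
Proof. by move=> h; rewrite nth_mkseq. Qed.
Lemma nth_hole N x q : q < N -> nth false (hole N x) q = (q != x).
Proof. by move=> h; rewrite nth_mkseq. Qed.

Lemma box_dn N P : P.+1 < N -> dn (Col P) (box N P.+1) = box N P.
Proof.
move=> h; apply: (@eq_from_nth _ false); rewrite ?size_set2 ?size_mkseq // => q hq.
rewrite nth_set2 ?size_mkseq // !nth_box //.
by case: (eqVneq q P) => h1; case: (eqVneq q P.+1) => h2 //=; lia.
Qed.

Lemma hole_dn N P : P.+1 < N -> dn (Col P) (hole N P) = hole N P.+1.
Proof.
move=> h; apply: (@eq_from_nth _ false); rewrite ?size_set2 ?size_mkseq // => q hq.
rewrite nth_set2 ?size_mkseq // !nth_hole //.
by case: (eqVneq q P) => h1; case: (eqVneq q P.+1) => h2 //=; lia.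
Qed.

Lemma box_val N P x : P.+1 < N ->
  (eps (Col P) (box N x) = (P == x)) * (phi (Col P) (box N x) = (P.+1 == x)).
Proof.
move=> h; rewrite /= !nth_box //; last by lia.
by split; case: eqP; case: eqP => //; lia.
Qed.

Lemma hole_val N P x : P.+1 < N ->
  (eps (Col P) (hole N x) = (P.+1 == x)) * (phi (Col P) (hole N x) = (P == x)).
Proof.
move=> h; rewrite /= !nth_hole //; last by lia.
by split; case: eqP; case: eqP => //; lia.
Qed.

Lemma weps_pair (T : Type) (C : sl2 T) x y : weps C [:: x; y] = eps C x + (eps C y - phi C x).
Proof. by rewrite /= sub0n addn0. Qed.
Lemma wphi_pair (T : Type) (C : sl2 T) x y : wphi C [:: x; y] = phi C y + (phi C x - eps C y).
Proof. by rewrite /= !sub0n subn0 addn0. Qed.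

Lemma wdn_pair (T : Type) (C : sl2 T) x y : wdn C [:: x; y] =
  if eps C y < phi C x then [:: dn C x; y]
  else if 0 < phi C y then [:: x; dn C y] else [:: x; y].
Proof. by rewrite /= sub0n addn0; case: ifP => // _; case: ifP. Qed.

Ltac decide_eqs := repeat match goal with
  | |- context [@eq_op _ ?x ?y] =>
    first [ rewrite (@eqn_false x y); [|lia] | rewrite (_ : (x == y) = true); [|by apply/eqP; lia] ]
  end.

Section Virtual.
Variable n : nat.
Hypothesis hn : 2 <= n.
Notation N := (n.*2).

(** As the letter runs through its ranks the hole climbs from row 0 to row 2n-1 and the box descends
    from 2n-1 to 0. Both move at every arrow, except that n -> 0 moves the hole alone and 0 -> bar n
    the box alone. *)
Definition hole_pos a := if a <= n then a else a.-1.
Definition box_pos a := if a < n then N.-1 - a else N - a.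
(* The vector crystal is sent into the adjoint crystal of type A: a dual vector (the complement of
   a singleton) followed by a vector. *)
Definition virtL a := [:: hole N (hole_pos a); box N (box_pos a)].
Definition virt (w : seq nat) : seq (seq bool) := flatten (map virtL w).

Lemma virt_cons a w : virt (a :: w) = virtL a ++ virt w.
Proof. by []. Qed.

Lemma wf_virt w : wf N (virt w).
Proof. by elim: w => // a w IH; rewrite virt_cons /= !size_mkseq eqxx. Qed.

Lemma virtL_val P a : P.+1 < N ->
  (weps (Col P) (virtL a) = (P.+1 == hole_pos a) + ((P == box_pos a) - (P == hole_pos a))) *
  (wphi (Col P) (virtL a) = (P.+1 == box_pos a) + ((P == hole_pos a) - (P == box_pos a))).
Proof.
move=> h; by rewrite /virtL weps_pair wphi_pair !(box_val _ h) !(hole_val _ h).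
Qed.

(** Both mirror positions read the signature of the letter itself. The tensor rule then makes the
    same choice of factor in type A as in type B, which extends the embedding to words. *)
Lemma virtL_Lc i P a : 1 <= i <= n -> a <= N -> (P == i.-1) || (P == N.-1 - i) ->
  (weps (Col P) (virtL a) = eps (Lc n i) a) * (wphi (Col P) (virtL a) = phi (Lc n i) a).
Proof.
move=> hi ha hP; have h : P.+1 < N by lia.
rewrite !virtL_val // /hole_pos /box_pos; have {}hi : 0 < i /\ i <= n by lia.
case: (LcP a (introT andP hi)) => [h1 h2|h1 h2|h1 h2|h1 h2|h1 h2|h1 h2|h1 h2|h1 h2 h3 h4];
  case: (leqP a n) => g1; case: (ltnP a n) => g2; try (by exfalso; clear -hi h1 h2 g1 g2 hn; lia);
  case/orP: hP => /eqP eP; decide_eqs; try (by split).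
by rewrite (_ : N - a = a) ?subnn; [split|lia].
Qed.

Lemma hb_dn P h b : P.+1 < N -> wdn (Col P) [:: hole N h; box N b] =
  if (P == h) && (P != b) then [:: hole N P.+1; box N b]
  else if P.+1 == b then [:: hole N h; box N P] else [:: hole N h; box N b].
Proof.
move=> hP; rewrite wdn_pair !(box_val _ hP) !(hole_val _ hP).
have -> : (if 0 < (P.+1 == b) then [:: hole N h; dn (Col P) (box N b)] else
   [:: hole N h; box N b]) = if P.+1 == b then [:: hole N h; box N P] else [:: hole N h; box N b].
  by have [<-|//] := eqVneq P.+1 b; rewrite box_dn.
have [<-|h1] := eqVneq P h; last by rewrite ltn0.
by rewrite hole_dn //; case: (P == b).
Qed.

Lemma virtL_eq a h b : hole_pos a = h -> box_pos a = b -> virtL a = [:: hole N h; box N b].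
Proof. by move=> <- <-. Qed.

Lemma virtL_unbarred a : a < n -> virtL a = [:: hole N a; box N (N.-1 - a)].
Proof. by move=> h; apply: virtL_eq; rewrite /hole_pos /box_pos ?(ltnW h) ?h. Qed.

Lemma virtL_barred a : n < a -> virtL a = [:: hole N a.-1; box N (N - a)].
Proof. by move=> h; apply: virtL_eq; rewrite /hole_pos /box_pos; [case: leqP|case: ltnP]; lia. Qed.

Lemma virtL_zero : virtL n = [:: hole N n; box N n].
Proof. by apply: virtL_eq; rewrite /hole_pos /box_pos ?leqnn ?ltnn //; lia. Qed.

Lemma virtL_dn_far i a : 1 <= i < n -> a <= N -> 0 < phi (Lc n i) a ->
  wdn (Col i.-1) (wdn (Col (N.-1 - i)) (virtL a)) = virtL a.+1.
Proof.
move=> hi ha; have {hi} [hi hin] : 1 <= i <= n /\ i < n by lia.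
have h1 : i.-1.+1 < N by lia.
have h2 : (N.-1 - i).+1 < N by lia.
case: (LcP a hi) => // g1 g2 _; subst a; try lia.
- rewrite virtL_unbarred ?virtL_unbarred; [|lia..]; rewrite hb_dn //.
  rewrite ifF; last by lia.
  rewrite ifT; last by lia.
  rewrite hb_dn // ifT; last by lia.
  by congr [:: hole N _; box N _]; lia.
- rewrite virtL_barred ?virtL_barred; [|lia..]; rewrite hb_dn //.
  rewrite ifT; last by lia.
  rewrite hb_dn // ifF; last by lia.
  rewrite ifT; last by lia.
  by congr [:: hole N _; box N _]; lia.
Qed.

Lemma virtL_dn_n a : a <= N -> 0 < phi (Lc n n) a -> wdn (Col n.-1) (virtL a) = virtL a.+1.
Proof.
have hi : 1 <= n <= n by lia.
have h : n.-1.+1 < N by lia.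
move=> ha; case: (LcP a hi) => // g1 g2 _; subst a; try lia.
- rewrite virtL_unbarred; last by lia.
  rewrite (@prednK n) ?virtL_zero; last by lia.
  rewrite hb_dn // ifT; last by lia.
  by congr [:: hole N _; box N _]; lia.
- rewrite virtL_zero virtL_barred // hb_dn // ifF; last by lia.
  rewrite ifT; last by lia.
  by congr [:: hole N _; box N _]; lia.
Qed.

Lemma virt_Lc i P w : 1 <= i <= n -> bnd n w -> (P == i.-1) || (P == N.-1 - i) ->
  (weps (Col P) (virt w) = weps (Lc n i) w) * (wphi (Col P) (virt w) = wphi (Lc n i) w).
Proof.
move=> hi + hP; elim: w => [//|a w IH] /andP[ha /IH[e f]].
by rewrite virt_cons weps_cat wphi_cat e f !(virtL_Lc hi ha hP).
Qed.

(** The two type A operators see the same signature, and applying one leaves the signature of the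
    other alone; so both act inside the image of the same letter. *)
Lemma virt_dn i w : 1 <= i <= n -> bnd n w -> 0 < wphi (Lc n i) w ->
  (i < n -> wdn (Col i.-1) (wdn (Col (N.-1 - i)) (virt w)) = virt (wdn (Lc n i) w)) /\
  (i = n -> wdn (Col i.-1) (virt w) = virt (wdn (Lc n i) w)).
Proof.
move=> hi; elim: w => [//|a w IH] /andP[ha hw].
have hP1 : (i.-1 == i.-1) || (i.-1 == N.-1 - i) by rewrite eqxx.
have hP2 : (N.-1 - i == i.-1) || (N.-1 - i == N.-1 - i) by rewrite eqxx orbT.
rewrite virt_cons [wdn _ (a :: w)]/= [wphi _ (a :: w)]/= => h0.
have [h|h] := ltnP (weps (Lc n i) w) (phi (Lc n i) a); split=> hin.
- rewrite wdn_cat (virt_Lc hi hw hP2) (virtL_Lc hi ha hP2) h.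
  rewrite wdn_cat (virt_Lc hi hw hP1) (far_wdn (N := N)) ?(virtL_Lc hi ha hP1) ?h //; first last.
  + lia.
  + lia.
  + by rewrite /wf /= !size_mkseq eqxx.
  by rewrite virtL_dn_far //; [rewrite hin; lia|exact: leq_ltn_trans h].
- rewrite wdn_cat (virt_Lc hi hw hP1) (virtL_Lc hi ha hP1) h.
  move: h; rewrite {}hin => h; rewrite virtL_dn_n //.
  exact: leq_ltn_trans h.
- have {IH} [IH _] := IH hw ltac:(lia).
  rewrite wdn_cat (virt_Lc hi hw hP2) (virtL_Lc hi ha hP2) ifF; last by rewrite ltnNge h.
  rewrite wdn_cat.
  rewrite (far_wdn (N := N)) ?wf_virt ?(virt_Lc hi hw hP1) ?(virtL_Lc hi ha hP1) //; try lia.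
  rewrite ltnNge h.
  by rewrite virt_cons IH.
- have {IH} [_ IH] := IH hw ltac:(lia).
  by rewrite wdn_cat (virt_Lc hi hw hP1) (virtL_Lc hi ha hP1) ltnNge h virt_cons -IH.
Qed.

Lemma virt_rconn i w : 1 <= i <= n -> bnd n w -> 0 < wphi (Lc n i) w ->
  rconn N (virt w) (virt (wdn (Lc n i) w)).
Proof.
move=> hi hw h; have [h1 h2] := virt_dn hi hw h.
have hP1 : (i.-1 == i.-1) || (i.-1 == N.-1 - i) by rewrite eqxx.
have hP2 : (N.-1 - i == i.-1) || (N.-1 - i == N.-1 - i) by rewrite eqxx orbT.
have [hin|hin] := ltnP i n; last first.
  have e : i = n by lia.
  apply: rst_step; split; first exact: wf_virt.
  exists i.-1; split; [lia|by rewrite (virt_Lc hi hw hP1)|by rewrite h2].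
apply: (@rst_trans _ _ _ (wdn (Col (N.-1 - i)) (virt w))); apply: rst_step; split.
- exact: wf_virt.
- by exists (N.-1 - i); split; [lia|rewrite (virt_Lc hi hw hP2)|].
- by apply: wf_wdn; [lia|exact: wf_virt].
- exists i.-1; split; [lia| |by rewrite h1].
  by rewrite (far_wdn (N := N)) ?wf_virt ?(virt_Lc hi hw hP1) //; lia.
Qed.

Lemma virt_high w : bnd n w -> (forall i, 1 <= i <= n -> weps (Lc n i) w = 0) -> rhigh N (virt w).
Proof.
move=> hw h P hP; have [hn'|hn'] := ltnP P n.
  by rewrite (@virt_Lc P.+1) ?h ?eqxx //; lia.
by rewrite (@virt_Lc (N.-1 - P)) ?h //; lia.
Qed.

Lemma virtL_inj a b : a <= N -> b <= N -> virtL a = virtL b -> a = b.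
Proof.
move=> ha hb [e1 e2].
have {}e1 : hole_pos a = hole_pos b.
  have := congr1 (nth false ^~ (hole_pos a)) e1; rewrite !nth_hole ?eqxx; by rewrite /hole_pos; case: (leqP a n); lia.
have {}e2 : box_pos a = box_pos b.
  have := congr1 (nth false ^~ (box_pos a)) e2; rewrite !nth_box ?eqxx; by rewrite /box_pos; case: (ltnP a n); lia.
move: e1 e2; rewrite /hole_pos /box_pos.
by case: (leqP a n) => g1; case: (leqP b n) => g2; case: (ltnP a n) => g3; case: (ltnP b n) => g4; lia.
Qed.

Lemma virt_inj w w' : bnd n w -> bnd n w' -> virt w = virt w' -> w = w'.
Proof.
elim: w w' => [|a w IH] [|b w'] //= /andP[ha hw] /andP[hb hw'] e.
have [e1 e2 e3] := e; congr cons; last exact: IH.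
by apply: virtL_inj; rewrite // /virtL e1 e2.
Qed.

Lemma connB_rconn (x y : word n) : connB n x y -> rconn N (virt (ranks x)) (virt (ranks y)).
Proof.
elim=> {x y} [x y [i [hi /(fBP hi)[h ->]]]|x|x y _ c|x y z _ c1 _ c2].
- by apply: virt_rconn => //; exact: ranks_bnd.
- exact: rst_refl.
- exact: rst_sym.
- exact: rst_trans c1 c2.
Qed.

Lemma highestB_weps (x : word n) : highestB n x -> forall i, 1 <= i <= n -> weps (Lc n i) (ranks x) = 0.
Proof. by move=> h i hi; apply/(eB_None hi)/h. Qed.

Theorem highestB_uniq (x y : word n) : connB n x y -> highestB n x -> highestB n y -> x = y.
Proof.
move=> c hx hy; apply: ranks_inj; apply: virt_inj; rewrite ?ranks_bnd //.
apply: (rconn_highest (wf_virt _) (connB_rconn c)); apply: virt_high; rewrite ?ranks_bnd //.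
- exact: highestB_weps.
- exact: highestB_weps.
Qed.
End Virtual.

(** * The three-letter relations *)

(** [Lc_spec] without subtraction and with its inert case cut into intervals, so that every case is
    a conjunction of linear conditions. *)
Variant Lc_range n i a : nat -> nat -> Prop :=
| RaL of i < n & a.+1 = i : Lc_range n i a 0 1
| RaL' of i < n & a = i : Lc_range n i a 1 0
| RaR' of i < n & a + i = n + n : Lc_range n i a 0 1
| RaR of i < n & a + i = (n + n).+1 : Lc_range n i a 1 0
| RaN of i = n & a.+1 = n : Lc_range n i a 0 2
| Ra0 of i = n & a = n : Lc_range n i a 1 1
| RaNb of i = n & a = n.+1 : Lc_range n i a 2 0
| RaO1 of a.+1 < i : Lc_range n i a 0 0
| RaO2 of i < n & i < a & a + i < n + n : Lc_range n i a 0 0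
| RaO3 of (n + n).+1 < a + i : Lc_range n i a 0 0.

Lemma Lc_rangeP n i a : 1 <= i <= n -> Lc_range n i a (eps (Lc n i) a) (phi (Lc n i) a).
Proof.
move=> hi; case: (LcP a hi) => *; try by constructor; lia.
have [h|h] := ltnP a.+1 i; first by constructor.
have [h'|h'] := ltnP (n + n).+1 (a + i); first by constructor.
by apply: RaO2; lia.
Qed.

(* The three-letter plactic relations other than (R3) differ by a transposition of the last
   two letters or of the first two letters. *)
Inductive elem3 n : seq nat -> seq nat -> Prop :=
| E3a a b c a' b' c' : a' = a -> b' = c -> c' = b -> c <= a <= b -> c < b ->
    b + c <> n + n -> (a = c -> a <> n) -> (a = b -> a = n) -> b <= n + n ->
    elem3 n [:: a; b; c] [:: a'; b'; c']
| E3b a b c a' b' c' : a' = b -> b' = a -> c' = c -> a <= c <= b -> a < b ->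
    a + b <> n + n -> (b = c -> c <> n) -> (a = c -> a = n) -> b <= n + n ->
    elem3 n [:: a; b; c] [:: a'; b'; c']
| E3c a b c a' b' c' : a' = a -> b' = c.+1 -> c'.+1 = b -> c.+1 < n -> c.+1 <= a ->
    a + c < n + n -> b + c = n + n -> elem3 n [:: a; b; c] [:: a'; b'; c']
| E3d a b c a' b' c' : a = b'.+1 -> b.+1 = a' -> c = c' -> b'.+1 < n -> b'.+1 <= c ->
    c + b' < n + n -> a' + b' = n + n -> elem3 n [:: a; b; c] [:: a'; b'; c']
| E3e a b c a' b' c' : a = n -> b = n.+1 -> c.+1 = n -> a' = b -> b' = c -> c' = a ->
    elem3 n [:: a; b; c] [:: a'; b'; c'].

Ltac prune := try (exfalso; lia).
Ltac e3 := solve [apply: E3a; lia | apply: E3b; lia | apply: E3c; lia | apply: E3d; lia | apply: E3e; lia].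

(** Equal [weps] and [wphi] make an operator choose the same factor of any surrounding word, so this
    form of closure survives concatenation. *)
Definition closed_at (R : seq nat -> seq nat -> Prop) n i x y :=
  [/\ weps (Lc n i) x = weps (Lc n i) y, wphi (Lc n i) x = wphi (Lc n i) y,
     0 < wphi (Lc n i) x -> R (wdn (Lc n i) x) (wdn (Lc n i) y) &
     0 < weps (Lc n i) x -> R (wup (Lc n i) x) (wup (Lc n i) y)].

(** The constructors are not closed one at a time: an operator may turn an instance of (R1) into one
    of (R3), for example. Hence the target is the whole of [elem3]. *)
Lemma E3a_closed n i a b c : 1 <= i <= n -> c <= a <= b -> c < b ->
    b + c <> n + n -> (a = c -> a <> n) -> (a = b -> a = n) -> b <= n + n ->
   closed_at (elem3 n) n i [:: a; b; c] [:: a; c; b].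
Proof.
move=> hi h1 h2 h3 h4 h5 h6; rewrite /closed_at /= !upE !dnE.
case: (Lc_rangeP a hi) => *; prune; case: (Lc_rangeP b hi) => *; prune; case: (Lc_rangeP c hi) => *; prune.
all: split=> //= *.
all: e3.
Qed.

Lemma E3b_closed n i a b c : 1 <= i <= n -> a <= c <= b -> a < b ->
    a + b <> n + n -> (b = c -> c <> n) -> (a = c -> a = n) -> b <= n + n ->
   closed_at (elem3 n) n i [:: a; b; c] [:: b; a; c].
Proof.
move=> hi h1 h2 h3 h4 h5 h6; rewrite /closed_at /= !upE !dnE.
case: (Lc_rangeP a hi) => *; prune; case: (Lc_rangeP b hi) => *; prune; case: (Lc_rangeP c hi) => *; prune.
all: split=> //= *.
all: e3.
Qed.

Lemma E3c_closed n i a b c b' c' : 1 <= i <= n -> b' = c.+1 -> c'.+1 = b -> c.+1 < n ->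
   c.+1 <= a -> a + c < n + n -> b + c = n + n ->
   closed_at (elem3 n) n i [:: a; b; c] [:: a; b'; c'].
Proof.
move=> hi h1 h2 h3 h4 h5 h6; rewrite /closed_at /= !upE !dnE.
case: (Lc_rangeP c hi) => *; prune; case: (Lc_rangeP a hi) => *; prune; case: (Lc_rangeP b hi) => *; prune;
  case: (Lc_rangeP b' hi) => *; prune; case: (Lc_rangeP c' hi) => *; prune.
all: split=> //= *.
all: e3.
Qed.

Lemma E3d_closed n i a b c a' b' : 1 <= i <= n -> a = b'.+1 -> b.+1 = a' -> b'.+1 < n ->
    b'.+1 <= c -> c + b' < n + n -> a' + b' = n + n ->
    closed_at (elem3 n) n i [:: a; b; c] [:: a'; b'; c].
Proof.
move=> hi h1 h2 h3 h4 h5 h6; rewrite /closed_at /= !upE !dnE.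
case: (Lc_rangeP c hi) => *; prune; case: (Lc_rangeP a hi) => *; prune; case: (Lc_rangeP b hi) => *; prune;
  case: (Lc_rangeP b' hi) => *; prune; case: (Lc_rangeP a' hi) => *; prune.
all: split=> //= *.
all: e3.
Qed.

Lemma E3e_closed n i a b c : 1 <= i <= n -> 2 <= n -> a = n -> b = n.+1 -> c.+1 = n ->
  closed_at (elem3 n) n i [:: a; b; c] [:: b; c; a].
Proof.
move=> hi hn h1 h2 h3; rewrite /closed_at /= !upE !dnE.
case: (Lc_rangeP a hi) => *; prune; case: (Lc_rangeP b hi) => *; prune; case: (Lc_rangeP c hi) => *; prune.
all: split=> //= *.
all: e3.
Qed.

Lemma elem3_closed n i x y : 2 <= n -> 1 <= i <= n -> elem3 n x y -> closed_at (elem3 n) n i x y.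
Proof.
move=> hn hi; case=> a b c a' b' c' *; subst.
- exact: E3a_closed.
- exact: E3b_closed.
- exact: E3c_closed.
- exact: E3d_closed.
- exact: E3e_closed.
Qed.

(** * The crystal structure on columns *)

(* A column is encoded by its letter pairs [(z \in C, zbar \in C)] together with the number
   of letters 0; [colw n k s m] is the part of its reading lying between [k] and [kbar]. *)
Fixpoint colw n k (s : seq (bool * bool)) m : seq nat :=
  if s is p :: s' then nseq p.1 k ++ colw n k.+1 s' m ++ nseq p.2 (n.*2 - k)
  else nseq m n.

(** In [colw n k s m], position [j] is the index i = k+j+1: the pairs [j] and [j.+1] hold the ranks
    of i, i+1, bar(i+1) and bar i, while the last pair belongs to the index n. *)
Fixpoint seps j (s : seq (bool * bool)) m : nat :=
  match j, s with
  | j'.+1, _ :: s' => seps j' s' m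
  | 0, [:: p] => if p.1 then 0 else if p.2 then 2 else 0 < m
  | 0, p :: q :: _ => (q.1 && ~~ p.1) + ((p.2 && ~~ q.2) - (p.1 && ~~ q.1))
  | _, _ => 0
  end.

Fixpoint sphi j (s : seq (bool * bool)) m : nat :=
  match j, s with
  | j'.+1, _ :: s' => sphi j' s' m
  | 0, [:: p] => if p.2 then 0 else if p.1 then 2 else 0 < m
  | 0, p :: q :: _ => (q.2 && ~~ p.2) + ((p.1 && ~~ q.1) - (p.2 && ~~ q.2))
  | _, _ => 0
  end.

Fixpoint sdn j (s : seq (bool * bool)) m :=
  match j, s with
  | j'.+1, p :: s' => let r := sdn j' s' m in (p :: r.1, r.2)
  | 0, [:: p] => if p.1 then ([:: (false, false)], m.+1) else ([:: (false, true)], m.-1)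
  | 0, p :: q :: s' =>
      if (p.1 && ~~ q.1) && ~~ (p.2 && ~~ q.2) then ((false, p.2) :: (true, q.2) :: s', m)
      else ((p.1, true) :: (q.1, false) :: s', m)
  | _, _ => (s, m)
  end.

Fixpoint sup j (s : seq (bool * bool)) m :=
  match j, s with
  | j'.+1, p :: s' => let r := sup j' s' m in (p :: r.1, r.2)
  | 0, [:: p] => if p.2 then ([:: (false, false)], m.+1) else ([:: (true, false)], m.-1)
  | 0, p :: q :: s' =>
      if ~~ (p.1 && ~~ q.1) && (p.2 && ~~ q.2) then ((p.1, false) :: (q.1, true) :: s', m)
      else ((true, p.2) :: (false, q.2) :: s', m)
  | _, _ => (s, m)
  end.

Lemma colw_bound n k s m x : k + size s = n -> x \in colw n k s m -> k <= x <= n.*2 - k.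
Proof.
elim: s k => [|p s IH] k /= hk.
  by rewrite mem_nseq => /andP[_ /eqP->]; lia.
rewrite !mem_cat !mem_nseq => /or3P[/andP[_ /eqP->]|h|/andP[_ /eqP->]]; try lia.
by have := IH k.+1 ltac:(lia) h; lia.
Qed.

Definition triv (C : sl2 nat) w := ((weps C w = 0) * (wphi C w = 0))%type.

Lemma trivP (C : sl2 nat) w : (forall x, x \in w -> (eps C x = 0) * (phi C x = 0)) -> triv C w.
Proof.
elim: w => [//|x w IH] h /=.
have [e f] := IH (fun y hy => h y (mem_behead (s := x :: w) hy)).
have [e' f'] := h x (mem_head _ _).
by split; rewrite /= ?e ?f ?e' ?f'.
Qed.

Lemma triv_nseq (C : sl2 nat) (a : bool) x : (eps C x = 0) -> (phi C x = 0) -> triv C (nseq a x).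
Proof. by move=> e f; apply: trivP => y /nseqP[-> _]. Qed.

Lemma triv_frame (C : sl2 nat) u v u' : triv C u -> triv C u' ->
  [/\ weps C (u ++ v ++ u') = weps C v, wphi C (u ++ v ++ u') = wphi C v,
      0 < wphi C v -> wdn C (u ++ v ++ u') = u ++ wdn C v ++ u' &
      0 < weps C v -> wup C (u ++ v ++ u') = u ++ wup C v ++ u'].
Proof.
move=> [e f] [e' f'].
have E : weps C (v ++ u') = weps C v by rewrite weps_cat e' sub0n addn0.
have F : wphi C (v ++ u') = wphi C v by rewrite wphi_cat e' f' subn0.
split.
- by rewrite weps_cat e f E subn0.
- by rewrite wphi_cat f F addn0.
- by move=> h; rewrite wdn_cat f ltn0 wdn_cat e' h.
- move=> h; have hh : 0 < weps C (u ++ v ++ u') by rewrite weps_cat e f E subn0.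
  by rewrite (wup_cat hh) f E h wup_cat ?E // e' ltn0.
Qed.

Lemma wdn_cons (T : Type) (C : sl2 T) a v :
  wdn C (a :: v) = if weps C v < phi C a then dn C a :: v else a :: wdn C v.
Proof. by []. Qed.

Lemma wup_cons (T : Type) (C : sl2 T) a v :
  wup C (a :: v) = if phi C a < weps C v then a :: wup C v else up C a :: v.
Proof. by []. Qed.

Section ColumnCrystal.
Variables (n i : nat).
Hypothesis hi : 1 <= i <= n.
Local Notation C := (Lc n i).

Definition col_ok k j s m := [/\ weps C (colw n k s m) = seps j s m,
   wphi C (colw n k s m) = sphi j s m,
   0 < sphi j s m -> wdn C (colw n k s m) = colw n k (sdn j s m).1 (sdn j s m).2 &
   0 < seps j s m -> wup C (colw n k s m) = colw n k (sup j s m).1 (sup j s m).2].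

(** Adjacent letters 0 cancel each other, so a nonempty block of them has the signature of a single
    0. *)
Lemma weps_nseq0 m : i = n -> (weps C (nseq m n) = (0 < m)) * (wphi C (nseq m n) = (0 < m)).
Proof.
move=> e; have [E F] := Lc_val hi (Lc0 e (erefl n)).
elim: m => //= m [-> ->]; rewrite E F; by case: m.
Qed.

Lemma wdn_nseq0 m : i = n -> wdn C (nseq m.+1 n) = nseq m n ++ [:: n.+1].
Proof.
move=> e; have [E F] := Lc_val hi (Lc0 e (erefl n)).
elim: m => [|m IH]; first by rewrite /= F dnE.
by rewrite [LHS](wdn_cons C n (nseq m.+1 n)) weps_nseq0 // F IH.
Qed.

Lemma wup_nseq0 m : i = n -> wup C (nseq m.+1 n) = n.-1 :: nseq m n.
Proof.
move=> e; have [E F] := Lc_val hi (Lc0 e (erefl n)).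
by rewrite [LHS](wup_cons C n (nseq m n)) weps_nseq0 // F upE; case: m.
Qed.

Lemma col_ok_last p m : i = n -> col_ok n.-1 0 [:: p] m.
Proof.
move=> e.
have [E1 F1] := Lc_val hi (LcN e (erefl n.-1)).
have [E2 F2] := Lc_val hi (LcNb e (erefl n.+1)).
have h1 : n.-1.+1 = n by lia.
have h2 : n.*2 - n.-1 = n.+1 by lia.
have [E0 F0] := weps_nseq0 m e.
have E3 : weps C (nseq m n ++ [:: n.+1]) = 2.
  by rewrite weps_cat E0 F0 /= E2; case: (m).
have F3 : wphi C (nseq m n ++ [:: n.+1]) = 0.
  by rewrite wphi_cat F0 /= E2 F2; case: (m).
rewrite /col_ok /= h2; case: p => [[] []]; rewrite /= ?cats0.
all: split=> //=.
- by rewrite E3 F1 E1.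
- by rewrite E3 F3 F1.
- by rewrite E0 E1 F1; case: (m).
- by rewrite E0 F0 F1; case: (m).
- by move=> _; rewrite E0 F1 dnE h1; case: (m).
- move=> _; rewrite wup_cat ?E3 // F0 /= E2 F2 upE /= ifT; last by case: (m).
  by elim: (m) => //= m' ->.
- by case: (m) => // m' _; rewrite wdn_nseq0 // h2.
- by case: (m) => // m' _; rewrite wup_nseq0.
Qed.

Lemma col_ok_block k p q s m : i = k.+1 -> k.+2 + size s = n -> col_ok k 0 [:: p, q & s] m.
Proof.
move=> ei hk; have hin : i < n by lia.
have h1 : n.*2 - k = (n.*2 - k.+1).+1 by lia.
have [E1 F1] := Lc_val hi (@LcL n i k hin ltac:(lia)).
have [E2 F2] := Lc_val hi (@LcL' n i k.+1 hin ltac:(lia)).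
have [E3 F3] := Lc_val hi (@LcR' n i (n.*2 - k.+1) hin ltac:(lia)).
have [E4 F4] := Lc_val hi (@LcR n i (n.*2 - k.+1).+1 hin ltac:(lia)).
have [E5 F5] : triv C (colw n k.+2 s m).
  apply: trivP => x /(colw_bound hk) hx.
  by rewrite !(Lc_val hi (@LcO n i x _ _ _ _)) //; lia.
set k' := n.*2 - k.+1 in h1 E3 F3 E4 F4; have h2 : n.*2 - k.+1 = k' by [].
clearbody k'; rewrite /col_ok /= h1 h2.
have U : wup C (colw n k.+2 s m ++ [:: k'.+1]) = colw n k.+2 s m ++ [:: k'].
  have h : 0 < weps C (colw n k.+2 s m ++ [:: k'.+1]) by rewrite weps_cat /= E4 F4 E5 F5.
  by rewrite (wup_cat h) /= E4 F4 F5 /= upE.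
case: p => [[] []]; case: q => [[] []]; rewrite /= ?cats0 -?catA.
all: split=> //= *.
all: rewrite ?(weps_cat, wphi_cat, wdn_cat, E1, E2, E3, E4, E5, F1, F2, F3, F4, F5, upE, dnE) /=.
all: rewrite ?(weps_cat, wphi_cat, wdn_cat, E1, E2, E3, E4, E5, F1, F2, F3, F4, F5, upE, dnE) /=.
all: by rewrite ?U ?h1 ?h2.
Qed.

(** Only the two pairs at [j] and [j.+1], or the last pair and the letters 0, are active for [i];
    the letters outside and between them have an empty signature. *)
Lemma colw_ok j k s m : k + size s = n -> i = (k + j).+1 -> j < size s -> col_ok k j s m.
Proof.
elim: s k j => [//|p s IH] k [|j] /= hk ei hj; last first.
  have [h1 h2 h3 h4] := IH k.+1 j ltac:(lia) ltac:(lia) hj.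
  have t1 (a : bool) : triv C (nseq a k).
    by apply: triv_nseq; rewrite (Lc_val hi (@LcO n i k _ _ _ _)) //; lia.
  have t2 (a : bool) : triv C (nseq a (n.*2 - k)).
    by apply: triv_nseq; rewrite (Lc_val hi (@LcO n i (n.*2 - k) _ _ _ _)) //; lia.
  have [g1 g2 g3 g4] := triv_frame (colw n k.+1 s m) (t1 p.1) (t2 p.2).
  split=> /=; rewrite ?g1 ?g2 //.
  - by move=> h; rewrite g3 ?h2 // h3.
  - by move=> h; rewrite g4 ?h1 // h4.
case: s hk {IH hj} => [|q s] /= hk.
  rewrite (_ : k = n.-1); last by lia.
  by apply: col_ok_last; lia.
by apply: col_ok_block; lia.
Qed.
End ColumnCrystal.

(* Read the pairs as a path: an absent pair is a down step, a full pair an up step, and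
   every letter 0 a final up step. [fit d] says that the path started [d] below the ceiling
   never exceeds it; for the ceiling 0 this is [N(z) <= z] together with height at most n. *)
Fixpoint fit d (s : seq (bool * bool)) m : bool :=
  match s with
  | [::] => m <= d
  | (true, true) :: s' => if d is d'.+1 then fit d' s' m else false
  | (false, false) :: s' => fit d.+1 s' m
  | _ :: s' => fit d s' m
  end.

(* The path started [d] below level 0 has maximum exactly 1, and the up step at which it first
   reaches level 1 is erased. *)
Inductive Er : nat -> seq (bool * bool) -> nat -> seq (bool * bool) -> nat -> Prop :=
| ErZ d : Er d [::] d.+1 [::] d
| ErP s m : fit 0 s m -> Er 0 ((true, true) :: s) m ((false, false) :: s) m
| ErU d s m s' m' : Er d s m s' m' -> Er d.+1 ((true, true) :: s) m ((true, true) :: s') m'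
| ErH d (b : bool) s m s' m' :
    Er d s m s' m' -> Er d ((b, ~~ b) :: s) m ((b, ~~ b) :: s') m'
| ErD d s m s' m' : Er d.+1 s m s' m' -> Er d ((false, false) :: s) m ((false, false) :: s') m'.

(** An operator shifts by one the height between two consecutive steps, yet keeps the maximum over
    their three endpoints: the only interior peak, an up step followed by a down step, has an empty
    signature. *)
Lemma fit_closed j d s m : j < size s -> fit d s m ->
  (0 < sphi j s m -> fit d (sdn j s m).1 (sdn j s m).2 /\ size (sdn j s m).1 = size s) /\
  (0 < seps j s m -> fit d (sup j s m).1 (sup j s m).2 /\ size (sup j s m).1 = size s).
Proof.
elim: s d j => [//|[a b] s IH] d [|j] /=; last first.
  move=> hj; have {}IH d' : fit d' s m ->
      (0 < sphi j s m -> fit d' (sdn j s m).1 (sdn j s m).2 /\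
        (size (sdn j s m).1).+1 = (size s).+1) /\
      (0 < seps j s m -> fit d' (sup j s m).1 (sup j s m).2 /\
        (size (sup j s m).1).+1 = (size s).+1).
    move=> /(IH d' j hj)[h1 h2].
    by split=> [/h1|/h2] [? ->].
  by case: a b => [] [] /=; try case: d => //; move=> *; apply: IH.
case: s {IH} => [|[a' b'] s] /=.
  by move=> _; case: a b => [] []; try case: d => //; case: m => //= *; split=> //= _; split=> //; lia.
move=> _; case: a b a' b' => [] [] [] []; try case: d => //=; try case=> //=. all: try by move=> *; split.

Qed.

Lemma Er_size d s m s' m' : Er d s m s' m' -> size s' = size s.
Proof. by elim=> //= *; congr S. Qed.

Ltac er := simpl; first [ assumption | exact: ErZ | apply: ErP; simpl; (done || lia)
  | apply: ErU; er | apply: (@ErH _ true); er | apply: (@ErH _ false); er | apply: ErD; er ].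

Definition Er_ok j d s m s' m' :=
  [/\ seps j s m = seps j s' m', sphi j s m = sphi j s' m',
  0 < sphi j s m -> Er d (sdn j s m).1 (sdn j s m).2 (sdn j s' m').1 (sdn j s' m').2 &
  0 < seps j s m -> Er d (sup j s m).1 (sup j s m).2 (sup j s' m').1 (sup j s' m').2].

(** An operator next to the erased step may carry it to a neighbouring pair, since up-flat and
    flat-up are exchanged; one acting further right preserves [fit], and one further left acts alike
    on both paths. *)
Lemma Er_closed j d s m s' m' : j < size s -> Er d s m s' m' -> Er_ok j d s m s' m'.
Proof.
elim: s d j s' m' => [//|p s IH] d [|j] s' m' hj h; last first.
  inversion h as [|t mt hf|d' t mt t' mt' e|d' b t mt t' mt' e|d' t mt t' mt' e]; subst => {h}.
  - have [h1 h2] := fit_closed (j := j) hj hf.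
    by split=> //= [/h1|/h2] [? _]; apply: ErP.
  - by have [e1 e2 e3 e4] := IH _ j _ _ hj e; split=> //= [/e3|/e4]; apply: ErU.
  - by have [e1 e2 e3 e4] := IH _ j _ _ hj e; split=> //= [/e3|/e4]; apply: ErH.
  - by have [e1 e2 e3 e4] := IH _ j _ _ hj e; split=> //= [/e3|/e4]; apply: ErD.
move=> {IH hj}; case: s h => [|q s] h.
  inversion h as [|t mt hf|d' t mt t' mt' e|d' b t mt t' mt' e|d' t mt t' mt' e]; subst => {h};
    try (inversion e; subst => {e}).
  - by move: hf => /=; rewrite leqn0 => /eqP->; split.
  - by split.
  - by case: b; split=> //= *; er.
  - by split=> //= *; er.
inversion h as [|t mt hf|d' t mt t' mt' e|d' b t mt t' mt' e|d' t mt t' mt' e]; subst => {h}.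
- by case: q hf => [[] []] hf //; split=> //= *; er.
- inversion e; subst => {e}; try match goal with b : bool |- _ => case: b end;
    split=> //= *; er.
- case: b; inversion e; subst => {e}; try match goal with b : bool |- _ => case: b end;
    split=> //= *; er.
- inversion e; subst => {e}; try match goal with b : bool |- _ => case: b end;
    split=> //= *; er.
Qed.

(** * The combinatorics of columns *)

Definition colrel n (a b : nat) := (a < b) || ((a == n) && (b == n)).
Definition NN n (v : seq nat) z := count (fun x => (x <= z) || (n.*2 - z <= x)) v.

Lemma colrel_trans n : transitive (colrel n).
Proof. by move=> b a c; rewrite /colrel; lia. Qed.

Lemma colw_sorted n k s m : k + size s = n -> pairwise (colrel n) (colw n k s m).
Proof.
elim: s k => [|p s IH] k /= hk.
  by elim: m => //= m ->; rewrite andbT; apply/allP => x /nseqP[-> _]; rewrite /colrel eqxx orbT.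
have hb x : x \in colw n k.+1 s m -> k < x < n.*2 - k.
  by move=> /colw_bound; lia.
rewrite !pairwise_cat IH; last by lia.
rewrite allrel_catr; apply/and3P; split.
- apply/andP; split; apply/allrelP => x y /nseqP[-> _].
    by move=> /hb; rewrite /colrel; lia.
  by move=> /nseqP[-> _]; rewrite /colrel; lia.
- by case: (p.1).
rewrite andTb; apply/andP; split; last by case: (p.2).
by apply/allrelP => x y /hb hx /nseqP[-> _]; rewrite /colrel; lia.
Qed.

Lemma colw_ex n d k v : k + d = n -> pairwise (colrel n) v ->
  all (fun x => k <= x <= n.*2 - k) v -> exists s m, size s = d /\ v = colw n k s m.
Proof.
elim: d k v => [|d IH] k v hk hp ha.
  exists [::], (size v); split=> //=; apply/all_pred1P.
  by apply: sub_all ha => x /=; lia.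
have [a [v1 [e1 h1]]] : exists (a : bool) v1, v = nseq a k ++ v1 /\ all (fun x => k < x) v1.
  case: v hp ha => [|x v] /=; first by exists false, [::].
  case/andP=> hx hp /andP[hk2 ha]; have [e|ne] := eqVneq x k.
    exists true, v; rewrite e; split=> //; apply: sub_all hx => y; rewrite /colrel e; lia.
  exists false, (x :: v); split=> //=; apply/andP; split; first by lia.
  by apply: sub_all hx => y; rewrite /colrel; lia.
have [b [v2 [e2 h2]]] : exists (b : bool) v2, v1 = v2 ++ nseq b (n.*2 - k) /\ all (fun x => x < n.*2 - k) v2.
  move: hp ha; rewrite e1 pairwise_cat all_cat => /and3P[_ _ hp] /andP[_ ha].
  case/lastP: v1 h1 hp ha {e1} => [|v1 x] h1 hp ha; first by exists false, [::].
  move: hp ha h1; rewrite -cats1 pairwise_cat !all_cat /= allrel1r => /and3P[hx hp _] /and3P[ha hk2 _] /and3P[h1 hk3 _].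
  have [e|ne] := eqVneq x (n.*2 - k).
    exists true, v1; rewrite e; split=> //; apply: sub_all hx => y; rewrite /colrel e; lia.
  exists false, (v1 ++ [:: x]); rewrite cats0; split=> //; rewrite all_cat /= andbT; apply/andP; split; last by lia.
  by apply: sub_all hx => y; rewrite /colrel; lia.
have [|||s [m [es e]]] := IH k.+1 v2; first by lia.
- by move: hp; rewrite e1 e2 !pairwise_cat => /and3P[_ _ /and3P[_ ->]].
- move: ha h1 h2; rewrite e1 e2 !all_cat => /and3P[_ ha _] /andP[h1 _] h2.
  apply/allP => x hx; have := allP ha x hx; have := allP h1 x hx; have := allP h2 x hx; lia.
exists ((a, b) :: s), m; split; first by rewrite /= es.
by rewrite e1 e2 e.
Qed.

(** N(z) for the letter z of rank [j], seen on the pairs; the path has height [cnt j s] minus [j.+1]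
    after its step [j]. *)
Fixpoint cnt j (s : seq (bool * bool)) : nat :=
  if s is p :: s' then p.1 + p.2 + (if j is j'.+1 then cnt j' s' else 0) else 0.
Definition tot (s : seq (bool * bool)) : nat := sumn [seq nat_of_bool p.1 + nat_of_bool p.2 | p <- s].

Lemma size_colw n k s m : size (colw n k s m) = tot s + m.
Proof.
elim: s k => [|p s IH] k /=; first by rewrite size_nseq.
by rewrite !size_cat !size_nseq IH /tot /=; lia.
Qed.

Lemma NN_colw n k s m j : k + size s = n -> j < size s -> NN n (colw n k s m) (k + j) = cnt j s.
Proof.
elim: s k j => [//|p s IH] k j /= hk hj.
rewrite /NN !count_cat !count_nseq -/(NN _ _ _).
have -> : (k <= k + j) || (n.*2 - (k + j) <= k) by lia.
have -> : (n.*2 - k <= k + j) || (n.*2 - (k + j) <= n.*2 - k) by lia.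
rewrite !mul1n.
have -> : NN n (colw n k.+1 s m) (k + j) = if j is j'.+1 then cnt j' s else 0.
  case: j hj => [|j] hj; last by rewrite -addSnnS IH //; lia.
  apply/eqP; rewrite -leqn0 leqNgt -has_count; apply/hasPn => x /colw_bound hx.
  by have := hx ltac:(lia); lia.
by case: j {hj} => [|j] /=; lia.
Qed.

Lemma mem_colw_lo n k s m j : k + size s = n -> j < size s ->
  (k + j \in colw n k s m) = (nth (false, false) s j).1.
Proof.
elim: s k j => [//|p s IH] k j /= hk hj; rewrite !mem_cat !mem_nseq.
have -> : (k + j == n.*2 - k) = false by lia.
rewrite andbF orbF; case: j hj => [|j] hj /=.
  rewrite addn0 eqxx andbT; case: (p.1) => //=; apply/negP => /colw_bound h.
  by have := h ltac:(lia); lia.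
rewrite -addSnnS IH; [|lia..].
by rewrite (_ : (k.+1 + j == k) = false) ?andbF //; lia.
Qed.

Lemma mem_colw_hi n k s m j : k + size s = n -> j < size s ->
  (n.*2 - (k + j) \in colw n k s m) = (nth (false, false) s j).2.
Proof.
elim: s k j => [//|p s IH] k j /= hk hj; rewrite !mem_cat !mem_nseq.
have -> : (n.*2 - (k + j) == k) = false by lia.
rewrite andbF orFb; case: j hj => [|j] hj /=.
  rewrite addn0 eqxx andbT; case: (p.2) => /=; first by rewrite orbT.
  rewrite orbF; apply/negP => /colw_bound h.
  by have := h ltac:(lia); lia.
rewrite -addSnnS IH; [|lia..].
by rewrite (_ : (n.*2 - (k.+1 + j) == n.*2 - k) = false) ?andbF ?orbF //; lia.
Qed.

Lemma rem_catl (T : eqType) (x : T) u v : x \in u -> rem x (u ++ v) = rem x u ++ v.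
Proof.
elim: u => //= y u IH; rewrite in_cons eq_sym; case: eqP => //= _ h.
by rewrite IH.
Qed.

Lemma rem_catr (T : eqType) (x : T) u v : x \notin u -> rem x (u ++ v) = u ++ rem x v.
Proof.
elim: u => //= y u IH; rewrite in_cons negb_or eq_sym => /andP[/negbTE-> h].
by rewrite IH.
Qed.

Lemma rem_colw n k s m j : k + size s = n -> j < size s -> nth (false, false) s j = (true, true) ->
  rem (n.*2 - (k + j)) (rem (k + j) (colw n k s m)) = colw n k (set_nth (false, false) s j (false, false)) m.
Proof.
elim: s k j => [//|p s IH] k [|j] /= hk hj hp.
  rewrite hp /= addn0 eqxx rem_catr /= ?eqxx ?cats0 //.
  by apply/negP => /colw_bound h; have := h ltac:(lia); lia.
have h1 : k + j.+1 \in colw n k.+1 s m by rewrite -addSnnS mem_colw_lo ?hp //; lia.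
have h2 : n.*2 - (k + j.+1) \in colw n k.+1 s m by rewrite -addSnnS mem_colw_hi ?hp //; lia.
have h3 : n.*2 - (k + j.+1) \in rem (k + j.+1) (colw n k.+1 s m).
  by move: h2; rewrite (perm_mem (perm_to_rem h1)) in_cons; case: eqP => //; lia.
have nx x : k < x < n.*2 - k -> x \notin nseq p.1 k.
  by move=> h; rewrite mem_nseq negb_and; apply/orP; right; lia.
rewrite rem_catr; last by apply: nx; lia.
rewrite rem_catr; last by apply: nx; lia.
rewrite (rem_catl _ h1) (rem_catl _ h3); congr (_ ++ (_ ++ _)).
by rewrite -addSnnS IH //; lia.
Qed.

Lemma rem_colw0 n k s m : k + size s = n -> rem n (colw n k s m.+1) = colw n k s m.
Proof.
elim: s k => [|p s IH] k /= hk; first by rewrite eqxx.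
have h1 : n \in colw n k.+1 s m.+1.
  elim: s k.+1 {IH hk} => [|q s IH] k' /=; first by rewrite in_cons eqxx.
  by rewrite !mem_cat IH orbT.
rewrite rem_catr; last by rewrite mem_nseq negb_and; apply/orP; right; lia.
by rewrite rem_catl // IH //; lia.
Qed.

Lemma cntS p s j : cnt j.+1 (p :: s) = p.1 + p.2 + cnt j s.
Proof. by []. Qed.

Lemma cnt0 p s : cnt 0 (p :: s) = p.1 + p.2.
Proof. by rewrite /= addn0. Qed.

Lemma tot_cons p s : tot (p :: s) = p.1 + p.2 + tot s.
Proof. by []. Qed.

Lemma fitP d s m : fit d s m <->
  (forall j, j < size s -> cnt j s <= j.+1 + d) /\ tot s + m <= size s + d.
Proof.
elim: s d => [|p s IH] d; first by split=> [h|[_ h]]; [split|].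
(* [d'] is the distance to the ceiling after the step [p]: it loses one at a full pair and gains one
   at an absent pair. *)
have E d' : d + 1 = d' + p.1 + p.2 ->
    ((forall j, j < size (p :: s) -> cnt j (p :: s) <= j.+1 + d) /\
      tot (p :: s) + m <= size (p :: s) + d) <->
    ((forall j, j < size s -> cnt j s <= j.+1 + d') /\ tot s + m <= size s + d').
  move=> ed; rewrite tot_cons [size _]/=; split=> -[h1 h2]; split; try lia.
    by move=> j hj; have := h1 j.+1 hj; rewrite cntS; lia.
  move=> [|j] hj; first by rewrite cnt0; lia.
  by have := h1 j hj; rewrite cntS; lia.
case: p E => [[] []] E /=; last first.
- by rewrite IH (E d.+1) //=; lia.
- by rewrite IH (E d) //=; lia.
- by rewrite IH (E d) //=; lia.
case: d E => [|d] E; last by rewrite IH (E d) //=; lia.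
by split=> // -[/(_ 0 isT)]; rewrite cnt0.
Qed.

(** With [Er_zero], this covers the two ways of first reaching height [d.+1]: at an up step given by
    a full pair, or at the last letter 0. [Er_inv] is the converse of both. *)
Lemma Er_pair d s m j : j < size s -> nth (false, false) s j = (true, true) ->
  cnt j s = j.+2 + d -> (forall j', j' < j -> cnt j' s <= j'.+1 + d) ->
  (forall j', j' < size s -> cnt j' s <= j'.+2 + d) -> tot s + m <= (size s).+1 + d ->
  Er d s m (set_nth (false, false) s j (false, false)) m.
Proof.
elim: s d j => [//|p s IH] d [|j]; rewrite [size _]/= [nth _ _ _]/= => hj hp hc h1 h2 h3.
  move: hc h2 h3; rewrite tot_cons hp cnt0 /= => hc h2 h3.
  have -> : d = 0 by lia.
  apply: ErP; apply/fitP; split; last by lia.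
  by move=> j' hj'; have := h2 j'.+1 hj'; rewrite cntS /=; lia.
have {}IH d' : d + 1 = d' + p.1 + p.2 -> Er d' s m (set_nth (false, false) s j (false, false)) m.
  move=> ed; apply: IH => //.
  - by move: hc; rewrite cntS; lia.
  - by move=> j' hj'; have := h1 j'.+1 hj'; rewrite cntS; lia.
  - by move=> j' hj'; have := h2 j'.+1 hj'; rewrite cntS; lia.
  - by move: h3; rewrite tot_cons; lia.
have := h1 0 isT; rewrite cnt0; case: p {h1 h2 h3 hc} IH => [[] []] /= IH h.
- by case: d IH h => // d IH _; apply: ErU; apply: IH; lia.
- by apply: (@ErH _ true); apply: IH; lia.
- by apply: (@ErH _ false); apply: IH; lia.
- by apply: ErD; apply: IH; lia.
Qed.

Lemma Er_zero d s m : (forall j, j < size s -> cnt j s <= j.+1 + d) ->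
  tot s + m.+1 = (size s).+1 + d -> Er d s m.+1 s m.
Proof.
elim: s d => [|p s IH] d h1 h2.
  by move: h2; rewrite /tot /= => h2; have -> : m = d by [lia]; apply: ErZ.
have {}IH d' : d + 1 = d' + p.1 + p.2 -> Er d' s m.+1 s m.
  move=> ed; apply: IH.
  - by move=> j' hj'; have := h1 j'.+1 hj'; rewrite cntS; lia.
  - by move: h2; rewrite tot_cons /=; lia.
have := h1 0 isT; rewrite cnt0; case: p {h1 h2} IH => [[] []] /= IH h.
- by case: d IH h => // d IH _; apply: ErU; apply: IH; lia.
- by apply: (@ErH _ true); apply: IH; lia.
- by apply: (@ErH _ false); apply: IH; lia.
- by apply: ErD; apply: IH; lia.
Qed.

Lemma Er_inv d s m s' m' : Er d s m s' m' ->
  [/\ forall j, j < size s -> cnt j s <= j.+2 + d, tot s + m <= (size s).+1 + d &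
   (exists j, [/\ j < size s, nth (false, false) s j = (true, true), cnt j s = j.+2 + d,
      forall j', j' < j -> cnt j' s <= j'.+1 + d &
      s' = set_nth (false, false) s j (false, false) /\ m' = m]) \/
   [/\ forall j, j < size s -> cnt j s <= j.+1 + d, s' = s, m = m'.+1 &
      tot s + m = (size s).+1 + d]].
Proof.
have step (p : bool * bool) d0 d1 t mt t' mt' : d0 + 1 = d1 + p.1 + p.2 ->
  [/\ forall j, j < size t -> cnt j t <= j.+2 + d1, tot t + mt <= (size t).+1 + d1 &
   (exists j, [/\ j < size t, nth (false, false) t j = (true, true), cnt j t = j.+2 + d1,
      forall j', j' < j -> cnt j' t <= j'.+1 + d1 &
      t' = set_nth (false, false) t j (false, false) /\ mt' = mt]) \/
   [/\ forall j, j < size t -> cnt j t <= j.+1 + d1, t' = t, mt = mt'.+1 &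
      tot t + mt = (size t).+1 + d1]] ->
  [/\ forall j, j < size (p :: t) -> cnt j (p :: t) <= j.+2 + d0, tot (p :: t) + mt <= (size (p :: t)).+1 + d0 &
   (exists j, [/\ j < size (p :: t), nth (false, false) (p :: t) j = (true, true), cnt j (p :: t) = j.+2 + d0,
      forall j', j' < j -> cnt j' (p :: t) <= j'.+1 + d0 &
      p :: t' = set_nth (false, false) (p :: t) j (false, false) /\ mt' = mt]) \/
   [/\ forall j, j < size (p :: t) -> cnt j (p :: t) <= j.+1 + d0, p :: t' = p :: t, mt = mt'.+1 &
      tot (p :: t) + mt = (size (p :: t)).+1 + d0]].
  move=> ed [h1 h2 h3]; rewrite tot_cons [size (_ :: _)]/=; split; [|lia|].
    move=> [|j] hj; first by rewrite cnt0; lia.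
    by have := h1 j hj; rewrite cntS; lia.
  case: h3 => [[j [g1 g2 g3 g4 [-> ->]]]|[g1 -> g3 g4]].
    left; exists j.+1; split=> //; first by rewrite cntS; lia.
    move=> [|j'] hj'; first by rewrite cnt0; lia.
    by have := g4 j' hj'; rewrite cntS; lia.
  right; split=> //; last by lia.
  move=> [|j] hj; first by rewrite cnt0; lia.
  by have := g1 j hj; rewrite cntS; lia.
elim=> {d s m s' m'}.
- by move=> d; split=> //; right; split.
- move=> s m /fitP[h1 h2]; rewrite tot_cons [size (_ :: _)]/= [_.1]/= [_.2]/=; split; [|lia|].
    move=> [|j] hj; first by rewrite cnt0.
    by have := h1 j hj; rewrite cntS /=; lia.
  by left; exists 0.
- by move=> d s m s' m' _; apply: step => /=; lia.
- by move=> d b s m s' m' _; apply: step => /=; lia.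
- by move=> d s m s' m' _; apply: step => /=; lia.
Qed.

(** * Relation (R5) on words *)

Lemma cntSr j s : j.+1 < size s ->
  cnt j.+1 s = cnt j s + ((nth (false, false) s j.+1).1 + (nth (false, false) s j.+1).2).
Proof.
elim: j s => [|j IH] [|p s] // h; first by case: s h => // q s _; rewrite cntS !cnt0.
by rewrite cntS IH // cntS /=; lia.
Qed.

Lemma cnt_last s : s <> [::] -> cnt (size s).-1 s = tot s.
Proof.
elim: s => [//|p [|q s] IH] _; first by rewrite cnt0 tot_cons addn0.
by rewrite [size _]/= cntS (IH (ltac:(done) : q :: s <> [::])) tot_cons.
Qed.

(** A path climbs by at most one per step, so its first positive height is reached at an up step,
    which is a full pair. *)
Lemma cnt_first_pair s J : J < size s -> J.+2 <= cnt J s ->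
  exists j, [/\ j <= J, j.+2 <= cnt j s & nth (false, false) s j = (true, true)].
Proof.
elim: J => [|J IH] hJ h.
  exists 0; split=> //; case: s hJ h => // [[[] []] s] _ //=; rewrite ?addn0 //.
have [h1|h1] := leqP J.+2 (cnt J s).
  by have [|j [g1 g2 g3]] := IH _ h1; [lia|exists j; split; [lia| |]].
exists J.+1; split=> //; move: h; rewrite cntSr //.
by case: (nth _ _ _) => [[] []] //=; lia.
Qed.

Definition admN n (v : seq nat) := [/\ pairwise (colrel n) v, size v <= n &
  forall z, z < n -> z \in v -> n.*2 - z \in v -> NN n v z <= z.+1].

Lemma NN_cat n u v z : NN n (u ++ v) z = NN n u z + NN n v z.
Proof. exact: count_cat. Qed.

Lemma NN_le n v z : NN n v z <= size v.
Proof. exact: count_size. Qed.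

Lemma NN_all n u z : all (fun y => (y < z) || (n.*2 - z < y)) u -> NN n u z = size u.
Proof.
move=> h; apply/eqP; rewrite -all_count; apply: sub_all h => y; lia.
Qed.

(** The letters outside a factor containing both z and bar z are all counted by N(z), so a proper
    factor of this kind lowers N(z) by at least one. *)
Lemma factors_adm n v : pairwise (colrel n) v -> (forall z, z < n -> NN n v z <= z.+2) ->
  size v <= n.+1 ->
  forall u x t, v = u ++ x ++ t -> size x < size v -> admN n x.
Proof.
move=> + hN hs u x t e hx; rewrite {1}e !pairwise_cat => /and3P[hu _ /and3P[ht px _]].
split=> //; first by lia.
move=> z hz zx zbx; rewrite leqNgt; apply/negP => h.
have := hN z hz; rewrite e !NN_cat (@NN_all n u) ?(@NN_all n t).
- by move: hx; rewrite e !size_cat; lia.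
- apply/allP => y hy; have := allrelP ht _ _ zbx hy; rewrite /colrel; lia.
- apply/allP => y hy; have := allrelP hu _ _ hy _.
  by move=> /(_ z); rewrite mem_cat zx /colrel => /(_ isT); lia.
Qed.

(** For the converse take the least rank at which the bound fails: removing the first or the last
    letter then leaves a factor that is still not admissible. *)
Lemma adm_factors n v : 0 < n -> pairwise (colrel n) v -> all (fun x => x <= n.*2) v ->
  (forall u x t, v = u ++ x ++ t -> x <> [::] -> size x < size v -> admN n x) ->
  (forall z, z < n -> NN n v z <= z.+2) /\ size v <= n.+1.
Proof.
move=> n0 pv bv H.
have hs : size v <= n.+1.
  rewrite leqNgt; apply/negP; case: v {pv bv} H => // x v H h.
  have e : x :: v = [:: x] ++ v ++ [::] by rewrite cats0.
  have ne : v <> [::] by move=> ev; move: h; rewrite ev.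
  by have [_ + _] := H _ _ _ e ne (ltnSn _); move: h => /=; lia.
split=> // z hz.
have [s [m [es ev]]] := @colw_ex n n 0 v (erefl _) pv ltac:(by apply: sub_all bv => y; lia).
have E j : j < n -> NN n v j = cnt j s.
  by move=> hj; rewrite ev -(@NN_colw n 0 s m j) ?es.
elim/ltn_ind: z hz => z IHz hz; rewrite leqNgt; apply/negP => h.
case: z hz IHz h => [|z] hz IHz h.
  by move: h; rewrite E // ; case: (s) => // p s'; rewrite cnt0; case: p => [[] []].
have hz' := IHz z (leqnn _) ltac:(lia).
(* The bound holds at [z] and fails at [z.+1], so the count grows by two in between. *)
have hp : nth (false, false) s z.+1 = (true, true).
  move: h hz'; rewrite !E ?cntSr ?es //; last by lia.
  by case: (nth _ _ _) => [[] []] //=; lia.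
set y := z.+1 in hz h hp *.
have hy : y \in v by rewrite ev -[y]add0n mem_colw_lo ?hp ?es.
have hyb : n.*2 - y \in v by rewrite ev -{1}[y]add0n mem_colw_hi ?hp ?es.
have bad x u t : v = u ++ x ++ t -> size u + size t = 1 -> y \in x -> n.*2 - y \in x -> False.
  move=> e e1 yx ybx.
  have ne : x <> [::] by move=> ex; rewrite ex in yx.
  have [_ _ hx] : admN n x by apply: (H u x t e ne); rewrite e !size_cat; lia.
  have := hx y hz yx ybx; move: h; rewrite e !NN_cat.
  by have := NN_le n u y; have := NN_le n t y; lia.
case: v pv hy hyb h ev bad {H bv hs IHz E hz'} => // x t pv hy hyb h ev bad.
have ne : n.*2 - y <> y by lia.
have [ex|nx] := eqVneq x y; last first.
  have yt : y \in t by move: hy; rewrite in_cons eq_sym (negbTE nx).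
  apply: (bad t [:: x] [::]) => //; first by rewrite cats0.
  move: hyb; rewrite in_cons => /orP[/eqP eb|//].
  by move: pv => /= /andP[/allP/(_ y yt)]; rewrite /colrel; lia.
case/lastP: t pv hy hyb h ev bad => [|t b] pv hy hyb h ev bad.
  by move: hyb; rewrite inE => /eqP; lia.
(* If y is the first letter and bar y the last, neither end can be removed; but then N(y) is only
   2. *)
have [eb|nb] := eqVneq b (n.*2 - y).
  move: h; rewrite -cats1 -cat1s !NN_cat.
  have -> : NN n t y = 0.
    apply/eqP; rewrite -leqn0 leqNgt -has_count; apply/hasPn => c hc.
    move: pv; rewrite /= -cats1 all_cat pairwise_cat allrel1r.
    case/andP=> /andP[/allP/(_ c hc)] + _ /andP[/allP/(_ c hc)].
    by rewrite /colrel ex eb; lia.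
  by rewrite /NN /=; lia.
apply: (bad (x :: t) [::] [:: b]) => //.
- by rewrite /= cats1.
- by rewrite ex mem_head.
- by move: hyb; rewrite -rcons_cons mem_rcons in_cons eq_sym (negbTE nb).
Qed.

Section Words.
Variable n : nat.
Implicit Types w : word n.

Lemma isColumnE w : isColumn n w = (w != [::]) && pairwise (colrel n) (ranks w).
Proof.
rewrite /isColumn; congr (_ && _).
by rewrite -(sorted_pairwise (@colrel_trans n)) /ranks sorted_map.
Qed.

Lemma column_colw w : isColumn n w -> exists s m, size s = n /\ ranks w = colw n 0 s m.
Proof.
rewrite isColumnE => /andP[_ h]; apply: (@colw_ex n n 0) => //.
by apply/allP => x /(allP (ranks_bnd w)); rewrite subn0.
Qed.

Lemma colw_column w s m : size s = n -> ranks w = colw n 0 s m -> w <> [::] -> isColumn n w.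
Proof. by move=> es e /eqP h; rewrite isColumnE h e colw_sorted. Qed.

Lemma NcolE w z : Ncol n w z = NN n (ranks w) z.
Proof. by rewrite /Ncol /NN /ranks count_map. Qed.

Lemma nth_ranks w p : p < size w -> nth 0 (ranks w) p = nth ord0 w p.
Proof. by move=> h; rewrite /ranks (nth_map ord0). Qed.

(** In a column the letters counted by N(z) are those up to the position of z and those from the
    position of bar z on. This turns the distance condition into the condition on N(z). *)
Lemma count_sorted v p q z : pairwise (colrel n) v -> p < size v -> q < size v -> z < n ->
  nth 0 v p = z -> nth 0 v q = n.*2 - z -> p < q /\ NN n v z = p.+1 + (size v - q).
Proof.
move=> pv hp hq hz ep eq.
have mono i j : i < j -> j < size v -> colrel n (nth 0 v i) (nth 0 v j).
  move=> hij hj; move/(pairwiseP 0): pv; apply; rewrite ?inE //.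
  exact: ltn_trans hij hj.
have pq : p < q.
  rewrite ltnNge; apply/negP; rewrite leq_eqVlt => /orP[/eqP e|h].
    by move: ep; rewrite -e eq; lia.
  by have := mono q p h hp; rewrite ep eq /colrel; lia.
split=> //.
have eN i : i < size v -> ((nth 0 v i <= z) || (n.*2 - z <= nth 0 v i)) = (i <= p) || (q <= i).
  move=> hi.
  have [h1|h1|->] := ltngtP i p; last by rewrite ep leqnn.
    by have := mono i p h1 hp; rewrite ep /colrel; lia.
  have [h2|h2|->] := ltngtP i q; last by rewrite eq leqnn orbT.
    by have := mono p i h1 hi; have := mono i q h2 hq; rewrite ep eq /colrel; lia.
  by have := mono q i h2 hi; rewrite eq /colrel; lia.
rewrite /NN -(mkseq_nth 0 v) count_map size_mkseq.
rewrite (eq_in_count (a2 := fun i => (i <= p) || (q <= i))); last first.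
  by move=> i; rewrite mem_iota /= => hi; rewrite eN.
have -> : size v = p.+1 + ((q - p.+1) + (size v - q)) by lia.
rewrite !iotaD !count_cat add0n.
rewrite (eq_in_count (a2 := predT)); last by move=> i; rewrite mem_iota /=; lia.
rewrite (eq_in_count (a2 := pred0) (s := iota p.+1 _)); last by move=> i; rewrite mem_iota /=; lia.
rewrite (eq_in_count (a2 := predT) (s := iota _ (size v - q))); last by move=> i; rewrite mem_iota /=; lia.
by rewrite !count_predT count_pred0 !size_iota; lia.
Qed.

Lemma admissibleP w : admissible n w <-> w <> [::] /\ admN n (ranks w).
Proof.
rewrite /admissible /admN isColumnE size_map; split.
  case=> /andP[/eqP h1 h2] h3 h4; split=> //; split=> // z hz zw zbw.
  set v := ranks w in h2 zw zbw *.
  have sv : size v = size w by rewrite size_map.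
  have hp : index z v < size v by rewrite index_mem.
  have hq : index (n.*2 - z) v < size v by rewrite index_mem.
  have [pq ->] := count_sorted h2 hp hq hz (nth_index 0 zw) (nth_index 0 zbw).
  have /= := h4 (index z v) (index (n.*2 - z) v).
  rewrite -!nth_ranks -?sv // !nth_index // => /(_ hp hq hz erefl); lia.
case=> h1 [h2 h3 h4]; split=> //; first by apply/andP; split=> //; apply/eqP.
move=> p q hp hq /=; move: (nth_ranks hp) (nth_ranks hq).
move: (nth ord0 w p) (nth ord0 w q) => z zb ez ezb' hz ezb.
have {}ezb : nth 0 (ranks w) q = n.*2 - z by rewrite ezb'.
have sv : size (ranks w) = size w by rewrite size_map.
rewrite -sv in hp hq; have [pq e] := count_sorted h2 hp hq hz ez ezb.
have := h4 z hz; rewrite -{1}ez -{1}ezb !mem_nth // => /(_ isT isT); rewrite e sv.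
by move: hp hq; rewrite sv; lia.
Qed.

Lemma ranks_cat u w : ranks (u ++ w) = ranks u ++ ranks w.
Proof. exact: map_cat. Qed.

Lemma ranks_split w u x t : ranks w = u ++ x ++ t ->
  exists u' x' t', [/\ w = u' ++ x' ++ t', ranks u' = u, ranks x' = x & ranks t' = t].
Proof.
move=> e; exists (letters n u), (letters n x), (letters n t).
have := ranks_bnd w; rewrite e /bnd !all_cat => /and3P[hu hx ht].
split; rewrite ?lettersK //; apply: ranks_inj.
by rewrite !ranks_cat !lettersK.
Qed.

Lemma ranks_rem (a : letter n) w : ranks (rem a w) = rem (nat_of_ord a) (ranks w).
Proof. by elim: w => //= b w IH; rewrite (inj_eq (@ord_inj _)); case: eqP => //= _; rewrite ranks_cons IH. Qed.

Lemma mem_ranks (a : letter n) w : (nat_of_ord a \in ranks w) = (a \in w).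
Proof. exact: mem_map (@ord_inj _) _ _. Qed.

Definition small_factors w :=
  forall u v x, w = u ++ x ++ v -> x != [::] -> size x < size w -> admissible n x.

Definition is_R5 w w' := exists s m s' m', [/\ size s = n, ranks w = colw n 0 s m,
  ranks w' = colw n 0 s' m' & Er 0 s m s' m'].

Lemma badZE w s m (z : letter n) : size s = n -> ranks w = colw n 0 s m ->
  badZ n w z <-> [/\ z < n, nth (false, false) s z = (true, true) & z.+2 <= cnt z s].
Proof.
move=> es ew; rewrite /badZ NcolE -mem_ranks.
split=> [[hz h1 [zb h2 ezb] h3]|[hz h1 h2]].
  move: h1 h2 h3; rewrite -(mem_ranks zb) ezb ew -[nat_of_ord z]add0n.
  rewrite mem_colw_lo ?mem_colw_hi ?NN_colw ?es // add0n.
  by case: (nth _ _ _) => a b /= -> ->.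
have e1 : nat_of_ord z \in ranks w by rewrite ew -[nat_of_ord z]add0n mem_colw_lo ?es ?h1.
have e2 : n.*2 - z \in ranks w by rewrite ew -{1}[nat_of_ord z]add0n mem_colw_hi ?es ?h1.
split=> //; last by rewrite ew -[nat_of_ord z]add0n NN_colw ?es.
have hb : n.*2 - z < n.*2.+1 by lia.
by exists (Ordinal hb) => //; rewrite -mem_ranks.
Qed.

Lemma R5_column w : 0 < n -> isColumn n w -> small_factors w ->
  exists s m, [/\ size s = n, ranks w = colw n 0 s m, forall j, j < n -> cnt j s <= j.+2 &
    tot s + m <= n.+1].
Proof.
move=> n0 cw hf; have [s [m [es ew]]] := column_colw cw.
have pw : pairwise (colrel n) (ranks w) by move: cw; rewrite isColumnE => /andP[].
have [|h1 h2] := adm_factors n0 pw (ranks_bnd w).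
  move=> u x t e nx hx; have [u' [x' [t' [e' _ ex' _]]]] := ranks_split e.
  have /admissibleP[_] : admissible n x'.
    apply: hf e' _ _; first by apply/eqP => h; apply: nx; rewrite -ex' h.
    by move: hx; rewrite -ex' !size_map.
  by rewrite ex'.
exists s, m; split=> //.
  by move=> j hj; have := h1 j hj; rewrite ew -[j in NN _ _ j]add0n NN_colw ?es.
by move: h2; rewrite ew size_colw.
Qed.

Lemma R5a_Er w (z zb : letter n) : 0 < n -> isColumn n w -> small_factors w ->
  badZ n w z -> (forall z', badZ n w z' -> z <= z') -> (zb : nat) = n.*2 - z ->
  is_R5 w (rem zb (rem z w)).
Proof.
move=> n0 cw hf hb hmin ezb; have [s [m [es ew h1 h2]]] := R5_column n0 cw hf.
have /(badZE z es ew)[hz hp hc] := hb.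
exists s, m, (set_nth (false, false) s z (false, false)), m; split=> //.
  by rewrite !ranks_rem ezb ew -[nat_of_ord z]add0n rem_colw ?es // add0n.
apply: Er_pair; rewrite ?es ?addn0 //.
- by have := h1 z hz; lia.
(* An earlier positive height would begin at an earlier full pair, hence at a smaller bad letter. *)
- move=> j hj; rewrite leqNgt addn0; apply/negP => hc'.
  have [|j' [g1 g2 g3]] := cnt_first_pair _ hc'; first by rewrite es; lia.
  have hb' : j' < n.*2.+1 by lia.
  have : z <= Ordinal hb' by apply: hmin; apply/(badZE _ es ew); split=> //=; lia.
  by rewrite /=; lia.
- by move=> j' hj'; rewrite addn0; apply: h1.
Qed.

(** Without a bad letter the pairs keep the path at or below level 0, so the column can only fail by
    its height; that height is n+1, and the last letter 0 makes the excess. *)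
Lemma R5b_Er w (z0 : letter n) : 0 < n -> isColumn n w -> small_factors w ->
  ~ admissible n w -> (forall z, ~ badZ n w z) -> (z0 : nat) = n -> is_R5 w (rem z0 w).
Proof.
move=> n0 cw hf hna hb ez; have [s [m [es ew h1 h2]]] := R5_column n0 cw hf.
have hc j : j < n -> cnt j s <= j.+1.
  move=> hj; rewrite leqNgt; apply/negP => hc'.
  have [|j' [g1 g2 g3]] := cnt_first_pair _ hc'; first by rewrite es.
  have hb' : j' < n.*2.+1 by lia.
  by apply: (hb (Ordinal hb')); apply/(badZE _ es ew); split=> //=; lia.
have ht : tot s <= n.
  have ns : s <> [::] by move=> e; move: es; rewrite e /=; lia.
  by rewrite -(cnt_last ns) es; have := hc n.-1; lia.
have hs : tot s + m = n.+1.
  apply/eqP; rewrite eqn_leq h2 /= ltnNge; apply/negP => h; apply: hna; apply/admissibleP.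
  move: (cw); rewrite isColumnE => /andP[/eqP nw0 pw]; split=> //; split=> //.
    by rewrite ew size_colw.
  by move=> z hz _ _; rewrite ew -[z in NN _ _ z]add0n NN_colw ?es //; apply: hc.
case: m ew h2 hs => [|m] ew h2 hs; first by lia.
exists s, m.+1, s, m; split=> //.
  by rewrite ranks_rem ez ew rem_colw0.
apply: Er_zero; rewrite ?es ?addn0 //.
by move=> j hj; rewrite addn0; apply: hc.
Qed.

(** The way back from paths, needed because an operator delivers the new instance of (R5) as a
    path. *)
Lemma Er_R5 w w' : 0 < n -> is_R5 w w' -> elemB n w w'.
Proof.
move=> n0 [s [m [s' [m' [es ew ew' er]]]]].
have [h1 h2 h3] := Er_inv er.
rewrite es addn0 in h1 h2.
have w0 : w <> [::].
  move=> e; have : size (ranks w) = 0 by rewrite e.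
  rewrite ew size_colw => h0.
  case: h3 => [[j [hj hp hc _ _]]|[_ _ _ e']]; last by lia.
  have : 0 + j \in colw n 0 s m by rewrite mem_colw_lo ?hp.
  by move/size0nil: (etrans (size_colw n 0 s m) h0) => ->.
have cw : isColumn n w := colw_column es ew w0.
have hf : small_factors w.
  move=> u v x e x0 hx; apply/admissibleP; split; first by apply/eqP.
  apply: (@factors_adm n (ranks w) _ _ _ (ranks u) _ (ranks v)).
  - by move: cw; rewrite isColumnE => /andP[].
  - move=> z hz; rewrite ew -[z in NN _ _ z]add0n NN_colw ?es //.
    by have := h1 z hz; rewrite addn0.
  - by rewrite ew size_colw.
  - by rewrite e !ranks_cat.
  - by rewrite !size_map.
case: h3 => [[j [hj hp hc hlt [es' em']]]|[hc es' em hs]].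
  have hb : j < n.*2.+1 by rewrite es in hj; lia.
  have hb' : n.*2 - j < n.*2.+1 by lia.
  have hjn : j < n by rewrite -es.
  have bz : badZ n w (Ordinal hb).
    by apply/(badZE _ es ew); split=> //=; rewrite hc addn0.
  have -> : w' = rem (Ordinal hb') (rem (Ordinal hb) w).
    apply: ranks_inj; rewrite !ranks_rem /= ew' ew es' em' -[j in rem j _]add0n -[j in n.*2 - j]add0n.
    by rewrite rem_colw ?es.
  apply: R5a => //.
  - move=> /admissibleP[_ [_ _ h]]; have := h j hjn.
    rewrite ew -{1 3}[j]add0n mem_colw_lo ?es ?hp //.
    rewrite -{1}[j]add0n mem_colw_hi ?es ?hp // NN_colw ?es // hc => /(_ isT isT); lia.
  - move=> z' /(badZE _ es ew)[g1 g2 g3]; rewrite leqNgt; apply/negP => /= hz.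
    by have := hlt z' hz; lia.
have hb : n < n.*2.+1 by lia.
have -> : w' = rem (Ordinal hb) w.
  by apply: ranks_inj; rewrite ranks_rem /= ew' ew em es' rem_colw0.
apply: R5b => //.
- move=> /admissibleP[_ [_ + _]]; rewrite ew size_colw; move: hs; rewrite es; lia.
- move=> z /(badZE _ es ew)[g1 _ g3]; have := hc z; rewrite es => /(_ g1); lia.
Qed.
End Words.

(** * Compatibility of the congruence with the crystal operators *)

Definition elemN n (x y : seq nat) := elem3 n x y \/
  exists s m s' m', [/\ size s = n, x = colw n 0 s m, y = colw n 0 s' m' & Er 0 s m s' m'].

Definition stepN n (x y : seq nat) := exists u v p q,
  [/\ elemN n p q, x = u ++ p ++ v & y = u ++ q ++ v].

Lemma sdn_size j s m : size (sdn j s m).1 = size s.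
Proof.
elim: s j => [|p s IH] [|j] //=; last by rewrite IH.
by case: s {IH} => [|q s]; case: ifP.
Qed.

Lemma sup_size j s m : size (sup j s m).1 = size s.
Proof.
elim: s j => [|p s IH] [|j] //=; last by rewrite IH.
by case: s {IH} => [|q s]; case: ifP.
Qed.

Lemma elemN_closed n i x y : 2 <= n -> 1 <= i <= n -> elemN n x y -> closed_at (elemN n) n i x y.
Proof.
move=> hn hi [h|[s [m [s' [m' [es -> -> er]]]]]].
  have [h1 h2 h3 h4] := elem3_closed hn hi h.
  by split=> // [/h3|/h4] ?; left.
have es' : size s' = n by rewrite (Er_size er).
have hj : i.-1 < size s by lia.
have [c1 c2 c3 c4] := @colw_ok n i hi i.-1 0 s m ltac:(by []) ltac:(lia) hj.
have [d1 d2 d3 d4] := @colw_ok n i hi i.-1 0 s' m' ltac:(by []) ltac:(lia) ltac:(by rewrite es' -es).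
have [g1 g2 g3 g4] := Er_closed hj er.
split; rewrite ?c1 ?d1 ?c2 ?d2 //.
- move=> h; rewrite c3 // d3 -?g2 //; right.
  by do 4 eexists; split; last exact: g3; rewrite ?sdn_size.
- move=> h; rewrite c4 // d4 -?g1 //; right.
  by do 4 eexists; split; last exact: g4; rewrite ?sup_size.
Qed.

Lemma stepN_closed n i x y : 2 <= n -> 1 <= i <= n -> stepN n x y -> closed_at (stepN n) n i x y.
Proof.
move=> hn hi [u [v [p [q [h -> ->]]]]].
have [h1 h2 h3 h4] := elemN_closed hn hi h.
have e1 : weps (Lc n i) (u ++ p ++ v) = weps (Lc n i) (u ++ q ++ v).
  by rewrite !weps_cat h1 h2.
split=> //.
- by rewrite !wphi_cat !weps_cat h1 h2.
- rewrite !wdn_cat !weps_cat h1 h2 => hf; case: ifP => c1; first by exists (wdn (Lc n i) u), v, p, q.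
  case: ifP => c2; last by exists u, (wdn (Lc n i) v), p, q.
  exists u, v, (wdn (Lc n i) p), (wdn (Lc n i) q); split=> //; apply: h3.
  by rewrite h2; exact: leq_ltn_trans c2.
- move=> he; have he' := he; rewrite e1 in he'; rewrite (wup_cat he) (wup_cat he') !weps_cat h1 h2.
  case: ifP => c1; last by exists (wup (Lc n i) u), v, p, q.
  have c0 w : weps (Lc n i) w = weps (Lc n i) q -> wphi (Lc n i) w = wphi (Lc n i) q ->
     0 < weps (Lc n i) (w ++ v).
    by move=> a b; rewrite weps_cat a b; move: c1; rewrite ?weps_cat; lia.
  rewrite (wup_cat (c0 _ h1 h2)) (wup_cat (c0 _ erefl erefl)) h2.
  case: ifP => c2; first by exists u, (wup (Lc n i) v), p, q.
  exists u, v, (wup (Lc n i) p), (wup (Lc n i) q); split=> //; apply: h4.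
  by rewrite h1; move: c1; lia.
Qed.

Section WordStep.
Variable n : nat.
Hypothesis hn : 2 <= n.
Implicit Types w : word n.

Lemma nw3 w a b c : ranks w = [:: a; b; c] -> exists x y z : letter n,
  [/\ w = [:: x; y; z], (x : nat) = a, (y : nat) = b & (z : nat) = c].
Proof. by case: w => [|x [|y [|z []]]] // [<- <- <-]; exists x, y, z. Qed.

Lemma elemB_N w w' : elemB n w w' -> elemN n (ranks w) (ranks w').
Proof.
have n0 : 0 < n by lia.
have lt (x : letter n) : x <= n.*2 by rewrite -ltnS ltn_ord.
case.
- by move=> x y z h1 h2 h3; left; rewrite /ranks /=; have lz := lt z; apply: E3a; lia.
- by move=> x y z h1 h2 h3; left; rewrite /ranks /=; have lz := lt z; apply: E3b; lia.
- by move=> x y h1 h2 h3; left; rewrite /ranks /=; have lz := lt y; apply: E3a; lia.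
- by move=> x y h1 h2 h3; left; rewrite /ranks /=; have lz := lt y; apply: E3b; lia.
- by move=> x y a b xb *; left; rewrite /ranks /=; apply: E3c; lia.
- by move=> x y a b xb *; left; rewrite /ranks /=; apply: E3d; lia.
- by move=> z0 nb nn *; left; rewrite /ranks /=; apply: E3e; lia.
- by move=> z0 x *; left; rewrite /ranks /=; apply: E3a; lia.
- by move=> z0 x xb *; left; rewrite /ranks /=; apply: E3b; lia.
- move=> {}w z zb cw _ hf hb hm ez; right; exact: R5a_Er.
- move=> {}w z0 cw na hf hb ez; right; exact: R5b_Er.
Qed.

Lemma elemN_B w w' : elemN n (ranks w) (ranks w') -> elemB n w w'.
Proof.
have n0 : 0 < n by lia.
case; last by move=> h; apply: Er_R5.
move eX : (ranks w) => X; move eY : (ranks w') => Y h; case: h eX eY => a b c a' b' c'.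
- move=> -> -> -> h1 h2 h3 h4 h5 h6 /nw3[x [y [z [-> ? ? ?]]]] /nw3[x' [y' [z' [-> ? ? ?]]]].
  have -> : x' = x by apply: ord_inj; lia.
  have -> : y' = z by apply: ord_inj; lia.
  have -> : z' = y by apply: ord_inj; lia.
  have [e|ne] := eqVneq a c.
    have -> : x = z by apply: ord_inj; lia.
    have := h4 e; move=> ?; apply: R2a; lia.
  have [e|ne'] := eqVneq a b.
    have -> : y = x by apply: ord_inj; lia.
    by have := h5 e; move=> ?; apply: R4a; lia.
  by apply: R1a; lia.
- move=> -> -> -> h1 h2 h3 h4 h5 h6 /nw3[x [y [z [-> ? ? ?]]]] /nw3[x' [y' [z' [-> ? ? ?]]]].
  have -> : x' = y by apply: ord_inj; lia.
  have -> : y' = x by apply: ord_inj; lia.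
  have -> : z' = z by apply: ord_inj; lia.
  have [e|ne] := eqVneq b c.
    have -> : z = y by apply: ord_inj; lia.
    by have := h4 e; move=> ?; apply: R2b; lia.
  have [e|ne'] := eqVneq a c.
    have -> : z = x by apply: ord_inj; lia.
    have hb : n.*2 - y < n.*2.+1 by lia.
    have := h5 e; have := ltn_ord y; move=> hy ?; apply: (@R4b n x (Ordinal hb)) => /=; lia.
  by apply: R1b; lia.
- move=> -> e1 e2 h1 h2 h3 h4 /nw3[x [y [z [-> ? ? ?]]]] /nw3[x' [y' [z' [-> ? ? ?]]]].
  have -> : x' = x by apply: ord_inj; lia.
  by apply: R3a; lia.
- move=> e1 e2 e3 h1 h2 h3 h4 /nw3[x [y [z [-> ? ? ?]]]] /nw3[x' [y' [z' [-> ? ? ?]]]].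
  have -> : z' = z by apply: ord_inj; lia.
  by apply: R3b; lia.
- move=> -> -> e -> -> -> /nw3[x [y [z [-> ? ? ?]]]] /nw3[x' [y' [z' [-> ? ? ?]]]].
  have -> : x' = y by apply: ord_inj; lia.
  have -> : y' = z by apply: ord_inj; lia.
  have -> : z' = x by apply: ord_inj; lia.
  by apply: R3c; lia.
Qed.

Lemma stepB_N w w' : stepB n w w' <-> stepN n (ranks w) (ranks w').
Proof.
split=> [[u [v [x [y [h -> ->]]]]]|[u [v [p [q [h e e']]]]]].
  by exists (ranks u), (ranks v), (ranks x), (ranks y); rewrite !ranks_cat; split=> //; apply: elemB_N.
have [u1 [x [v1 [-> eu ex ev]]]] := ranks_split e.
have [u2 [y [v2 [-> eu' ey ev']]]] := ranks_split e'.
have -> : u2 = u1 by apply: ranks_inj; rewrite eu eu'.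
have -> : v2 = v1 by apply: ranks_inj; rewrite ev ev'.
by exists u1, v1, x, y; split=> //; apply: elemN_B; rewrite ex ey.
Qed.

Lemma congB_cat u v w w' : congB n w w' -> congB n (u ++ w ++ v) (u ++ w' ++ v).
Proof.
elim=> {w w'} [w w' [u1 [v1 [x [y [h -> ->]]]]]|w|w w' _|w1 w2 w3 _ h1 _].
- by apply: rst_step; exists (u ++ u1), (v1 ++ v), x, y; rewrite -!catA.
- exact: rst_refl.
- exact: rst_sym.
- exact: rst_trans.
Qed.

Definition bisim_at i w w' :=
  [/\ weps (Lc n i) (ranks w) = weps (Lc n i) (ranks w'), wphi (Lc n i) (ranks w) = wphi (Lc n i) (ranks w'),
   forall x, fB n i w = Some x -> exists2 y, fB n i w' = Some y & congB n x y &
   forall x, eB n i w = Some x -> exists2 y, eB n i w' = Some y & congB n x y].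

Lemma stepN_sym_closed i (w w' : word n) : 1 <= i <= n ->
  closed_at (stepN n) n i (ranks w) (ranks w') -> bisim_at i w w' /\ bisim_at i w' w.
Proof.
move=> hi [h1 h2 h3 h4].
have F x y : 0 < wphi (Lc n i) (ranks w) -> ranks x = wdn (Lc n i) (ranks w) ->
    ranks y = wdn (Lc n i) (ranks w') -> congB n x y.
  by move=> h e e'; apply/rst_step/stepB_N; rewrite e e'; apply: h3.
have E x y : 0 < weps (Lc n i) (ranks w) -> ranks x = wup (Lc n i) (ranks w) ->
    ranks y = wup (Lc n i) (ranks w') -> congB n x y.
  by move=> h e e'; apply/rst_step/stepB_N; rewrite e e'; apply: h4.
have [b b'] := (ranks_bnd w, ranks_bnd w').
split; split=> // x.
- move=> /(fBP hi)[h e]; exists (letters n (wdn (Lc n i) (ranks w'))).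
    by apply/fBP; rewrite // -h2 lettersK ?bnd_dn.
  by apply: F => //; rewrite lettersK ?bnd_dn.
- move=> /(eBP hi)[h e]; exists (letters n (wup (Lc n i) (ranks w'))).
    by apply/eBP; rewrite // -h1 lettersK ?bnd_up.
  by apply: E => //; rewrite lettersK ?bnd_up.
- move=> /(fBP hi)[h e]; exists (letters n (wdn (Lc n i) (ranks w))).
    by apply/fBP; rewrite // h2 lettersK ?bnd_dn.
  by apply/rst_sym/F; rewrite ?h2 // lettersK ?bnd_dn.
- move=> /(eBP hi)[h e]; exists (letters n (wup (Lc n i) (ranks w))).
    by apply/eBP; rewrite // h1 lettersK ?bnd_up.
  by apply/rst_sym/E; rewrite ?h1 // lettersK ?bnd_up.
Qed.

Lemma congB_bisim i w w' : 1 <= i <= n -> congB n w w' -> bisim_at i w w'.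
Proof.
move=> hi h; suff [] : bisim_at i w w' /\ bisim_at i w' w by [].
elim: h => {w w'} [w w' /stepB_N/(stepN_closed hn hi)|w|w w' _ []|w1 w2 w3 _ [h1 h2] _ [g1 g2]] //.
- exact: stepN_sym_closed.
- by split; split=> // x h; exists x => //; exact: rst_refl.
- have tr x y z : bisim_at i x y -> bisim_at i y z -> bisim_at i x z.
    move=> [a1 a2 a3 a4] [b1 b2 b3 b4]; split; rewrite ?a1 ?a2 //.
      move=> t /a3[t' /b3[t'' ? c] c']; exists t'' => //; exact: rst_trans c' c.
    move=> t /a4[t' /b4[t'' ? c] c']; exists t'' => //; exact: rst_trans c' c.
  by split; [apply: tr h1 g1|apply: tr g2 h2].
Qed.
End WordStep.

(** * Highest weight words are congruent to highest weight tableaux *)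

Definition readY (Y : seq nat) : seq nat := flatten (rev [seq iota 0 h | h <- Y]).

Lemma readY_cat Y1 Y2 : readY (Y1 ++ Y2) = readY Y2 ++ readY Y1.
Proof. by rewrite /readY map_cat rev_cat flatten_cat. Qed.

Lemma readY_cons h Y : readY (h :: Y) = readY Y ++ iota 0 h.
Proof. by rewrite /readY /= rev_cons flatten_rcons. Qed.

Definition del m q := iota 0 q ++ iota q.+1 (m - q.+1).

(** Among columns of equal height, the first can grow and the last ([sorted_last_occ]) can shrink
    while the heights stay decreasing. *)
Lemma sorted_first_occ Y (a : nat) : sorted geq Y -> a \in Y ->
  exists Y1 Y2, Y = Y1 ++ a :: Y2 /\ all (fun h => a < h) Y1.
Proof.
elim: Y => [//|h Y IH] sY; rewrite in_cons => hm.
have [e|ne] := eqVneq a h; first by exists [::], Y; rewrite e.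
rewrite (negbTE ne) /= in hm.
have [Y1 [Y2 [e hY1]]] := IH (path_sorted sY) hm.
exists (h :: Y1), Y2; rewrite e /=; split=> //; rewrite hY1 andbT.
have := order_path_min (rev_trans leq_trans) sY => /allP/(_ a hm) /=; lia.
Qed.

Lemma sorted_last_occ Y (a : nat) : sorted geq Y -> a \in Y ->
  exists Y1 Y2, Y = Y1 ++ a :: Y2 /\ all (fun h => h < a) Y2.
Proof.
elim: Y => [//|h Y IH] sY; rewrite in_cons => hm.
case: (boolP (a \in Y)) => h1.
  have [Y1 [Y2 [e hY2]]] := IH (path_sorted sY) h1.
  by exists (h :: Y1), Y2; rewrite e.
rewrite (negbTE h1) orbF in hm; exists [::], Y; split; first by rewrite (eqP hm).
apply/allP => x hx; have := order_path_min (rev_trans leq_trans) sY => /allP/(_ x hx) /=.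
by rewrite -(eqP hm); have : x != a by [apply: contraNneq h1 => <-]; lia.
Qed.

Section Insertion.
Variable n : nat.
Hypothesis hn : 2 <= n.

Definition cong_nat X Y := congB n (letters n X) (letters n Y).

Lemma cong_nat_refl X : cong_nat X X. Proof. exact: rst_refl. Qed.
Lemma cong_nat_trans Y X Z : cong_nat X Y -> cong_nat Y Z -> cong_nat X Z.
Proof. exact: rst_trans. Qed.
Lemma letters_cat u v : letters n (u ++ v) = letters n u ++ letters n v.
Proof. exact: map_cat. Qed.

Lemma cong_nat_cat u v X Y : cong_nat X Y -> cong_nat (u ++ X ++ v) (u ++ Y ++ v).
Proof. by move=> h; rewrite /cong_nat !letters_cat; apply: congB_cat. Qed.

Lemma cong_nat_catl u X Y : cong_nat X Y -> cong_nat (u ++ X) (u ++ Y).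
Proof. by move=> h; have := cong_nat_cat u [::] h; rewrite !cats0. Qed.

Lemma cong_nat_catr v X Y : cong_nat X Y -> cong_nat (X ++ v) (Y ++ v).
Proof. exact: (cong_nat_cat [::] v). Qed.

Lemma cong_nat_elem X Y : bnd n X -> bnd n Y -> elemN n X Y -> cong_nat X Y.
Proof.
move=> bx bY h; apply: rst_step; exists [::], [::], (letters n X), (letters n Y).
by rewrite /= !cats0; split=> //; apply: elemN_B; rewrite ?lettersK.
Qed.

Lemma cong_nat_push_right j r : j + r < n -> cong_nat (iota j r.+1 ++ [:: j]) (j :: iota j r.+1).
Proof.
elim: r => [|r IH] hr; first exact: cong_nat_refl.
case: r IH hr => [|r] IH hr.
  by apply: cong_nat_elem => /=; [lia|lia|left; apply: E3a; lia].
have e1 : iota j r.+3 = iota j r.+1 ++ [:: j + r.+1; (j + r.+1).+1].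
  by have -> : r.+3 = r.+1 + 2 by [lia]; rewrite iotaD.
have e2 : iota j r.+2 = iota j r.+1 ++ [:: j + r.+1] by have -> : r.+2 = r.+1 + 1 by [lia]; rewrite iotaD.
apply: (@cong_nat_trans ((iota j r.+2 ++ [:: j]) ++ [:: (j + r.+1).+1])).
  rewrite e1 e2 -!catA; apply: cong_nat_catl.
  by apply: cong_nat_elem => /=; [lia|lia|left; apply: E3a; lia].
have -> : j :: iota j r.+3 = (j :: iota j r.+2) ++ [:: (j + r.+1).+1].
  by rewrite e1 e2 /= -catA.
by apply/cong_nat_catr/IH; lia.
Qed.

Lemma cong_nat_push_left s t j : s + t = j -> j < n ->
  cong_nat (iota s t ++ [:: j; j]) (j :: iota s t ++ [:: j]).
Proof.
elim: t s => [|t IH] s hs hj; first exact: cong_nat_refl.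
case: t IH hs => [|t] IH hs.
  by apply: cong_nat_elem => /=; [lia|lia|left; apply: E3b; lia].
rewrite [iota s t.+2]/= -/(iota s.+1 t.+1).
apply: (@cong_nat_trans ([:: s] ++ (j :: iota s.+1 t.+1 ++ [:: j]))).
  by apply: (cong_nat_catl [:: s]); apply: IH => //; lia.
apply: (@cong_nat_cat [::] (iota s.+2 t ++ [:: j]) [:: s; j; s.+1] [:: j; s; s.+1]).
by apply: cong_nat_elem => /=; [lia|lia|left; apply: E3b; lia].
Qed.

(** The letter first travels left to its own copy in the column; one of the two copies then crosses
    the smaller letters. *)
Lemma cong_nat_column_letter m j : j < m <= n -> cong_nat (iota 0 m ++ [:: j]) (j :: iota 0 m).
Proof.
move=> hm; have -> : m = j + (m - j.+1).+1 by lia.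
set r := m - j.+1; rewrite iotaD -catA add0n.
apply: cong_nat_trans; first by apply: cong_nat_catl; apply: cong_nat_push_right; lia.
rewrite [iota j r.+1]/= -/(iota j.+1 r).
have h : cong_nat (iota 0 j ++ [:: j; j]) (j :: iota 0 j ++ [:: j]) by apply: cong_nat_push_left; lia.
by move: (cong_nat_catr (iota j.+1 r) h); rewrite /= -!catA.
Qed.

Lemma cong_nat_column_word m t : m <= n -> all (fun j => j < m) t -> cong_nat (iota 0 m ++ t) (t ++ iota 0 m).
Proof.
move=> hm; elim: t => [|j t IH]; first by rewrite cats0 => _; exact: cong_nat_refl.
move=> /= /andP[hj ht]; apply: (@cong_nat_trans ((j :: iota 0 m) ++ t)).
  by rewrite -cat1s catA; apply/cong_nat_catr/cong_nat_column_letter; rewrite hj.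
by apply: (cong_nat_catl [:: j]); apply: IH.
Qed.

Lemma cong_nat_columns_letter Y j : all (fun h => j < h <= n) Y -> cong_nat (readY Y ++ [:: j]) (j :: readY Y).
Proof.
elim: Y => [|h Y IH] /=; first by move=> _; exact: cong_nat_refl.
move=> /andP[hj hY]; rewrite readY_cons -catA; apply: cong_nat_trans.
  by apply: cong_nat_catl; apply: cong_nat_column_letter hj.
by rewrite -cat1s catA; apply: cong_nat_catr (IH hY).
Qed.

(** The gap passes to the shorter column: the part of the longer one beyond [m'] is a common tail,
    and a column commutes with any word in its own letters. *)
Lemma cong_nat_del_columns q m m' : q < m' -> m' <= m -> m <= n ->
  cong_nat (iota 0 m' ++ del m q) (del m' q ++ iota 0 m).
Proof.
move=> h1 h2 h3.
have -> : del m q = del m' q ++ iota m' (m - m').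
  rewrite /del -catA; congr (_ ++ _).
  have -> : m - q.+1 = (m' - q.+1) + (m - m') by lia.
  by rewrite iotaD subnKC.
have -> : iota 0 m = iota 0 m' ++ iota m' (m - m') by rewrite -iotaD subnKC.
rewrite (catA (iota 0 m')) (catA (del m' q)); apply: cong_nat_catr; apply: cong_nat_column_word; first by lia.
by rewrite /del all_cat; apply/andP; split; apply/allP => x; rewrite mem_iota; lia.
Qed.

Lemma colw_iota k a s m : colw n k (nseq a (true, false) ++ s) m = iota k a ++ colw n (k + a) s m.
Proof.
elim: a k => [|a IH] k /=; first by rewrite addn0.
by rewrite IH cats0 addSnnS.
Qed.

Lemma colw_nil k b : colw n k (nseq b (false, false)) 0 = [::].
Proof. by elim: b k => //= b IH k; rewrite IH. Qed.

Lemma Er_iota a d s m s' m' : Er d s m s' m' ->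
  Er d (nseq a (true, false) ++ s) m (nseq a (true, false) ++ s') m'.
Proof. by move=> h; elim: a => //= a IH; apply: (@ErH _ true). Qed.

Lemma fit_iota a b d : fit d (nseq a (true, false) ++ nseq b (false, false)) 0.
Proof. by elim: a => [|a IH] //=; elim: b d => //= b IH d; apply: IH. Qed.

Lemma cong_nat_bar m q : q < m <= n -> cong_nat (iota 0 m ++ [:: n.*2 - q]) (del m q).
Proof.
move=> hm; apply: cong_nat_elem.
- by rewrite /bnd all_cat; apply/andP; split; last (by rewrite /=; lia);
    apply/allP => x; rewrite mem_iota; lia.
- by rewrite /bnd /del all_cat; apply/andP; split; apply/allP => x; rewrite mem_iota; lia.
(* This is (R5): the path has [q] flat steps, the up step of the pair at rank [q], then flat and
   down steps. *)
right; set t := nseq (m - q.+1) (true, false) ++ nseq (n - m) (false, false).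
exists (nseq q (true, false) ++ (true, true) :: t), 0, (nseq q (true, false) ++ (false, false) :: t), 0.
split.
- by rewrite /t size_cat /= size_cat !size_nseq; lia.
- rewrite colw_iota /= add0n /t colw_iota colw_nil cats0.
  have -> : m = q + (1 + (m - q.+1)) by lia.
  rewrite !iotaD -!catA; congr (_ ++ (_ ++ (_ ++ _))); rewrite ?add0n ?addn1 //.
  by congr iota; lia.
- by rewrite colw_iota /= add0n /t colw_iota colw_nil !cats0.
- by apply/Er_iota/ErP/fit_iota.
Qed.

Lemma cong_nat_zero : cong_nat (iota 0 n ++ [:: n]) (iota 0 n).
Proof.
have hb : bnd n (iota 0 n) by apply/allP => x; rewrite mem_iota; lia.
apply: cong_nat_elem => //; first by rewrite /bnd all_cat; apply/andP; split; [exact: hb|rewrite /=; lia].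
right; exists (nseq n (true, false)), 1, (nseq n (true, false)), 0.
rewrite size_nseq -[nseq n (true, false)]cats0 !colw_iota /= cats0; split=> //.
exact/Er_iota/ErZ.
Qed.

(** The gap left by a barred letter runs through shorter and shorter columns down to one of height
    [q.+1], where it removes the last letter. *)
Lemma cong_nat_del_columns_read q Y m : q < n -> sorted geq (m :: Y) ->
  all (fun h => q < h) (m :: Y) -> m <= n ->
  cong_nat (iota 0 q.+1 ++ readY Y ++ del m q) (iota 0 q ++ readY Y ++ iota 0 m).
Proof.
move=> hq; elim: Y m => [|h Y IH] m hs ha hm.
  have hqm : q < m by case/andP: ha.
  have := @cong_nat_del_columns q m q.+1; rewrite {2}/del subnn cats0; apply; lia.
case/andP: hs => hmh hs; case/andP: ha => hqm ha.
rewrite readY_cons -!catA; apply: (@cong_nat_trans (iota 0 q.+1 ++ readY Y ++ del h q ++ iota 0 m)).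
  by apply: cong_nat_catl; apply: cong_nat_catl; apply: cong_nat_del_columns => //; case/andP: ha.
have := cong_nat_catr (iota 0 m) (IH h hs ha (leq_trans hmh hm)); rewrite -!catA; exact.
Qed.

Lemma cong_nat_bar_columns q Y : q < n -> sorted geq Y -> all (fun h => q < h <= n) Y ->
  cong_nat (iota 0 q.+1 ++ readY Y ++ [:: n.*2 - q]) (iota 0 q ++ readY Y).
Proof.
case: Y => [|m Y] hq hs ha.
  have := @cong_nat_bar q.+1 q; rewrite /del subnn !cats0; apply; lia.
rewrite readY_cons -catA; apply: cong_nat_trans.
  by apply: cong_nat_catl; apply: cong_nat_catl; apply: cong_nat_bar; case/andP: ha.
apply: cong_nat_del_columns_read => //; last by case/andP: ha => /andP[].
by apply: sub_all ha => h /andP[].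
Qed.

(** Only the last letter of the column stays uncancelled; for [h = n] it starts a string of length
    two. *)
Lemma iota_val i h : 1 <= i <= n -> h <= n ->
  (weps (Lc n i) (iota 0 h) = 0) * (wphi (Lc n i) (iota 0 h) = if h == i then (i == n).+1 else 0).
Proof.
move=> hi; elim: h => [|h IH] hh; first by rewrite ifF //; lia.
rewrite -addn1 iotaD add0n weps_cat wphi_cat !IH ?(ltnW hh) // [iota h 1]/=.
rewrite /weps /wphi; case: (LcP h hi) => *; do !case: eqP => //=; lia.
Qed.

Lemma readY_val i Y : 1 <= i <= n -> all (fun h => h <= n) Y ->
  (weps (Lc n i) (readY Y) = 0) * (wphi (Lc n i) (readY Y) = count_mem i Y * (i == n).+1).
Proof.
move=> hi; elim: Y => [//|h Y IH] /= /andP[hh hY].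
rewrite readY_cons weps_cat wphi_cat !(IH hY) !(iota_val hi hh) sub0n subn0.
by split=> //; rewrite mulnDl; case: (h == i); rewrite ?mul1n ?mul0n.
Qed.

Lemma highest_readY_nat w : bnd n w -> (forall i, 1 <= i <= n -> weps (Lc n i) w = 0) ->
  exists Y, [/\ sorted geq Y, all (fun h => 1 <= h <= n) Y & cong_nat w (readY Y)].
Proof.
elim/last_ind: w => [|u a IH] hb hw; first by exists [::]; split=> //; exact: cong_nat_refl.
rewrite -cats1 in hb hw *.
have [bu ba] : bnd n u /\ a <= n.*2 by move: hb; rewrite /bnd all_cat /= andbT => /andP.
have [|Y [sY aY cY]] := IH bu; first by move=> i hi; have := hw i hi; rewrite weps_cat; lia.
have aY' : all (fun h => h <= n) Y by apply: sub_all aY => h /andP[].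
have by' : bnd n (readY Y).
  apply/allP => x /flattenP[t]; rewrite mem_rev => /mapP[h /(allP aY') hh ->].
  by rewrite mem_iota; lia.
have hY i : 1 <= i <= n -> eps (Lc n i) a <= count_mem i Y * (i == n).+1.
  move=> hi; rewrite -(readY_val hi aY').
  have [_ e _ _] := congB_bisim hn hi cY; rewrite !lettersK // in e.
  have := hw i hi; rewrite weps_cat -e /= => h.
  have {}h : eps (Lc n i) a + (0 - phi (Lc n i) a) <= wphi (Lc n i) u by lia.
  by apply: leq_trans h; exact: leq_addr.
have c0 : cong_nat (u ++ [:: a]) (readY Y ++ [:: a]) by apply: cong_nat_catr.
(* The appended letter keeps the word highest only if the tableau cancels its [eps], which takes a
   column of height [i]. *)
have inY i : 1 <= i <= n -> 0 < eps (Lc n i) a -> i \in Y.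
  move=> hi he; have := leq_trans he (hY i hi).
  by rewrite muln_gt0 -has_count => /andP[/hasP[x hx /eqP <-]].
have [a0|a0] := posnP a.
  exists (rcons Y 1); split.
  - rewrite (sorted_pairwise (rev_trans leq_trans)) pairwise_rcons.
    rewrite -(sorted_pairwise (rev_trans leq_trans)) sY andbT.
    by apply: sub_all aY => h /andP[].
  - by rewrite all_rcons aY /=; lia.
  - apply: cong_nat_trans c0 _; rewrite -cats1 readY_cat a0; apply: cong_nat_columns_letter.
    by apply: sub_all aY.
have sP : pairwise geq Y by rewrite -(sorted_pairwise (rev_trans leq_trans)).
(* An unbarred letter lengthens a column of height [a], a barred one shortens a column of height
   [q.+1], and the letter 0 is absorbed by a column of height [n]. *)
have [an|an|ean] := ltngtP a n.
- have hi : 1 <= a <= n by lia.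
  have [|Y1 [Y2 [eY hY1]]] := sorted_first_occ sY (inY a hi _).
    by rewrite (Lc_val hi (@LcL' n a a an erefl)).
  exists (Y1 ++ a.+1 :: Y2); move: sP aY; rewrite eY !pairwise_cat !all_cat /= !allrel_consr.
  move=> /and3P[/andP[_ h1] h2 /andP[h3 h4]] /and3P[h5 _ h6]; split.
  + rewrite (sorted_pairwise (rev_trans leq_trans)) pairwise_cat /= allrel_consr h1 h2 h4 hY1 /= andbT.
    by apply: sub_all h3 => x; exact: leqW.
  + by rewrite h5 h6 an.
  + apply: cong_nat_trans c0 _; rewrite eY !readY_cat !readY_cons -!catA; apply: cong_nat_catl.
    have -> : iota 0 a.+1 = iota 0 a ++ [:: a] by rewrite -addn1 iotaD.
    rewrite -catA; apply: cong_nat_catl; apply: cong_nat_columns_letter.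
    by apply/allP => x hx; rewrite (allP hY1) //; case/andP: (allP h5 x hx).
- set q := n.*2 - a; have hi : 1 <= q.+1 <= n by lia.
  have [|Y1 [Y2 [eY hY2]]] := sorted_last_occ sY (inY q.+1 hi _).
    have [hq|hq] := ltnP q.+1 n.
      by rewrite (Lc_val hi (@LcR n q.+1 a hq _)) //; lia.
    by rewrite (Lc_val hi (@LcNb n q.+1 a _ _)) //; lia.
  have ea : a = n.*2 - q by lia.
  move: sP aY; rewrite eY !pairwise_cat !all_cat /= !allrel_consr.
  move=> /and3P[/andP[h0 h1] h2 /andP[h3 h4]] /and3P[h5 _ h6].
  have sY1 : sorted geq Y1 by rewrite (sorted_pairwise (rev_trans leq_trans)).
  have aY1 : all (fun h => q < h <= n) Y1.
    apply/allP => x hx; have /andP[_ hx2] := allP h5 x hx.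
    by have hx1 : q < x := allP h0 x hx; rewrite hx1.
  have cY1 : cong_nat (readY Y ++ [:: a]) (readY Y2 ++ iota 0 q ++ readY Y1).
    rewrite eY readY_cat readY_cons -!catA; apply: cong_nat_catl; rewrite ea.
    by apply: cong_nat_bar_columns => //; lia.
  (* For [q = 0] the column of height 1 vanishes; it was the last one, since [Y2] has only positive
     heights below 1. *)
  have [q0|q0] := posnP q.
    exists Y1; split=> //.
    apply: cong_nat_trans c0 (cong_nat_trans cY1 _); rewrite q0 /=.
    case: Y2 {eY h1 h3 h4 cY1} hY2 h6 => [|y Y2] /=; first by move=> *; exact: cong_nat_refl.
    by move=> /andP[g1 _] /andP[g2 _]; lia.
  exists (Y1 ++ q :: Y2); split.
  + rewrite (sorted_pairwise (rev_trans leq_trans)) pairwise_cat /= allrel_consr h1 h2 h4 /= andbT.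
    rewrite andbT; apply/andP; split; first by apply: sub_all h0 => x; exact: ltnW.
    by apply: sub_all hY2.
  + by case/andP: hi => _ hi; rewrite all_cat /= h5 h6 q0 (ltnW hi).
  + by apply: cong_nat_trans c0 (cong_nat_trans cY1 _); rewrite readY_cat readY_cons -catA; exact: cong_nat_refl.
- have hi : 1 <= n <= n by lia.
  have [|Y1 [Y2 [eY hY1]]] := sorted_first_occ sY (inY n hi _).
    by rewrite ean (Lc_val hi (@Lc0 n n n erefl erefl)).
  have e1 : Y1 = [::].
    case: Y1 eY hY1 => // y Y1 eY /andP[h1 _]; move: aY'; rewrite eY /= => /andP[]; lia.
  exists Y; split=> //; apply: cong_nat_trans c0 _; rewrite eY e1 /= readY_cons -catA ean.
  by apply: cong_nat_catl; exact: cong_nat_zero.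
Qed.
End Insertion.

(** * Orthogonal tableaux and the plactic congruence *)

(** The empty word is allowed; [readsP] restores nonemptiness through the heights, which the
    operators preserve. *)
Definition colN n v := exists s m, size s = n /\ v = colw n 0 s m.

Lemma colN_dn n i v : 1 <= i <= n -> colN n v ->
  (0 < wphi (Lc n i) v -> colN n (wdn (Lc n i) v)) /\
  (0 < weps (Lc n i) v -> colN n (wup (Lc n i) v)).
Proof.
move=> hi [s [m [es ->]]].
have [c1 c2 c3 c4] := @colw_ok n i hi i.-1 0 s m ltac:(by []) ltac:(lia) ltac:(by rewrite es; lia).
rewrite c1 c2; split=> h; rewrite ?c3 ?c4 //.
  by do 2 eexists; split; last by []; rewrite sdn_size.
by do 2 eexists; split; last by []; rewrite sup_size.
Qed.

Definition colsN n (L : seq (seq nat)) := forall v, v \in L -> colN n v.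

Lemma colsN_dn n i L : 1 <= i <= n -> colsN n L -> 0 < wphi (Lc n i) (flatten L) ->
  exists L', [/\ wdn (Lc n i) (flatten L) = flatten L', colsN n L' & map size L' = map size L].
Proof.
move=> hi; elim: L => [//|v L IH] hL /=; rewrite wphi_cat wdn_cat => h0.
have hv : colN n v by apply: hL; rewrite mem_head.
have {}hL : colsN n L by move=> u hu; apply: hL; rewrite in_cons hu orbT.
case: ifP => h.
  exists (wdn (Lc n i) v :: L); rewrite /= size_wdn; split=> // u.
  rewrite in_cons => /orP[/eqP->|/hL //]; apply: (colN_dn hi hv).1.
  exact: leq_ltn_trans h.
have [L' [-> h2 h3]] := IH hL ltac:(lia).
exists (v :: L'); rewrite /= h3; split=> // u.
by rewrite in_cons => /orP[/eqP->|/h2].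
Qed.

Lemma colsN_up n i L : 1 <= i <= n -> colsN n L -> 0 < weps (Lc n i) (flatten L) ->
  exists L', [/\ wup (Lc n i) (flatten L) = flatten L', colsN n L' & map size L' = map size L].
Proof.
move=> hi; elim: L => [//|v L IH] hL /= h0; rewrite (wup_cat h0).
have hv : colN n v by apply: hL; rewrite mem_head.
have {}hL : colsN n L by move=> u hu; apply: hL; rewrite in_cons hu orbT.
rewrite weps_cat in h0; case: ifP => h; last first.
  exists (wup (Lc n i) v :: L); rewrite /= size_wup; split=> // u.
  rewrite in_cons => /orP[/eqP->|/hL //]; apply: (colN_dn hi hv).2.
  by move: h h0; lia.
have [L' [-> h2 h3]] := IH hL (leq_ltn_trans (leq0n _) h).
exists (v :: L'); rewrite /= h3; split=> // u.
by rewrite in_cons => /orP[/eqP->|/h2].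
Qed.

Section Assembly.
Variable n : nat.
Hypothesis hn : 2 <= n.
Implicit Types (w x y h : word n) (T : seq (word n)).

Definition reads (S : seq nat) x :=
  exists T, [/\ all (isColumn n) T, map size T = S & readT n T = x].

Lemma isColumn_colN w : isColumn n w <-> w <> [::] /\ colN n (ranks w).
Proof.
split=> [h|[h [s [m [es e]]]]]; last exact: colw_column e h.
split; last by have [s [m ?]] := column_colw h; exists s, m.
by move: h; rewrite isColumnE => /andP[/eqP].
Qed.

Lemma ranks_flatten (L : seq (word n)) : ranks (flatten L) = flatten (map ranks L).
Proof. by elim: L => //= w L IH; rewrite ranks_cat IH. Qed.

Lemma letters_flatten (L : seq (seq nat)) : letters n (flatten L) = flatten (map (letters n) L).
Proof. by elim: L => //= w L IH; rewrite letters_cat IH. Qed.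

Lemma size_ranks w : size (ranks w) = size w.
Proof. exact: size_map. Qed.

Lemma map_size_ranks (L : seq (word n)) : map size (map ranks L) = map size L.
Proof. by rewrite -map_comp; apply: eq_map => w; exact: size_ranks. Qed.

Lemma readsP S x : reads S x <->
  exists L, [/\ colsN n L, map size L = rev S, all (leq 1) S & ranks x = flatten L].
Proof.
split=> [[T [cT <- <-]]|[L [cL sL pS ex]]].
  exists (map ranks (rev T)); rewrite -ranks_flatten; split=> //.
  - by move=> v /mapP[w]; rewrite mem_rev => /(allP cT)/isColumn_colN[_ h] ->.
  - by rewrite map_size_ranks map_rev.
  - apply/allP => k /mapP[w /(allP cT) cw ->].
    by rewrite lt0n size_eq0; move: cw; rewrite isColumnE => /andP[].
have bL v : v \in L -> bnd n v.
  move=> hv; apply/allP => a ha; apply: (allP (ranks_bnd x)).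
  by rewrite ex; apply/flattenP; exists v.
exists (rev (map (letters n) L)); split.
- rewrite all_rev; apply/allP => w /mapP[v hv ->].
  apply/isColumn_colN; rewrite lettersK ?bL //; split; last exact: cL.
  move=> e; have : size v \in rev S by rewrite -sL map_f.
  rewrite mem_rev => /(allP pS).
  by have <- : size (letters n v) = size v by [exact: size_map]; rewrite e.
- rewrite map_rev -[S]revK -sL; congr rev; rewrite -map_comp; apply: eq_map => v.
  exact: size_map.
- by apply: ranks_inj; rewrite /readT revK -letters_flatten lettersK ?ex // -ex ranks_bnd.
Qed.

(** An operator acts inside one factor and keeps it a column of the same height, so a cutting into
    columns is transported along a component. *)
Lemma reads_conn S x y : connB n x y -> reads S x <-> reads S y.
Proof.
elim=> {x y} [x y [i [hi e]]|x|x y _ h|x y z _ h1 _ h2] //; last first.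
- by rewrite h1.
- by rewrite h.
rewrite !readsP; split=> -[L [h1 h2 h3 h4]].
  have [h5 ->] := (fBP hi _ _).1 e; rewrite h4 in h5 *.
  by have [L' [-> g2 g3]] := colsN_dn hi h1 h5; exists L'; rewrite g3.
have [h5 ->] := (eBP hi _ _).1 ((fBK hi _ _).1 e); rewrite h4 in h5 *.
by have [L' [-> g2 g3]] := colsN_up hi h1 h5; exists L'; rewrite g3.
Qed.

Lemma fB_range i w w' : fB n i w = Some w' -> 1 <= i <= n.
Proof.
case hi : (1 <= i <= n) => //; rewrite /fB; elim: w w' => [//|a v IH] w'.
rewrite [size _]/= fW_cons.
have -> : strlen (fL n i) 2 a = 0 by rewrite /= /fL hi.
rewrite ltn0.
by case: (fW n i (size v) v) IH => //= u /(_ u erefl).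
Qed.

Lemma fB_conn i w w' : fB n i w = Some w' -> connB n w w'.
Proof. by move=> e; apply: rst_step; exists i; split=> //; exact: fB_range e. Qed.

Lemma fseq_conn s h w : fseqB n s h = Some w -> connB n h w.
Proof.
elim: s w => [|i s IH] w /=; first by case=> ->; exact: rst_refl.
case E : (fseqB n s h) => [y|] //= e; exact: rst_trans (IH y E) (fB_conn e).
Qed.

Lemma fseq_cong s h1 h2 w1 : congB n h1 h2 -> fseqB n s h1 = Some w1 ->
  exists2 w2, fseqB n s h2 = Some w2 & congB n w1 w2.
Proof.
move=> c; elim: s w1 => [|i s IH] w1 /=; first by case=> <-; exists h2.
case E : (fseqB n s h1) => [y|] //= e; have [y2 -> c2] := IH y E.
by have [_ _ /(_ _ e)] := congB_bisim hn (fB_range e) c2.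
Qed.

(** A chosen path to the top, given as a function so that the isomorphism in [congB_simB] is defined
    without choice. *)
Fixpoint topseq k w : seq nat :=
  if k is k'.+1 then
    let i := (find (fun j => isSome (eB n j w)) (iota 1 n)).+1 in
    if eB n i w is Some y then i :: topseq k' y else [::]
  else [::].

Lemma eB_sum i w y : 1 <= i <= n -> eB n i w = Some y -> sumn (ranks y) < sumn (ranks w).
Proof.
move=> hi /(eBP hi)[h ->]; elim: (ranks w) h => [//|a v IH] /= h.
case: ifP => h1 /=; first by rewrite ltn_add2l IH //; lia.
have [h2 _] := @Lc_up n i a hi ltac:(lia).
by rewrite ltn_add2r upE prednK.
Qed.

Lemma topseqP k w : sumn (ranks w) < k ->
  exists h, [/\ highestB n h, connB n w h & fseqB n (topseq k w) h = Some w].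
Proof.
elim: k w => [//|k IH] w hk /=.
set f := fun j => isSome (eB n j w); set i := (find f (iota 1 n)).+1.
case: (boolP (has f (iota 1 n))) => hf.
  have hi : 1 <= i <= n by move: hf; rewrite has_find size_iota.
  have := nth_find 0 hf; rewrite nth_iota ?add1n -/i; last by lia.
  rewrite /f; case E : (eB n i w) => [y|] // _.
  have [|h [h1 h2 h3]] := IH y; first by have := eB_sum hi E; lia.
  have e : fB n i y = Some w by apply/(fBK hi).
  exists h; split=> //=; last by rewrite h3.
  by apply: rst_trans h2; apply/rst_sym/(fB_conn e).
have hw : highestB n w.
  move=> j hj; move/hasPn/(_ j): hf; rewrite mem_iota /f add1n ltnS => /(_ hj).
  by case: (eB n j w).
(* A failed search gives [i = n.+1], where no operator is defined. *)
have -> : eB n i w = None.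
  have ei : i = n.+1 by rewrite /i (hasNfind hf) size_iota.
  rewrite ei /eB; elim: (w) => [//|a v IHv].
  by rewrite [size _]/= eW_cons IHv /eL ltnn andbF; case: ifP.
by exists w; split=> //; exact: rst_refl.
Qed.

Lemma highest_cong h1 h2 : congB n h1 h2 -> highestB n h1 -> highestB n h2.
Proof.
move=> c hh i hi; have [e _ _ _] := congB_bisim hn hi c.
by apply/(eB_None hi); rewrite -e; apply/(eB_None hi)/hh.
Qed.

Lemma top_pair w1 w2 : congB n w1 w2 -> exists h1 h2 s,
  [/\ connB n w1 h1, connB n w2 h2, highestB n h1, highestB n h2 &
   [/\ fseqB n s h1 = Some w1, fseqB n s h2 = Some w2 & congB n h1 h2]].
Proof.
have [k] := ubnP (sumn (ranks w1)); elim: k w1 w2 => // k IH w1 w2 hk c.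
case: (boolP (has (fun j => isSome (eB n j w1)) (iota 1 n))) => hf.
  have [i] := hasP hf; rewrite mem_iota add1n ltnS => hi.
  case E : (eB n i w1) => [y1|] // _.
  have [_ _ _ /(_ _ E)[y2 E2 c2]] := congB_bisim hn hi c.
  have [|h1 [h2 [s [a1 a2 a3 a4 [a5 a6 a7]]]]] := IH y1 y2 _ c2.
    by have := eB_sum hi E; lia.
  have e1 : fB n i y1 = Some w1 by apply/(fBK hi).
  have e2 : fB n i y2 = Some w2 by apply/(fBK hi).
  exists h1, h2, (i :: s); split=> //=.
  - by apply: rst_trans a1; apply/rst_sym/(fB_conn e1).
  - by apply: rst_trans a2; apply/rst_sym/(fB_conn e2).
  - by rewrite a5 a6.
have hw : highestB n w1.
  move=> j hj; move/hasPn/(_ j): hf; rewrite mem_iota add1n ltnS => /(_ hj).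
  by case: (eB n j w1).
exists w1, w2, [::]; split=> //; try exact: rst_refl.
exact: highest_cong hw.
Qed.

(** Both words descend by the same sequence of operators from the only highest weight word of their
    component. *)
Lemma cong_conn_eq y1 y2 : congB n y1 y2 -> connB n y1 y2 -> y1 = y2.
Proof.
move=> c d; have [h1 [h2 [s [a1 a2 a3 a4 [a5 a6 a7]]]]] := top_pair c.
have e : h1 = h2.
  apply: (highestB_uniq hn) => //; apply: rst_trans (rst_sym _ _ _ _ a1) _.
  exact: rst_trans d a2.
by move: a5; rewrite e a6 => -[].
Qed.

Lemma congB_simB w1 w2 : congB n w1 w2 -> simB n w1 w2.
Proof.
move=> c; have [h1 [h2 [s0 [a1 a2 a3 a4 [a5 a6 a7]]]]] := top_pair c.
split; last by exists h1, h2, s0.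
(* The path from [h1] down to [x] is replayed from [h2]. On the component of [w1] it is always
   defined, so the default value is not met there. *)
pose phi x := odflt x (fseqB n (topseq (sumn (ranks x)).+1 x) h2).
have P x : connB n w1 x -> congB n x (phi x) /\ connB n w2 (phi x).
  move=> cx; have [h [b1 b2 b3]] := topseqP (ltnSn (sumn (ranks x))).
  have e : h = h1.
    apply: (highestB_uniq hn) => //; apply: rst_trans (rst_sym _ _ _ _ b2) _.
    exact: rst_trans (rst_sym _ _ _ _ cx) a1.
  rewrite e in b3; have [y2 e2 c2] := fseq_cong a7 b3.
  by rewrite /phi e2 /=; split=> //; exact: rst_trans a2 (fseq_conn e2).
have eqc y y' : congB n y y' -> connB n w2 y -> connB n w2 y' -> y = y'.
  by move=> d d1 d2; apply: cong_conn_eq => //; exact: rst_trans (rst_sym _ _ _ _ d1) d2.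
have eqc1 y y' : congB n y y' -> connB n w1 y -> connB n w1 y' -> y = y'.
  by move=> d d1 d2; apply: cong_conn_eq => //; exact: rst_trans (rst_sym _ _ _ _ d1) d2.
exists phi; split.
- by move=> x /P[].
- move=> x y cx cy e; apply: eqc1 => //.
  have [dx _] := P x cx; have [dy _] := P y cy.
  by apply: rst_trans dx _; rewrite e; exact: rst_sym.
- move=> y cy; have [h [b1 b2 b3]] := topseqP (ltnSn (sumn (ranks y))).
  have e : h = h2.
    apply: (highestB_uniq hn) => //; apply: rst_trans (rst_sym _ _ _ _ b2) _.
    exact: rst_trans (rst_sym _ _ _ _ cy) a2.
  rewrite e in b3; have [x ex cx] := fseq_cong (rst_sym _ _ _ _ a7) b3.
  have dx : connB n w1 x by exact: rst_trans a1 (fseq_conn ex).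
  exists x => //; have [d1 d2] := P x dx; apply: eqc => //.
  exact: rst_trans (rst_sym _ _ _ _ d1) (rst_sym _ _ _ _ cx).
- move=> x y i cx cy hi; have [d1 d2] := P x cx; have [g1 g2] := P y cy; split=> e.
    have [_ _ /(_ _ e)[y' e' c'] _] := congB_bisim hn hi d1.
    rewrite e'; congr Some; apply: eqc => //; last by exact: rst_trans d2 (fB_conn e').
    exact: rst_trans (rst_sym _ _ _ _ c') g1.
  have [_ _ /(_ _ e)[y' e' c'] _] := congB_bisim hn hi (rst_sym _ _ _ _ d1).
  rewrite e'; congr Some; apply: eqc1 => //; last by exact: rst_trans cx (fB_conn e').
  exact: rst_trans (rst_sym _ _ _ _ c') (rst_sym _ _ _ _ g1).
Qed.

Definition rdY Y := readT n (map (colTY n) Y).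

Lemma rdYE Y : rdY Y = letters n (readY Y).
Proof. by rewrite /rdY /readT /readY letters_flatten map_rev -map_comp. Qed.

Lemma highest_rdY h : highestB n h -> exists Y,
  [/\ sorted geq Y, all (fun k => 1 <= k <= n) Y & congB n h (rdY Y)].
Proof.
move=> hh; have [|Y [h1 h2 h3]] := highest_readY_nat hn (ranks_bnd h).
  by move=> i hi; apply/(eB_None hi)/hh.
by exists Y; split=> //; rewrite rdYE -[h]ranksK.
Qed.

Lemma ranks_rdY Y : all (fun k => k <= n) Y -> ranks (rdY Y) = readY Y.
Proof.
move=> hY; rewrite rdYE lettersK //; apply/allP => x /flattenP[t].
rewrite mem_rev => /mapP[k /(allP hY) hk ->]; rewrite mem_iota; lia.
Qed.

Lemma rdY_highest Y : all (fun k => k <= n) Y -> highestB n (rdY Y).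
Proof. by move=> hY i hi; apply/(eB_None hi); rewrite ranks_rdY // (readY_val hn hi hY). Qed.

Lemma rdY_phi_inj Y Y' : all (fun k => 1 <= k <= n) Y -> all (fun k => 1 <= k <= n) Y' ->
  sorted geq Y -> sorted geq Y' ->
  (forall i, 1 <= i <= n -> wphi (Lc n i) (ranks (rdY Y)) = wphi (Lc n i) (ranks (rdY Y'))) -> Y = Y'.
Proof.
move=> aY aY' sY sY' h.
have le1 : subpred (fun k => 1 <= k <= n) (fun k => k <= n) by move=> k /andP[].
apply: (sorted_eq (rev_trans leq_trans)) => //; first by move=> a b; rewrite andbC => /anti_leq.
apply/allP => k _ /=; case hk : (1 <= k <= n).
  have := h k hk; rewrite !ranks_rdY ?(sub_all le1) // !(readY_val hn hk) ?(sub_all le1) //.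
  by move/eqP; rewrite eqn_pmul2r.
rewrite (count_memPn _) ?(count_memPn _) //.
- by apply/negP => /(allP aY'); rewrite hk.
- by apply/negP => /(allP aY); rewrite hk.
Qed.

(** By uniqueness the isomorphism matches the two highest weight words. It preserves their [wphi],
    so both are congruent to one tableau, and the common sequence [s] carries this congruence
    down. *)
Lemma simB_congB w1 w2 : simB n w1 w2 -> congB n w1 w2.
Proof.
move=> [[phi [p1 p2 p3 p4]] [h1 [h2 [s [c1 g1 c2 g2 [e1 e2]]]]]].
have fdef x i : connB n w1 x -> 1 <= i <= n -> fB n i x = None <-> fB n i (phi x) = None.
  move=> cx hi; split=> e.
    case E : (fB n i (phi x)) => [z|] //.
    have cz : connB n w2 z by exact: rst_trans (p1 x cx) (fB_conn E).
    have [y cy ey] := p3 z cz; move: E; rewrite -ey => /(p4 x y i cx cy hi).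
    by rewrite e.
  case E : (fB n i x) => [z|] //.
  have cz : connB n w1 z by exact: rst_trans cx (fB_conn E).
  by move/(p4 x z i cx cz hi): E; rewrite e.
have hphi : highestB n (phi h1).
  move=> i hi; case E : (eB n i (phi h1)) => [z|] //.
  move/(fBK hi): E => E.
  have cz : connB n w2 z.
    exact: rst_trans (p1 h1 c1) (rst_sym _ _ _ _ (fB_conn E)).
  have [y cy ey] := p3 z cz; move: E; rewrite -ey => /(p4 y h1 i cy c1 hi)/(fBK hi).
  by rewrite g1.
have ephi : phi h1 = h2.
  apply: (highestB_uniq hn) => //.
  exact: rst_trans (rst_sym _ _ _ _ (p1 h1 c1)) c2.
(* The two strings are walked down together; by [fdef] they end at the same time. *)
have wphi_eq i x : 1 <= i <= n -> connB n w1 x -> wphi (Lc n i) (ranks x) = wphi (Lc n i) (ranks (phi x)).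
  move=> hi; move ek : (wphi _ (ranks x)) => k; elim: k x ek => [|k IH] x ek cx.
    have e : fB n i x = None by rewrite fB_wdn // ek.
    by move/(fdef x i cx hi): e; rewrite fB_wdn //; case: (wphi _ _).
  have E : fB n i x = Some (letters n (wdn (Lc n i) (ranks x))) by rewrite fB_wdn // ek.
  set y := letters n _ in E; have cy : connB n w1 y by exact: rst_trans cx (fB_conn E).
  have E' := (p4 x y i cx cy hi).1 E.
  have [q1 q2] := (fBP hi _ _).1 E; have [q1' q2'] := (fBP hi _ _).1 E'.
  have [_ r _] := wdn_spec hi q1; have [_ r' _] := wdn_spec hi q1'.
  rewrite -q2 in r; rewrite -q2' in r'; rewrite -r' -(IH y) //.
  by move: r; rewrite ek => -[].
have [Y1 [s1 a1 d1]] := highest_rdY g1; have [Y2 [s2 a2 d2]] := highest_rdY g2.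
have eY : Y1 = Y2.
  apply: rdY_phi_inj => // i hi.
  have [_ <- _ _] := congB_bisim hn hi d1; have [_ <- _ _] := congB_bisim hn hi d2.
  by rewrite (wphi_eq i h1 hi c1) ephi.
have c : congB n h1 h2 by apply: rst_trans d1 _; rewrite eY; exact: rst_sym.
by have [w e c'] := fseq_cong c e1; move: e; rewrite e2 => -[->].
Qed.

Lemma TY_rdY T : readT n (TY n T) = rdY (map size T).
Proof. by rewrite /rdY -map_comp. Qed.

(** The tops of the two readings are the fillings of the two shapes; being congruent they have equal
    [wphi], so the shapes agree. The readings then lie in one component, hence are equal, and the
    shape cuts them into the same columns. *)
Lemma orthTab_uniq T T' : orthTab n T -> orthTab n T' -> congB n (readT n T) (readT n T') -> T = T'.
Proof.
move=> [[cT sT] aT dT] [[cT' sT'] aT' dT'] c.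
have pos T0 : all (isColumn n) T0 -> all (fun C => size C <= n) T0 ->
    all (fun k => 1 <= k <= n) (map size T0) /\ all (fun k => k <= n) (map size T0).
  move=> h1 h2; rewrite !all_map; split=> //; apply/allP => C hC /=.
  by rewrite (allP h2 C hC) andbT lt0n size_eq0; case/andP: (allP h1 C hC).
have [u1 u2] := pos T cT aT; have [u1' u2'] := pos T' cT' aT'.
rewrite !TY_rdY in dT dT'.
have [h1 [h2 [s [a1 a2 a3 a4 [a5 a6 a7]]]]] := top_pair c.
have e1 : h1 = rdY (map size T).
  apply: (highestB_uniq hn) => //; last exact: rdY_highest.
  exact: rst_trans (rst_sym _ _ _ _ a1) dT.
have e2 : h2 = rdY (map size T').
  apply: (highestB_uniq hn) => //; last exact: rdY_highest.
  exact: rst_trans (rst_sym _ _ _ _ a2) dT'.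
have es : map size T = map size T'.
  apply: rdY_phi_inj => // i hi; rewrite -e1 -e2.
  by have [] := congB_bisim hn hi a7.
have er : readT n T = readT n T'.
  apply: cong_conn_eq => //; apply: rst_trans dT _; rewrite es; exact: rst_sym.
have : rev T = rev T'.
  apply: eq_from_flatten_shape => //.
  by rewrite /shape !map_rev es.
by move/(congr1 rev); rewrite !revK.
Qed.

Lemma orthTab_exists w : exists T, orthTab n T /\ simB n (readT n T) w.
Proof.
have [h [h1 h2 h3]] := topseqP (ltnSn (sumn (ranks w))).
have [Y [sY aY cY]] := highest_rdY h1.
have [t et ct] := fseq_cong cY h3.
(* The filled shape is cut into columns by construction; [reads_conn] carries this cutting to [t],
   the word at the place of [w] in its component. *)
have : reads Y (rdY Y).
  exists (map (colTY n) Y); split=> //; last first.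
    by rewrite -map_comp -[RHS]map_id; apply: eq_map => k /=; rewrite size_map size_iota.
  rewrite all_map; apply/allP => k /(allP aY)/andP[k1 kn] /=.
  apply/isColumn_colN; split.
    by move/(congr1 size); rewrite size_map size_iota => /= k0; rewrite k0 in k1.
  exists (nseq k (true, false) ++ nseq (n - k) (false, false)), 0.
  rewrite size_cat !size_nseq subnKC //; split=> //.
  rewrite colw_iota colw_nil cats0 -[colTY n k]/(letters n (iota 0 k)) lettersK //.
  by apply/allP => x; rewrite mem_iota; lia.
move/(reads_conn Y (fseq_conn et)) => [T [cT sT eT]].
exists T; split; last by rewrite eT; apply/congB_simB/rst_sym.
split; first by split=> //; rewrite sT.
  by apply/allP => C hC; have /(allP aY)/andP[] : size C \in Y by rewrite -sT map_f.
by rewrite eT TY_rdY sT; apply/rst_sym/(fseq_conn et).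
Qed.
End Assembly.

Theorem mainTheorem8 (n : nat) : 2 <= n ->
  (forall w : word n, exists! T : seq (word n), orthTab n T /\ simB n (readT n T) w) /\
  (forall (w1 w2 : word n) (T1 T2 : seq (word n)),
     orthTab n T1 -> simB n (readT n T1) w1 ->
     orthTab n T2 -> simB n (readT n T2) w2 ->
     (simB n w1 w2 <-> congB n w1 w2) /\ (congB n w1 w2 <-> T1 = T2)).
Proof.
move=> hn; split=> [w|w1 w2 T1 T2 o1 s1 o2 s2].
  have [T [o s]] := orthTab_exists hn w; exists T; split=> // T' [o' s'].
  apply: (orthTab_uniq hn o o'); apply: rst_trans (simB_congB hn s) _.
  exact/rst_sym/(simB_congB hn s').
have c1 := simB_congB hn s1; have c2 := simB_congB hn s2.
split; first by split; [exact: simB_congB|exact: congB_simB].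
split=> [c|e].
  apply: (orthTab_uniq hn o1 o2); apply: rst_trans c1 _; apply: rst_trans c _.
  exact: rst_sym.
by apply: rst_trans (rst_sym _ _ _ _ c1) _; rewrite e.
Qed.
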